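(* Let $R$ be a ring, let $M$ be an $N$-nilpotent $R$-bimodule for some integer $N\ge 0$, and let $T_R(M)$ be its tensor ring. Let $\mathcal X$ be a class of $R$-modules containing all projective $R$-modules and let $\mathcal Y$ be a class of $R^{\mathrm{op}}$-modules containing all injective $R^{\mathrm{op}}$-modules. (1) Suppose that $M$ is compatible and admissible with respect to $\mathcal X$. Then $\mathrm{Ind}(\mathcal X)\text{-}\mathsf{GP}(T_R(M))=\Phi(\mathcal X\text{-}\mathsf{GP}(R))$. (2) Suppose that $M$ is co-compatible and co-admissible with respect to $\mathcal Y$. Then $\mathrm{Coind}(\mathcal Y)\text{-}\mathsf{GI}(T_R(M)^{\mathrm{op}})=\Psi(\mathcal Y\text{-}\mathsf{GI}(R^{\mathrm{op}}))$.
   Context: Rings are nonzero, associative and unital. ''$R$-module'' means left $R$-module; right $R$-modules are viewed as $R^{\mathrm{op}}$-modules. Tensor rings. For an $R$-bimodule $M$ put $M^{\otimes_R 0}=R$, $M^{\otimes_R(i+1)}=M\otimes_R M^{\otimes_R i}$. $M$ is $N$-nilpotent if $M^{\otimes_R(N+1)}=0$; then $T_R(M)=\bigoplus_{i=0}^N M^{\otimes_R i}$ is the tensor ring. A $T_R(M)$-module is identified with a pair $(X,u)$, $X$ an $R$-module and $u:M\otimes_R X\to X$ an $R$-homomorphism; morphisms $(X,u)\to(X',u')$ are $R$-homomorphisms $f:X\to X'$ with $f\circ u=u'\circ(M\otimes f)$. A $T_R(M)^{\mathrm{op}}$-module is identified with a pair $[Y,v]$, $Y$ an $R^{\mathrm{op}}$-module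 and $v:Y\to \mathrm{Hom}_{R^{\mathrm{op}}}(M,Y)$ an $R^{\mathrm{op}}$-homomorphism; morphisms $[Y,v]\to[Y',v']$ are $R^{\mathrm{op}}$-homomorphisms $g$ with $\mathrm{Hom}_{R^{\mathrm{op}}}(M,g)\circ v=v'\circ g$. $U$ denotes the forgetful functors to $R$-modules, resp. $R^{\mathrm{op}}$-modules: $U(X,u)=X$, $U[Y,v]=Y$. $\mathrm{Ind}(X)=T_R(M)\otimes_R X$, i.e. $\bigoplus_{i=0}^N M^{\otimes_R i}\otimes_R X$ with structure map the inclusion of $\bigoplus_{i=1}^N M^{\otimes_R i}\otimes_R X$. $\mathrm{Coind}(Y)=\mathrm{Hom}_{R^{\mathrm{op}}}(T_R(M),Y)$. Put $\mathrm{Ind}(\mathcal X)=\{\mathrm{Ind}(X)\mid X\in\mathcal X\}$ and $\mathrm{Coind}(\mathcal Y)=\{\mathrm{Coind}(Y)\mid Y\in\mathcal Y\}$. For a class $\mathsf X$ of $R$-modules, $\Phi(\mathsf X)$ is the class of $T_R(M)$-modules $(X,u)$ with $u$ a monomorphism and $\mathrm{coker}(u)\in\mathsf X$. For a class $\mathsf Y$ of $R^{\mathrm{op}}$-modules, $\Psi(\mathsf Y)$ is the class of $T_R(M)^{\mathrm{op}}$-modules $[Y,v]$ with $v$ an epimorphism and $\ker(v)\in\mathsf Y$. Relative Gorenstein modules. Let $S$ be a ring. For a class $\mathcal W$ of $S$-modules containing the projectives, a $\mathcal W$-complete projective resolution is an exact complex $P^\bullet$ of projective $S$-modules such that $\mathrm{Hom}_S(P^\bullet,W)$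 is exact for every $W\in\mathcal W$; an $S$-module is $\mathcal W$-Gorenstein projective if it is isomorphic to $\mathrm{Im}(P^{-1}\to P^0)$ for such a $P^\bullet$. $\mathcal W\text{-}\mathsf{GP}(S)$ is the class of these modules. For a class $\mathcal V$ of $S^{\mathrm{op}}$-modules containing the injectives, a $\mathcal V$-complete injective resolution is an exact complex $I^\bullet$ of injective $S^{\mathrm{op}}$-modules such that $\mathrm{Hom}_{S^{\mathrm{op}}}(V,I^\bullet)$ is exact for every $V\in\mathcal V$; an $S^{\mathrm{op}}$-module is $\mathcal V$-Gorenstein injective if it is isomorphic to $\ker(I^0\to I^1)$ for such an $I^\bullet$. $\mathcal V\text{-}\mathsf{GI}(S^{\mathrm{op}})$ is the class of these modules. $M$ is compatible with respect to $\mathcal X$ if for every $\mathrm{Ind}(\mathcal X)$-complete projective resolution $Q^\bullet$ of $T_R(M)$-modules: the complex $M\otimes_R U(Q^\bullet)$ is exact, and the complex $\mathrm{Hom}_{T_R(M)}(Q^\bullet,\mathrm{Ind}(M\otimes_R X))$ is exact for each $X\in\mathcal X$. $M$ is admissible with respect to $\mathcal X$ if $\mathrm{Ext}^1_R(G,M^{\otimes_R i}\otimes_R X)=0=\mathrm{Tor}_1^R(M,M^{\otimes_R i}\otimes_R G)$ for all $G\in\mathcal X\text{-}\mathsf{GP}(R)$, $X\in\mathcal X$, $i\ge 0$. $M$ is co-compatible with respect to $\mathcal Y$ if for every $\mathrm{Coind}(\mathcal Y)$-complete injective resolution $I^\bullet$ of $T_R(M)^{\mathrm{op}}$-modules: the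 complex $\mathrm{Hom}_{R^{\mathrm{op}}}(M,U(I^\bullet))$ is exact, and the complex $\mathrm{Hom}_{T_R(M)^{\mathrm{op}}}(\mathrm{Coind}(\mathrm{Hom}_{R^{\mathrm{op}}}(M,Y)),I^\bullet)$ is exact for each $Y\in\mathcal Y$. $M$ is co-admissible with respect to $\mathcal Y$ if $\mathrm{Ext}^1_{R^{\mathrm{op}}}(\mathrm{Hom}_{R^{\mathrm{op}}}(M^{\otimes_R i},Y),H)=0=\mathrm{Ext}^1_{R^{\mathrm{op}}}(M,\mathrm{Hom}_{R^{\mathrm{op}}}(M^{\otimes_R i},H))$ for all $H\in\mathcal Y\text{-}\mathsf{GI}(R^{\mathrm{op}})$, $Y\in\mathcal Y$, $i\ge 0$. *)

(* Defs.v *)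
From HB Require Import structures.
From mathcomp Require Import all_boot all_algebra.
From mathcomp Require Import boolp.

Set Implicit Arguments.
Unset Strict Implicit.
Unset Printing Implicit Defensive.

Import GRing.Theory.
Local Open Scope ring_scope.
Local Open Scope quotient_scope.

(* Right S-modules are left modules over the opposite ring: when Y has type
   lmodType (op S), s *: y stands for y.s. *)
Definition op (S : nzRingType) : nzRingType := S^c.

Section Modules.
Variable S : nzRingType.
Implicit Types U V W : lmodType S.

Definition isomorphic V W : Prop := exists f : {linear V -> W}, bijective f.

Definition projective (P : lmodType S) : Prop :=
  forall (V W : lmodType S) (g : {linear V -> W}) (f : {linear P -> W}),
    (forall w, exists v, g v = w) ->
    exists h : {linear P -> V}, forall x, g (h x) = f x.

Definition injective_module (I : lmodType S) : Prop :=
  forall (V W : lmodType S) (g : {linear V -> W}) (f : {linear V -> I}),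
    injective g ->
    exists h : {linear W -> I}, forall x, h (g x) = f x.

Section SubQuotients.
Variables (V W : lmodType S) (f : {linear V -> W}).

Definition ker_pred : {pred V} := fun v => f v == 0.
Fact ker_submod_closed : submod_closed ker_pred.
Proof.
split=> [|a u v]; rewrite ![_ \in ker_pred]unfold_in ?linear0 //.
by rewrite linearP => /eqP-> /eqP->; rewrite scaler0 addr0.
Qed.
HB.instance Definition _ := GRing.isSubmodClosed.Build S V ker_pred
  ker_submod_closed.
Record kernel := Kernel { kernel_val : V; _ : kernel_val \in ker_pred }.
HB.instance Definition _ := [isSub for kernel_val].
HB.instance Definition _ := [Choice of kernel by <:].
HB.instance Definition _ := [SubChoice_isSubLmodule of kernel by <:].

Definition im_pred : {pred W} := fun w => `[< exists v, f v = w >].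
Fact im_submod_closed : submod_closed im_pred.
Proof.
split=> [|a u v]; rewrite ![_ \in im_pred]unfold_in.
  by apply/asboolP; exists 0; rewrite linear0.
move=> /asboolP[x <-] /asboolP[y <-]; apply/asboolP.
by exists (a *: x + y); rewrite linearP.
Qed.
HB.instance Definition _ := GRing.isSubmodClosed.Build S W im_pred
  im_submod_closed.
Record image_mod := ImageMod { image_val : W; _ : image_val \in im_pred }.
HB.instance Definition _ := [isSub for image_val].
HB.instance Definition _ := [Choice of image_mod by <:].
HB.instance Definition _ := [SubChoice_isSubLmodule of image_mod by <:].

Definition coker_rel : rel W := fun x y => x - y \in im_pred.
Fact coker_rel_equiv : equiv_class_of coker_rel.
Proof.
split=> [x|x y|y x z]; rewrite /coker_rel ?subrr ?rpred0 //.
  by rewrite -opprB rpredN.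
by move=> xy yz; rewrite -(subrK y x) -addrA rpredD.
Qed.
Canonical coker_equiv := EquivRelPack coker_rel_equiv.
Definition coker : Type := {eq_quot coker_rel}.
HB.instance Definition _ := Choice.on coker.

Definition coker_proj (w : W) : coker := \pi_({eq_quot coker_rel}) w.

Lemma coker_projP x y : coker_proj x = coker_proj y <-> x - y \in im_pred.
Proof. by split=> [/eqmodP|?]; [|apply/eqmodP]. Qed.

Lemma coker_ind (P : coker -> Prop) :
  (forall w, P (coker_proj w)) -> forall c, P c.
Proof. by move=> h; elim/quotW. Qed.

Definition coker_repr (c : coker) : W := repr (c : {eq_quot coker_rel}).

Lemma coker_reprK c : coker_proj (coker_repr c) = c.
Proof. exact: reprK. Qed.

Lemma coker_repr_proj w : coker_repr (coker_proj w) - w \in im_pred.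
Proof. by apply/coker_projP; rewrite coker_reprK. Qed.

Definition coker_add c d := coker_proj (coker_repr c + coker_repr d).
Definition coker_opp c := coker_proj (- coker_repr c).
Definition coker_scale (a : S) c := coker_proj (a *: coker_repr c).

Lemma coker_addE x y :
  coker_add (coker_proj x) (coker_proj y) = coker_proj (x + y).
Proof.
by apply/coker_projP; rewrite opprD addrACA rpredD // coker_repr_proj.
Qed.
Lemma coker_oppE x : coker_opp (coker_proj x) = coker_proj (- x).
Proof. by apply/coker_projP; rewrite -opprD rpredN coker_repr_proj. Qed.
Lemma coker_scaleE a x : coker_scale a (coker_proj x) = coker_proj (a *: x).
Proof. by apply/coker_projP; rewrite -scalerBr rpredZ // coker_repr_proj. Qed.

Fact coker_addA : associative coker_add.
Proof.
by elim/coker_ind=> x; elim/coker_ind=> y; elim/coker_ind=> z;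
   rewrite !coker_addE addrA.
Qed.
Fact coker_addC : commutative coker_add.
Proof. by elim/coker_ind=> x; elim/coker_ind=> y; rewrite !coker_addE addrC. Qed.
Fact coker_add0 : left_id (coker_proj 0) coker_add.
Proof. by elim/coker_ind=> x; rewrite coker_addE add0r. Qed.
Fact coker_addN : left_inverse (coker_proj 0) coker_opp coker_add.
Proof. by elim/coker_ind=> x; rewrite coker_oppE coker_addE addNr. Qed.
HB.instance Definition _ := GRing.isZmodule.Build coker
  coker_addA coker_addC coker_add0 coker_addN.

Fact coker_scaleA a b c :
  coker_scale a (coker_scale b c) = coker_scale (a * b) c.
Proof. by elim/coker_ind: c => x; rewrite !coker_scaleE scalerA. Qed.
Fact coker_scale1 : left_id 1 coker_scale.
Proof. by elim/coker_ind=> x; rewrite coker_scaleE scale1r. Qed.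
Fact coker_scaleDr : right_distributive coker_scale +%R.
Proof.
move=> a; elim/coker_ind=> x; elim/coker_ind=> y.
by rewrite /+%R /= coker_addE !coker_scaleE coker_addE scalerDr.
Qed.
Fact coker_scaleDl c : {morph coker_scale^~ c : a b / a + b}.
Proof.
move=> a b; elim/coker_ind: c => x.
by rewrite !coker_scaleE {2}/+%R /= coker_addE scalerDl.
Qed.
HB.instance Definition _ := GRing.Zmodule_isLmodule.Build S coker
  coker_scaleA coker_scale1 coker_scaleDr coker_scaleDl.

End SubQuotients.

Definition hom V W : Type := {linear V -> W}.

Lemma hom_ext V W (f g : hom V W) : f =1 g -> f = g.
Proof.
case: f g => [f cf] [g cg] /= /funext fg.
case: _ / fg in cg *; case: cf cg => [[a] [b]] [[a'] [b']].
by rewrite (Prop_irrelevance a a') (Prop_irrelevance b b').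
Qed.

Section HomZmod.
Variables V W : lmodType S.
HB.instance Definition _ := gen_eqMixin (hom V W).
HB.instance Definition _ := gen_choiceMixin (hom V W).

Definition hom_add (f g : hom V W) : hom V W := f \+ g.
Definition hom_zero : hom V W := \0.
Definition hom_opp (f : hom V W) : hom V W := \- f.
Fact hom_addA : associative hom_add.
Proof. by move=> f g h; apply: hom_ext => x /=; rewrite addrA. Qed.
Fact hom_addC : commutative hom_add.
Proof. by move=> f g; apply: hom_ext => x /=; rewrite addrC. Qed.
Fact hom_add0 : left_id hom_zero hom_add.
Proof. by move=> f; apply: hom_ext => x /=; rewrite add0r. Qed.
Fact hom_addN : left_inverse hom_zero hom_opp hom_add.
Proof. by move=> f; apply: hom_ext => x /=; rewrite addNr. Qed.
HB.instance Definition _ := GRing.isZmodule.Build (hom V W)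
  hom_addA hom_addC hom_add0 hom_addN.
End HomZmod.

Definition hom_pre U V (f : {linear U -> V}) W (g : hom V W) : hom U W :=
  g \o f.
Definition hom_post U V W (f : {linear V -> W}) (g : hom U V) : hom U W :=
  f \o g.

End Modules.

Record bimodule (S R : nzRingType) := Bimodule {
  bimod_left :> lmodType S;
  ract : bimod_left -> R -> bimod_left;
  ractA : forall b r r', ract (ract b r) r' = ract b (r * r');
  ract1 : forall b, ract b 1 = b;
  ractDl : forall b b' r, ract (b + b') r = ract b r + ract b' r;
  ractDr : forall b r r', ract b (r + r') = ract b r + ract b r';
  ractZ : forall s b r, ract (s *: b) r = s *: ract b r
}.

Definition regular_bimod (R : nzRingType) : bimodule R R :=
  @Bimodule R R R^o (fun b r => b * r) (fun b r r' => esym (mulrA b r r'))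
    (@mulr1 R) (fun b b' r => mulrDl b b' r) (fun b r r' => mulrDr b r r')
    (fun s b r => esym (mulrA s b r)).

(* The underlying right R-module of an (S, R)-bimodule. *)
Definition rmod (S R : nzRingType) (B : bimodule S R) : Type := bimod_left B.

Section RightModule.
Variables (S R : nzRingType) (B : bimodule S R).
HB.instance Definition _ := GRing.Zmodule.on (rmod B).
Definition rmod_scale (r : op R) (b : rmod B) : rmod B := ract b r.
Fact rmod_scaleA a b v : rmod_scale a (rmod_scale b v) = rmod_scale (a * b) v.
Proof. exact: ractA. Qed.
Fact rmod_scale1 : left_id 1 rmod_scale. Proof. exact: ract1. Qed.
Fact rmod_scaleDr : right_distributive rmod_scale +%R.
Proof. by move=> r b b'; apply: ractDl. Qed.
Fact rmod_scaleDl v : {morph rmod_scale^~ v : a b / a + b}.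
Proof. by move=> a b; apply: ractDr. Qed.
HB.instance Definition _ := GRing.Zmodule_isLmodule.Build (op R) (rmod B)
  rmod_scaleA rmod_scale1 rmod_scaleDr rmod_scaleDl.
End RightModule.

Section BimodTheory.
Variables (S R : nzRingType) (B : bimodule S R).
Lemma ract0l r : ract (0 : B) r = 0.
Proof. exact: (@scaler0 (op R) (rmod B)). Qed.
Lemma ract0r (b : B) : ract b 0 = 0.
Proof. exact: (@scale0r (op R) (rmod B)). Qed.
Lemma ractNl (b : B) r : ract (- b) r = - ract b r.
Proof. exact: (@scalerN (op R) (rmod B)). Qed.
End BimodTheory.

Section Tensor.
Variables (S R : nzRingType) (B : bimodule S R) (X : lmodType R).

(* A word (b_1, x_1) ... (b_n, x_n) stands for the sum of the b_k (x) x_k. No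
   formal negatives are needed, because - (b (x) x) = (- b) (x) x. *)
Inductive tensor_eq : seq (B * X) -> seq (B * X) -> Prop :=
| tensor_refl s : tensor_eq s s
| tensor_sym s t : tensor_eq s t -> tensor_eq t s
| tensor_trans s t u : tensor_eq s t -> tensor_eq t u -> tensor_eq s u
| tensor_cat s s' t t' :
    tensor_eq s s' -> tensor_eq t t' -> tensor_eq (s ++ t) (s' ++ t')
| tensor_catC s t : tensor_eq (s ++ t) (t ++ s)
| tensor_zero : tensor_eq [:: (0, 0)] [::]
| tensor_addl b b' x : tensor_eq [:: (b + b', x)] [:: (b, x); (b', x)]
| tensor_addr b x x' : tensor_eq [:: (b, x + x')] [:: (b, x); (b, x')]
| tensor_bal b r x : tensor_eq [:: (ract b r, x)] [:: (b, r *: x)].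

Definition tensor_rel : rel (seq (B * X)) := fun s t => `[< tensor_eq s t >].
Fact tensor_rel_equiv : equiv_class_of tensor_rel.
Proof.
split=> [s|s t|s t u]; first exact/asboolP/tensor_refl.
  by apply/asboolP/asboolP; apply: tensor_sym.
by move=> /asboolP st /asboolP tu; apply/asboolP/(tensor_trans st tu).
Qed.
Canonical tensor_equiv := EquivRelPack tensor_rel_equiv.
Definition tensor : Type := {eq_quot tensor_rel}.
HB.instance Definition _ := Choice.on tensor.

Definition tensor_word (s : seq (B * X)) : tensor := \pi_({eq_quot tensor_rel}) s.
Definition tensor_repr (t : tensor) : seq (B * X) :=
  repr (t : {eq_quot tensor_rel}).
Definition tens (b : B) (x : X) : tensor := tensor_word [:: (b, x)].

Lemma tensor_wordP s t : tensor_word s = tensor_word t <-> tensor_eq s t.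
Proof. by split=> [/eqmodP/asboolP|?]; [|apply/eqmodP/asboolP]. Qed.
Lemma tensor_reprK t : tensor_word (tensor_repr t) = t.
Proof. exact: reprK. Qed.
Lemma tensor_repr_word s : tensor_eq (tensor_repr (tensor_word s)) s.
Proof. by apply/tensor_wordP; rewrite tensor_reprK. Qed.

Definition tensor_add t u := tensor_word (tensor_repr t ++ tensor_repr u).
Definition tensor_opp t :=
  tensor_word [seq (- p.1, p.2) | p <- tensor_repr t].

Lemma tensor_wordD s t :
  tensor_add (tensor_word s) (tensor_word t) = tensor_word (s ++ t).
Proof. by apply/tensor_wordP; apply: tensor_cat; apply: tensor_repr_word. Qed.

Lemma tensor_eq0l x : tensor_eq [:: (0, x)] [::].
Proof.
rewrite -(ract0r 0); apply: tensor_trans (tensor_bal _ _ _) _.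
by rewrite scale0r; apply: tensor_zero.
Qed.

Fact tensor_addA : associative tensor_add.
Proof.
move=> t u v; rewrite -(tensor_reprK t) -(tensor_reprK u) -(tensor_reprK v).
by rewrite !tensor_wordD catA.
Qed.
Fact tensor_addC : commutative tensor_add.
Proof. by move=> t u; apply/tensor_wordP/tensor_catC. Qed.
Fact tensor_add0 : left_id (tensor_word [::]) tensor_add.
Proof. by move=> t; rewrite -(tensor_reprK t) tensor_wordD. Qed.
Fact tensor_addN : left_inverse (tensor_word [::]) tensor_opp tensor_add.
Proof.
move=> t; rewrite -{2}(tensor_reprK t) tensor_wordD; apply/tensor_wordP.
elim: (tensor_repr t) => [|[b x] s IHs] /=; first exact: tensor_refl.
have step u : tensor_eq ((- b, x) :: u ++ (b, x) :: s)
                ([:: (- b + b, x)] ++ (u ++ s)).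
  apply: (@tensor_trans _ ([:: (- b, x); (b, x)] ++ (u ++ s))); last first.
    apply: tensor_cat; last exact: tensor_refl.
    exact/tensor_sym/tensor_addl.
  apply: (@tensor_cat [:: (- b, x)] [:: (- b, x)]); first exact: tensor_refl.
  rewrite -[(b, x) :: s]/([:: (b, x)] ++ s).
  rewrite -[X in tensor_eq _ X]/([:: (b, x)] ++ (u ++ s)) !catA.
  apply: tensor_cat; last exact: tensor_refl.
  exact: tensor_catC.
apply: tensor_trans (step _) _; rewrite addNr.
exact: (tensor_cat (tensor_eq0l x) IHs).
Qed.
HB.instance Definition _ := GRing.isZmodule.Build tensor
  tensor_addA tensor_addC tensor_add0 tensor_addN.

Lemma tensor_word_sum s : tensor_word s = \sum_(p <- s) tens p.1 p.2.
Proof.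
elim: s => [|[b x] s IHs]; first by rewrite big_nil.
by rewrite big_cons -IHs [RHS]tensor_wordD.
Qed.

Lemma tensor_ind (P : tensor -> Prop) :
  P 0 -> (forall b x, P (tens b x)) -> (forall t u, P t -> P u -> P (t + u)) ->
  forall t, P t.
Proof.
move=> P0 P1 PD t; rewrite -(tensor_reprK t) tensor_word_sum.
by apply: big_ind => // p _.
Qed.

Lemma tensDl b b' x : tens (b + b') x = tens b x + tens b' x.
Proof. by rewrite [RHS]tensor_wordD; apply/tensor_wordP/tensor_addl. Qed.
Lemma tensDr b x x' : tens b (x + x') = tens b x + tens b x'.
Proof. by rewrite [RHS]tensor_wordD; apply/tensor_wordP/tensor_addr. Qed.
Lemma tens_bal b r x : tens (ract b r) x = tens b (r *: x).
Proof. exact/tensor_wordP/tensor_bal. Qed.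
Lemma tens0l x : tens 0 x = 0.
Proof. exact/tensor_wordP/tensor_eq0l. Qed.
Lemma tens0r b : tens b 0 = 0.
Proof. by rewrite -(scale0r 0) -tens_bal ract0r tens0l. Qed.

Definition balanced (A : zmodType) (f : B -> X -> A) : Prop :=
  [/\ forall b b' x, f (b + b') x = f b x + f b' x,
      forall b x x', f b (x + x') = f b x + f b x' &
      forall b r x, f (ract b r) x = f b (r *: x)].

(* The additive map sending b (x) x to f b x, when f is balanced. *)
Definition tensor_lift (A : zmodType) (f : B -> X -> A) (t : tensor) : A :=
  \sum_(p <- tensor_repr t) f p.1 p.2.

Section Lift.
Variables (A : zmodType) (f : B -> X -> A).
Hypothesis f_bal : balanced f.

Lemma tensor_lift_word s :
  tensor_lift f (tensor_word s) = \sum_(p <- s) f p.1 p.2.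
Proof.
case: f_bal => fDl fDr fM.
rewrite /tensor_lift; move: (tensor_repr_word s).
move: (tensor_repr _) => u; elim=> {u s} //.
- by move=> s t u _ -> _.
- by move=> s s' t t' _ IH1 _ IH2; rewrite !big_cat IH1 IH2.
- by move=> s t; rewrite !big_cat /= addrC.
- by rewrite big_seq1 big_nil /=; apply: (addrI (f 0 0)); rewrite -fDl !addr0.
- by move=> b b' x; rewrite !(big_cons, big_nil) /= !addr0 fDl.
- by move=> b x x'; rewrite !(big_cons, big_nil) /= !addr0 fDr.
- by move=> b r x; rewrite !big_seq1 /= fM.
Qed.
Lemma tensor_lift_tens b x : tensor_lift f (tens b x) = f b x.
Proof. by rewrite tensor_lift_word big_seq1. Qed.
Lemma tensor_liftD t u : tensor_lift f (t + u) = tensor_lift f t + tensor_lift f u.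
Proof.
rewrite -(tensor_reprK t) -(tensor_reprK u) [_ + _]tensor_wordD.
by rewrite !tensor_lift_word big_cat.
Qed.
Lemma tensor_lift0 : tensor_lift f 0 = 0.
Proof. by rewrite tensor_lift_word big_nil. Qed.
End Lift.

Definition tensor_scale (s : S) : tensor -> tensor :=
  tensor_lift (fun b x => tens (s *: b) x).

Lemma tensor_scale_bal s : balanced (fun b x => tens (s *: b) x).
Proof.
split=> *; first by rewrite scalerDr tensDl.
  by rewrite tensDr.
by rewrite -ractZ tens_bal.
Qed.
Lemma tensor_scale_tens s b x : tensor_scale s (tens b x) = tens (s *: b) x.
Proof. exact: (tensor_lift_tens (tensor_scale_bal s)). Qed.
Fact tensor_scaleDr : right_distributive tensor_scale +%R.
Proof. by move=> s t u; apply: (tensor_liftD (tensor_scale_bal s)). Qed.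
Lemma tensor_scale0 s : tensor_scale s 0 = 0.
Proof. exact: (tensor_lift0 (tensor_scale_bal s)). Qed.
Fact tensor_scaleA a b t :
  tensor_scale a (tensor_scale b t) = tensor_scale (a * b) t.
Proof.
elim/tensor_ind: t => [|c x|t u IH1 IH2]; first by rewrite !tensor_scale0.
  by rewrite !tensor_scale_tens scalerA.
by rewrite !tensor_scaleDr IH1 IH2.
Qed.
Fact tensor_scale1 : left_id 1 tensor_scale.
Proof.
elim/tensor_ind=> [|c x|t u IH1 IH2]; first by rewrite !tensor_scale0.
  by rewrite !tensor_scale_tens scale1r.
by rewrite !tensor_scaleDr IH1 IH2.
Qed.
Fact tensor_scaleDl t : {morph tensor_scale^~ t : a b / a + b}.
Proof.
move=> a b; elim/tensor_ind: t => [|c x|t u IH1 IH2].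
- by rewrite !tensor_scale0 addr0.
- by rewrite !tensor_scale_tens scalerDl tensDl.
- by rewrite !tensor_scaleDr IH1 IH2 addrACA.
Qed.
HB.instance Definition _ := GRing.Zmodule_isLmodule.Build S tensor
  tensor_scaleA tensor_scale1 tensor_scaleDr tensor_scaleDl.

Lemma scale_tens s b x : s *: tens b x = tens (s *: b) x.
Proof. exact: tensor_scale_tens. Qed.

End Tensor.

Section TensorMap.
Variables (S R : nzRingType) (B : bimodule S R) (X X' : lmodType R).
Definition tensor_map (f : {linear X -> X'}) : tensor B X -> tensor B X' :=
  tensor_lift (fun b x => tens b (f x)).
Variable f : {linear X -> X'}.
Lemma tensor_map_bal : balanced (fun (b : B) x => tens b (f x)).
Proof.
by split=> *; rewrite ?tensDl // ?linearD ?tensDr // linearZ /= tens_bal.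
Qed.
Fact tensor_map_linear : linear (tensor_map f).
Proof.
move=> s t u; rewrite /tensor_map (tensor_liftD tensor_map_bal); congr (_ + _).
elim/tensor_ind: t => [|b x|t t' IH1 IH2].
- by rewrite scaler0 (tensor_lift0 tensor_map_bal) scaler0.
- by rewrite scale_tens !(tensor_lift_tens tensor_map_bal) scale_tens.
- by rewrite scalerDr !(tensor_liftD tensor_map_bal) IH1 IH2 scalerDr.
Qed.
HB.instance Definition _ := GRing.isLinear.Build S _ _ _ (tensor_map f)
  tensor_map_linear.
End TensorMap.

Arguments tensor_map {S R} B {X X'} f t.

Section TensorBimodule.
Variables (S R Q : nzRingType) (B : bimodule S R) (C : bimodule R Q).
Definition tensor_ract (t : tensor B C) (q : Q) : tensor B C :=
  tensor_lift (fun b c => tens b (ract c q)) t.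
Lemma tensor_ract_bal q : balanced (fun (b : B) (c : C) => tens b (ract c q)).
Proof.
by split=> *; rewrite ?tensDl // ?ractDl ?tensDr // ractZ tens_bal.
Qed.
Lemma tensor_ract_tens b c q : tensor_ract (tens b c) q = tens b (ract c q).
Proof. exact: (tensor_lift_tens (tensor_ract_bal q)). Qed.
Fact tensor_ractDl t u q :
  tensor_ract (t + u) q = tensor_ract t q + tensor_ract u q.
Proof. exact: (tensor_liftD (tensor_ract_bal q)). Qed.
Lemma tensor_ract0 q : tensor_ract 0 q = 0.
Proof. exact: (tensor_lift0 (tensor_ract_bal q)). Qed.
Fact tensor_ractA t q q' :
  tensor_ract (tensor_ract t q) q' = tensor_ract t (q * q').
Proof.
elim/tensor_ind: t => [|b x|t u IH1 IH2]; first by rewrite !tensor_ract0.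
  by rewrite !tensor_ract_tens ractA.
by rewrite !tensor_ractDl IH1 IH2.
Qed.
Fact tensor_ract1 t : tensor_ract t 1 = t.
Proof.
elim/tensor_ind: t => [|b x|t u IH1 IH2]; first by rewrite !tensor_ract0.
  by rewrite !tensor_ract_tens ract1.
by rewrite !tensor_ractDl IH1 IH2.
Qed.
Fact tensor_ractDr t q q' :
  tensor_ract t (q + q') = tensor_ract t q + tensor_ract t q'.
Proof.
elim/tensor_ind: t => [|b x|t u IH1 IH2].
- by rewrite !tensor_ract0 addr0.
- by rewrite !tensor_ract_tens ractDr tensDr.
- by rewrite !tensor_ractDl IH1 IH2 addrACA.
Qed.
Fact tensor_ractZ s t q : tensor_ract (s *: t) q = s *: tensor_ract t q.
Proof.
elim/tensor_ind: t => [|b x|t u IH1 IH2].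
- by rewrite scaler0 !tensor_ract0 scaler0.
- by rewrite scale_tens !tensor_ract_tens scale_tens.
- by rewrite scalerDr !tensor_ractDl scalerDr IH1 IH2.
Qed.
Definition tensor_bimod : bimodule S Q :=
  Bimodule tensor_ractA tensor_ract1 tensor_ractDl tensor_ractDr tensor_ractZ.
End TensorBimodule.

Section HomModule.
Variables (S R : nzRingType) (B : bimodule S R) (Y : lmodType (op R)).

(* Hom_{R^op}(B, Y), a right S-module through the left action of S on B. *)
Definition rhom : Type := hom (rmod B) Y.
HB.instance Definition _ := GRing.Zmodule.on rhom.

Definition bimod_lmul (s : S) (b : rmod B) : rmod B := s *: (b : B).
Fact bimod_lmul_linear s : linear (bimod_lmul s).
Proof.
by move=> r b b'; rewrite /bimod_lmul scalerDr; congr (_ + _); rewrite -ractZ.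
Qed.
HB.instance Definition _ s := GRing.isLinear.Build (op R) _ _ _ (bimod_lmul s)
  (bimod_lmul_linear s).

(* (g . s) b = g (s b) *)
Definition rhom_scale (s : op S) (g : rhom) : rhom := hom_pre (bimod_lmul s) g.
Fact rhom_scaleA a b g : rhom_scale a (rhom_scale b g) = rhom_scale (a * b) g.
Proof. by apply: hom_ext => x /=; rewrite /bimod_lmul scalerA. Qed.
Fact rhom_scale1 : left_id 1 rhom_scale.
Proof. by move=> g; apply: hom_ext => x /=; rewrite /bimod_lmul scale1r. Qed.
Fact rhom_scaleDr : right_distributive rhom_scale +%R.
Proof. by move=> s g h; apply: hom_ext. Qed.
Fact rhom_scaleDl g : {morph rhom_scale^~ g : a b / a + b}.
Proof.
by move=> a b; apply: hom_ext => x /=; rewrite /bimod_lmul scalerDl linearD.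
Qed.
HB.instance Definition _ := GRing.Zmodule_isLmodule.Build (op S) rhom
  rhom_scaleA rhom_scale1 rhom_scaleDr rhom_scaleDl.
End HomModule.

Section TensorRing.
Variables (R : nzRingType) (M : bimodule R R).

Fixpoint tensor_pow (i : nat) : bimodule R R :=
  if i is i'.+1 then tensor_bimod M (tensor_pow i') else regular_bimod R.

Definition nilpotent_bimod (N : nat) : Prop := forall t : tensor_pow N.+1, t = 0.

Variable N : nat.

(* The i-th component of f is its part of degree i. The product defined below
   drops the degrees above N, so tensor_ring is a ring for every M; it is the
   tensor ring of M when M is N-nilpotent. *)
Definition tensor_ring : Type := forall i : 'I_N.+1, tensor_pow i.
Implicit Types f g h : tensor_ring.

HB.instance Definition _ := Choice.on tensor_ring.

Lemma tring_ext f g : (forall i, f i = g i) -> f = g.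
Proof. exact: functional_extensionality_dep. Qed.

Definition tring_add f g : tensor_ring := fun i => f i + g i.
Definition tring_zero : tensor_ring := fun i => 0.
Definition tring_opp f : tensor_ring := fun i => - f i.
Fact tring_addA : associative tring_add.
Proof. by move=> f g h; apply: tring_ext => i; apply: addrA. Qed.
Fact tring_addC : commutative tring_add.
Proof. by move=> f g; apply: tring_ext => i; apply: addrC. Qed.
Fact tring_add0 : left_id tring_zero tring_add.
Proof. by move=> f; apply: tring_ext => i; apply: add0r. Qed.
Fact tring_addN : left_inverse tring_zero tring_opp tring_add.
Proof. by move=> f; apply: tring_ext => i; apply: addNr. Qed.
HB.instance Definition _ := GRing.isZmodule.Build tensor_ring
  tring_addA tring_addC tring_add0 tring_addN.

Lemma tring_addE f g i : (f + g) i = f i + g i. Proof. by []. Qed.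
Lemma tring_zeroE i : (0 : tensor_ring) i = 0. Proof. by []. Qed.
Lemma tring_sumE I (r : seq I) (F : I -> tensor_ring) i :
  (\sum_(k <- r) F k) i = \sum_(k <- r) F k i.
Proof. by elim/big_rec2: _ => // k x y _ <-. Qed.

Definition tring_lscale (r : R) f : tensor_ring := fun i => r *: f i.

Definition tring_of_ring (r : R) : tensor_ring :=
  fun i => let: Ordinal k _ := i return tensor_pow i in
           match k return tensor_pow k with 0 => r | _.+1 => 0 end.

(* Left multiplication by an element m of M: f_i is sent to m (x) f_i. *)
Definition tring_shift (m : M) f : tensor_ring :=
  fun i => let: Ordinal k lt_k := i return tensor_pow i in
    match k return (k < N.+1)%N -> tensor_pow k with
    | 0 => fun=> 0
    | k'.+1 => fun lt_k => tens m (f (Ordinal (ltnW lt_k)))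
    end lt_k.

(* Left multiplication by the element t of degree i:
   (m (x) t) g = m (x) (t g). *)
Fixpoint tring_lmul (i : nat) : tensor_pow i -> tensor_ring -> tensor_ring :=
  match i with
  | 0 => fun r g => tring_lscale r g
  | i'.+1 => fun t g =>
      tensor_lift (fun m t' => tring_shift m (tring_lmul t' g)) t
  end.

Definition tring_mul f g : tensor_ring := \sum_(i < N.+1) tring_lmul (f i) g.

Definition tring_one : tensor_ring := tring_of_ring 1.

Lemma tring_lscaleDl a b f :
  tring_lscale (a + b) f = tring_lscale a f + tring_lscale b f.
Proof. by apply: tring_ext => i; apply: scalerDl. Qed.
Lemma tring_lscaleDr a f g :
  tring_lscale a (f + g) = tring_lscale a f + tring_lscale a g.
Proof. by apply: tring_ext => i; apply: scalerDr. Qed.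
Lemma tring_lscaleA a b f :
  tring_lscale a (tring_lscale b f) = tring_lscale (a * b) f.
Proof. by apply: tring_ext => i; apply: scalerA. Qed.
Lemma tring_lscale1 f : tring_lscale 1 f = f.
Proof. by apply: tring_ext => i; apply: scale1r. Qed.
Lemma tring_lscale0 a : tring_lscale a 0 = 0.
Proof. by apply: tring_ext => i; apply: scaler0. Qed.

Lemma tring_shiftDl m m' f :
  tring_shift (m + m') f = tring_shift m f + tring_shift m' f.
Proof.
apply: tring_ext => -[[|k] lt_k]; rewrite tring_addE /=; first by rewrite addr0.
exact: tensDl.
Qed.
Lemma tring_shiftDr m f g :
  tring_shift m (f + g) = tring_shift m f + tring_shift m g.
Proof.
apply: tring_ext => -[[|k] lt_k]; rewrite tring_addE /=; first by rewrite addr0.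
exact: tensDr.
Qed.
Lemma tring_shift0 m : tring_shift m 0 = 0.
Proof.
apply: tring_ext => -[[|k] lt_k] //; exact: tens0r.
Qed.
Lemma tring_shift_bal m r f :
  tring_shift (ract m r) f = tring_shift m (tring_lscale r f).
Proof. by apply: tring_ext => -[[|k] lt_k] //; exact: tens_bal. Qed.
Lemma tring_shiftZ m r f :
  tring_shift (r *: m) f = tring_lscale r (tring_shift m f).
Proof.
apply: tring_ext => -[[|k] lt_k]; rewrite /tring_lscale /=.
  by rewrite scaler0.
exact/esym/scale_tens.
Qed.

Lemma tring_lmul_props i :
  [/\ forall (t u : tensor_pow i) g,
        tring_lmul (t + u) g = tring_lmul t g + tring_lmul u g,
      forall (t : tensor_pow i) g h,
        tring_lmul t (g + h) = tring_lmul t g + tring_lmul t h &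
      forall r (t : tensor_pow i) g,
        tring_lmul (r *: t) g = tring_lscale r (tring_lmul t g)].
Proof.
elim: i => [|i [IHDl IHDr IHZ]] /=.
  split=> *; first exact: tring_lscaleDl.
    exact: tring_lscaleDr.
  by rewrite tring_lscaleA.
have bal g : balanced (fun m t => tring_shift m (@tring_lmul i t g)).
  split=> *; first exact: tring_shiftDl.
    by rewrite IHDl tring_shiftDr.
  by rewrite tring_shift_bal IHZ.
split.
- by move=> t u g; apply: tensor_liftD.
- move=> t g h; elim/tensor_ind: t => [|m t|t u IH1 IH2].
  + by rewrite !tensor_lift0 // addr0.
  + by rewrite !tensor_lift_tens // IHDr tring_shiftDr.
  + by rewrite !tensor_liftD // IH1 IH2 addrACA.
- move=> r t g; elim/tensor_ind: t => [|m t|t u IH1 IH2].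
  + by rewrite scaler0 !tensor_lift0 // tring_lscale0.
  + by rewrite scale_tens !tensor_lift_tens // tring_shiftZ.
  + by rewrite scalerDr !tensor_liftD // IH1 IH2 tring_lscaleDr.
Qed.

Lemma tring_lmulDl i (t u : tensor_pow i) g :
  tring_lmul (t + u) g = tring_lmul t g + tring_lmul u g.
Proof. by case: (tring_lmul_props i). Qed.
Lemma tring_lmulDr i (t : tensor_pow i) g h :
  tring_lmul t (g + h) = tring_lmul t g + tring_lmul t h.
Proof. by case: (tring_lmul_props i). Qed.
Lemma tring_lmulZ i r (t : tensor_pow i) g :
  tring_lmul (r *: t) g = tring_lscale r (tring_lmul t g).
Proof. by case: (tring_lmul_props i). Qed.
Lemma tring_lmul0l i g : tring_lmul (0 : tensor_pow i) g = 0.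
Proof. by apply: (addrI (tring_lmul (0 : tensor_pow i) g)); rewrite -tring_lmulDl !addr0. Qed.
Lemma tring_lmul0r i (t : tensor_pow i) : tring_lmul t 0 = 0.
Proof. by apply: (addrI (tring_lmul t 0)); rewrite -tring_lmulDr !addr0. Qed.

Lemma tring_lmul_bal i g :
  balanced (fun m (t : tensor_pow i) => tring_shift m (tring_lmul t g)).
Proof.
split=> *; first exact: tring_shiftDl.
  by rewrite tring_lmulDl tring_shiftDr.
by rewrite tring_shift_bal tring_lmulZ.
Qed.

Lemma tring_lmul_tens i m (t : tensor_pow i) g :
  @tring_lmul i.+1 (tens m t) g = tring_shift m (tring_lmul t g).
Proof. exact: (tensor_lift_tens (@tring_lmul_bal i g)). Qed.

Lemma tring_lmul_deg i (t : tensor_pow i) g (j : 'I_N.+1) :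
  (j < i)%N -> tring_lmul t g j = 0.
Proof.
elim: i t j => // i IHi t j lt_ji.
elim/tensor_ind: t => [|m t|t u IH1 IH2]; first by rewrite tring_lmul0l.
  rewrite tring_lmul_tens; case: j lt_ji => -[|k] //= lt_k lt_ki.
  by rewrite IHi ?tens0r.
by rewrite tring_lmulDl tring_addE IH1 IH2 addr0.
Qed.

Lemma tring_mulDl : left_distributive tring_mul +%R.
Proof.
move=> f g h; rewrite /tring_mul -big_split; apply: eq_bigr => i _.
exact: tring_lmulDl.
Qed.
Lemma tring_mulDr : right_distributive tring_mul +%R.
Proof.
move=> f g h; rewrite /tring_mul -big_split; apply: eq_bigr => i _.
exact: tring_lmulDr.
Qed.
Lemma tring_mul0l g : tring_mul 0 g = 0.
Proof. by apply: big1 => i _; apply: tring_lmul0l. Qed.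

Lemma tring_mulZ r f g :
  tring_mul (tring_lscale r f) g = tring_lscale r (tring_mul f g).
Proof.
rewrite /tring_mul (big_morph _ (tring_lscaleDr r) (tring_lscale0 r)).
by apply: eq_bigr => i _; apply: tring_lmulZ.
Qed.

Lemma tring_mul_shift m f g :
  tring_mul (tring_shift m f) g = tring_shift m (tring_mul f g).
Proof.
rewrite /tring_mul (big_morph _ (tring_shiftDr m) (tring_shift0 m)).
rewrite big_ord_recl.
have -> : tring_lmul (tring_shift m f ord0) g = 0 by apply: (@tring_lmul0l 0).
rewrite add0r big_ord_recr.
have -> : tring_shift m (tring_lmul (f ord_max) g) = 0.
  apply: tring_ext => -[[|k] lt_k] //=.
  by rewrite tring_lmul_deg ?tens0r.
rewrite [RHS]addr0; apply: eq_bigr => i _.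
transitivity (@tring_lmul i.+1 (tens m (f (widen_ord (leqnSn N) i))) g).
  have E (p q : (i < N.+1)%N) : @tring_lmul i.+1 (tens m (f (Ordinal p))) g =
      @tring_lmul i.+1 (tens m (f (Ordinal q))) g.
    by rewrite (bool_irrelevance p q).
  exact: E.
exact: tring_lmul_tens.
Qed.

Lemma tring_lmulA i (t : tensor_pow i) g h :
  tring_mul (tring_lmul t g) h = tring_lmul t (tring_mul g h).
Proof.
elim: i t => [|i IHi] t; first exact: tring_mulZ.
elim/tensor_ind: t => [|m t|t u IH1 IH2].
- by rewrite !tring_lmul0l tring_mul0l.
- by rewrite !tring_lmul_tens tring_mul_shift IHi.
- by rewrite !tring_lmulDl tring_mulDl IH1 IH2.
Qed.

Fact tring_mulA : associative tring_mul.
Proof.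
move=> f g h.
have D x y : tring_mul (x + y) h = tring_mul x h + tring_mul y h.
  exact: tring_mulDl.
transitivity (\sum_(i < N.+1) tring_mul (tring_lmul (f i) g) h).
  by apply: eq_bigr => i _; rewrite tring_lmulA.
by rewrite -(big_morph (fun x => tring_mul x h) D (tring_mul0l h)).
Qed.

Lemma tring_mul_ring r f : tring_mul (tring_of_ring r) f = tring_lscale r f.
Proof.
rewrite /tring_mul big_ord_recl big1 ?addr0 // => i _.
exact: tring_lmul0l.
Qed.

Fact tring_mul1l : left_id tring_one tring_mul.
Proof. by move=> f; rewrite tring_mul_ring tring_lscale1. Qed.

Lemma tring_lmul_ring i (t : tensor_pow i) r :
  (forall lt_i : (i < N.+1)%N,
     tring_lmul t (tring_of_ring r) (Ordinal lt_i) = ract t r) /\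
  (forall j : 'I_N.+1, j != i :> nat -> tring_lmul t (tring_of_ring r) j = 0).
Proof.
elim: i t => [|i IHi] t.
  split=> [lt_i|[[|k] lt_k]] //= _; exact: scaler0.
elim/tensor_ind: t => [|m t|t u [IH1 IH1'] [IH2 IH2']].
- by split=> *; rewrite tring_lmul0l ?ract0l.
- rewrite tring_lmul_tens; split=> [lt_i|[[|k] lt_k] //= ne_k].
    by rewrite /= (proj1 (IHi t)) tensor_ract_tens.
  by rewrite (proj2 (IHi t)) ?tens0r.
- rewrite tring_lmulDl; split=> [lt_i|j ne_j]; rewrite tring_addE.
    by rewrite IH1 IH2 ractDl.
  by rewrite IH1' ?IH2' ?addr0.
Qed.

Lemma tring_mul_ringr f r i : tring_mul f (tring_of_ring r) i = ract (f i) r.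
Proof.
rewrite /tring_mul tring_sumE.
rewrite (bigD1_seq i) ?mem_index_enum ?index_enum_uniq //=.
rewrite big1_seq ?addr0 => [|j /andP[ne_ji _]].
  by case: i => i lt_i; apply: (proj1 (tring_lmul_ring _ _)).
by apply: (proj2 (tring_lmul_ring _ _)); rewrite eq_sym.
Qed.

Fact tring_mul1r : right_id tring_one tring_mul.
Proof. by move=> f; apply: tring_ext => i; rewrite tring_mul_ringr ract1. Qed.

Fact tring_one_neq0 : tring_one != 0.
Proof.
apply/eqP => /(congr1 (fun f => f ord0)) /= /eqP.
by rewrite (negPf (oner_neq0 R)).
Qed.

HB.instance Definition _ := GRing.Zmodule_isNzRing.Build tensor_ring
  tring_mulA tring_mul1l tring_mul1r tring_mulDl tring_mulDr tring_one_neq0.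

Fact tring_of_ring_additive : zmod_morphism tring_of_ring.
Proof.
by move=> r s; apply: tring_ext => -[[|k] lt_k] //=; rewrite [RHS]subr0.
Qed.
Fact tring_of_ring_multiplicative : monoid_morphism tring_of_ring.
Proof.
split=> // r s; rewrite [RHS]tring_mul_ring.
by apply: tring_ext => -[[|k] lt_k] //=; rewrite [RHS]scaler0.
Qed.
HB.instance Definition _ := GRing.isZmodMorphism.Build R tensor_ring
  tring_of_ring tring_of_ring_additive.
HB.instance Definition _ := GRing.isMonoidMorphism.Build R tensor_ring
  tring_of_ring tring_of_ring_multiplicative.

(* The inclusion of M as the part of degree 1; it is 0 when N = 0. *)
Definition tring_of_bimod (m : M) : tensor_ring := tring_shift m 1.

Lemma tring_of_bimodD m m' :
  tring_of_bimod (m + m') = tring_of_bimod m + tring_of_bimod m'.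
Proof. exact: tring_shiftDl. Qed.
Lemma tring_of_bimodZ r m :
  tring_of_bimod (r *: m) = tring_of_ring r * tring_of_bimod m.
Proof. by rewrite [RHS]tring_mul_ring; apply: tring_shiftZ. Qed.
Lemma tring_of_bimod_ract m r :
  tring_of_bimod (ract m r) = tring_of_bimod m * tring_of_ring r.
Proof.
rewrite [RHS]tring_mul_shift /tring_of_bimod tring_shift_bal -tring_mul_ring.
by congr tring_shift; rewrite [LHS]tring_mul1r [RHS]tring_mul1l.
Qed.

End TensorRing.

Arguments tring_of_ring {R} M N r.
Arguments tring_of_bimod {R M} N m.

Definition restrict_scalars (A B : nzRingType) (phi : {rmorphism A -> B})
  (V : lmodType B) : Type := V.

Section RestrictScalars.
Variables (A B : nzRingType) (phi : {rmorphism A -> B}).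
Section Object.
Variable V : lmodType B.
HB.instance Definition _ := GRing.Zmodule.on (restrict_scalars phi V).
Definition restrict_scale (a : A) (v : restrict_scalars phi V) :
  restrict_scalars phi V := phi a *: (v : V).
Fact restrict_scaleA a b v :
  restrict_scale a (restrict_scale b v) = restrict_scale (a * b) v.
Proof. by rewrite /restrict_scale scalerA -rmorphM. Qed.
Fact restrict_scale1 : left_id 1 restrict_scale.
Proof. by move=> v; rewrite /restrict_scale rmorph1 scale1r. Qed.
Fact restrict_scaleDr : right_distributive restrict_scale +%R.
Proof. by move=> a u v; apply: scalerDr. Qed.
Fact restrict_scaleDl v : {morph restrict_scale^~ v : a b / a + b}.
Proof. by move=> a b; rewrite /restrict_scale rmorphD; apply: scalerDl. Qed.
HB.instance Definition _ := GRing.Zmodule_isLmodule.Build A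
  (restrict_scalars phi V)
  restrict_scaleA restrict_scale1 restrict_scaleDr restrict_scaleDl.
End Object.

Section Map.
Variables (V W : lmodType B) (f : {linear V -> W}).
Definition restrict_map (v : restrict_scalars phi V) : restrict_scalars phi W :=
  f v.
Fact restrict_map_linear : linear restrict_map.
Proof. by move=> a u v; apply: (linearP f (phi a)). Qed.
HB.instance Definition _ := GRing.isLinear.Build A _ _ _ restrict_map
  restrict_map_linear.
End Map.
End RestrictScalars.

Definition rmorph_op (A B : nzRingType) (phi : {rmorphism A -> B}) :
  op A -> op B := phi.

Section RmorphOp.
Variables (A B : nzRingType) (phi : {rmorphism A -> B}).
Fact rmorph_op_additive : zmod_morphism (rmorph_op phi).
Proof. by move=> a b; apply: (rmorphB phi). Qed.
Fact rmorph_op_multiplicative : monoid_morphism (rmorph_op phi).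
Proof. by split=> [|a b]; [apply: (rmorph1 phi) | apply: (rmorphM phi)]. Qed.
HB.instance Definition _ := GRing.isZmodMorphism.Build (op A) (op B)
  (rmorph_op phi) rmorph_op_additive.
HB.instance Definition _ := GRing.isMonoidMorphism.Build (op A) (op B)
  (rmorph_op phi) rmorph_op_multiplicative.
End RmorphOp.

Section TensorRingModules.
Variables (R : nzRingType) (M : bimodule R R) (N : nat).
Notation T := (tensor_ring M N).

Definition forget (V : lmodType T) : lmodType R :=
  restrict_scalars (tring_of_ring M N) V.
Definition forget_map (V W : lmodType T) (f : {linear V -> W}) :
  {linear forget V -> forget W} := restrict_map (phi := tring_of_ring M N) f.
Definition forget_op (Y : lmodType (op T)) : lmodType (op R) :=
  restrict_scalars (rmorph_op (tring_of_ring M N)) Y.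
Definition forget_op_map (Y Z : lmodType (op T)) (f : {linear Y -> Z}) :
  {linear forget_op Y -> forget_op Z} :=
  restrict_map (phi := rmorph_op (tring_of_ring M N)) f.

Definition tring_ract (t : T) (r : R) : T := t * tring_of_ring M N r.
Fact tring_ractA t r s : tring_ract (tring_ract t r) s = tring_ract t (r * s).
Proof. by rewrite /tring_ract rmorphM mulrA. Qed.
Fact tring_ract1 t : tring_ract t 1 = t.
Proof. by rewrite /tring_ract rmorph1 mulr1. Qed.
Fact tring_ractDl t u r :
  tring_ract (t + u) r = tring_ract t r + tring_ract u r.
Proof. exact: mulrDl. Qed.
Fact tring_ractDr t r s :
  tring_ract t (r + s) = tring_ract t r + tring_ract t s.
Proof. by rewrite /tring_ract rmorphD mulrDr. Qed.
Fact tring_ractZ (s : T) (t : T^o) r :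
  tring_ract (s *: t) r = s *: (tring_ract t r : T^o).
Proof. exact/esym/mulrA. Qed.
Definition tring_bimod : bimodule T R :=
  @Bimodule T R T^o tring_ract
    tring_ractA tring_ract1 tring_ractDl tring_ractDr tring_ractZ.

Definition Ind (X : lmodType R) : lmodType T := tensor tring_bimod X.
Definition Coind (Y : lmodType (op R)) : lmodType (op T) := rhom tring_bimod Y.

(* The T-module V is identified with (forget V, struct_map V), where
   struct_map V : M (x) V -> V sends m (x) v to m v. *)
Section StructMap.
Variable V : lmodType T.
Definition struct_map : tensor M (forget V) -> forget V :=
  tensor_lift (fun (m : M) (v : forget V) =>
    (tring_of_bimod N m *: (v : V) : forget V)).
Lemma struct_map_bal : balanced (fun (m : M) (v : forget V) =>
    (tring_of_bimod N m *: (v : V) : forget V)).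
Proof.
split=> [m m' v|m v v'|m r v]; first by rewrite tring_of_bimodD; apply: (@scalerDl _ V v).
  exact: (@scalerDr _ V).
by rewrite tring_of_bimod_ract; apply/esym/(@scalerA _ V).
Qed.
Fact struct_map_linear : linear struct_map.
Proof.
move=> r t u; rewrite /struct_map (tensor_liftD struct_map_bal).
congr (_ + _); elim/tensor_ind: t => [|m v|t t' IH1 IH2].
- by rewrite scaler0 (tensor_lift0 struct_map_bal) scaler0.
- rewrite scale_tens !(tensor_lift_tens struct_map_bal) tring_of_bimodZ.
  exact/esym/(@scalerA _ V).
- by rewrite scalerDr !(tensor_liftD struct_map_bal) IH1 IH2 scalerDr.
Qed.
HB.instance Definition _ := GRing.isLinear.Build R _ _ _ struct_map
  struct_map_linear.
End StructMap.

(* The right T-module Y is identified with [forget_op Y, costruct_map Y], where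
   costruct_map Y : Y -> Hom_{R^op}(M, Y) sends y to (m |-> y m). *)
Section CostructMap.
Variable Y : lmodType (op T).
Definition costruct_fun (y : forget_op Y) (m : rmod M) : forget_op Y :=
  (tring_of_bimod N (m : M) : op T) *: (y : Y).
Fact costruct_fun_linear y : linear (costruct_fun y).
Proof.
move=> r m m'; rewrite /costruct_fun tring_of_bimodD tring_of_bimod_ract.
rewrite [LHS](@scalerDl _ Y y); congr (_ + _); exact/esym/(@scalerA _ Y).
Qed.
HB.instance Definition _ y := GRing.isLinear.Build (op R) _ _ _
  (costruct_fun y) (costruct_fun_linear y).
Definition costruct_map (y : forget_op Y) : rhom M (forget_op Y) :=
  costruct_fun y.
Fact costruct_map_linear : linear costruct_map.
Proof.
move=> r y z; apply: hom_ext => m /=; rewrite /costruct_fun [LHS](@scalerDr _ Y).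
by congr (_ + _); rewrite /bimod_lmul tring_of_bimodZ; apply: (@scalerA _ Y).
Qed.
HB.instance Definition _ := GRing.isLinear.Build (op R) _ _ _ costruct_map
  costruct_map_linear.
End CostructMap.

Definition Phi (X : lmodType R -> Prop) (V : lmodType T) : Prop :=
  injective (struct_map (V := V)) /\ X (coker (struct_map (V := V))).

Definition Psi (Y : lmodType (op R) -> Prop) (V : lmodType (op T)) : Prop :=
  (forall g, exists y, costruct_map (Y := V) y = g) /\
  Y (kernel (costruct_map (Y := V))).

End TensorRingModules.

Definition exact_at (A B C : zmodType) (f : A -> B) (g : B -> C) : Prop :=
  forall b, g b = 0 <-> exists a, f a = b.

Record complex (S : nzRingType) := Complex {
  cobj :> int -> lmodType S;
  cdiff : forall i, {linear cobj i -> cobj (i + 1)};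
  cdiffK : forall i x, cdiff (i + 1) (cdiff i x) = 0
}.

Section Gorenstein.
Variable S : nzRingType.

Definition exact_complex (C : complex S) : Prop :=
  forall i, exact_at (cdiff C i) (cdiff C (i + 1)).

(* hom_to_exact C W says that the complex Hom_S(C, W) is exact, and
   hom_from_exact V C that Hom_S(V, C) is exact. *)
Definition hom_to_exact (C : complex S) (W : lmodType S) : Prop :=
  forall i, exact_at (fun g : hom (C (i + 1 + 1)) W => hom_pre (cdiff C (i + 1)) g)
                     (fun g : hom (C (i + 1)) W => hom_pre (cdiff C i) g).

Definition hom_from_exact (V : lmodType S) (C : complex S) : Prop :=
  forall i, exact_at (fun g : hom V (C i) => hom_post (cdiff C i) g)
                     (fun g : hom V (C (i + 1)) => hom_post (cdiff C (i + 1)) g).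

Definition complete_proj_resolution (W : lmodType S -> Prop) (P : complex S) :
  Prop :=
  [/\ forall i, projective (P i), exact_complex P &
      forall X, W X -> hom_to_exact P X].

Definition Gorenstein_projective (W : lmodType S -> Prop) (G : lmodType S) :
  Prop :=
  exists2 P, complete_proj_resolution W P & isomorphic G (image_mod (cdiff P (-1))).

Definition complete_inj_resolution (V : lmodType S -> Prop) (I : complex S) :
  Prop :=
  [/\ forall i, injective_module (I i), exact_complex I &
      forall X, V X -> hom_from_exact X I].

Definition Gorenstein_injective (V : lmodType S -> Prop) (H : lmodType S) :
  Prop :=
  exists2 I, complete_inj_resolution V I & isomorphic H (kernel (cdiff I 0)).

Record proj_resolution (G : lmodType S) := ProjResolution {
  pobj :> nat -> lmodType S;
  pdiff : forall n, {linear pobj n.+1 -> pobj n};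
  paug : {linear pobj 0 -> G};
  pobj_proj : forall n, projective (pobj n);
  paug_surj : forall x, exists p, paug p = x;
  paug_exact : exact_at (pdiff 0) paug;
  pdiff_exact : forall n, exact_at (pdiff n.+1) (pdiff n)
}.

(* Ext^1(G, H) = 0: H^1 of Hom(P, H) vanishes for a projective resolution P of
   G; the choice of P is immaterial, so all of them are allowed. *)
Definition Ext1_vanishes (G H : lmodType S) : Prop :=
  forall P : proj_resolution G,
    exact_at (fun g : hom (P 0) H => hom_pre (pdiff P 0) g)
             (fun g : hom (P 1) H => hom_pre (pdiff P 1) g).

End Gorenstein.

Definition Tor1_vanishes (S R : nzRingType) (B : bimodule S R) (G : lmodType R) :
  Prop :=
  forall P : proj_resolution G,
    exact_at (tensor_map B (pdiff P 1)) (tensor_map B (pdiff P 0)).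

Section Conditions.
Variables (R : nzRingType) (M : bimodule R R) (N : nat).
Notation T := (tensor_ring M N).

(* The classes Ind(X) and Coind(Y), closed under isomorphism. *)
Definition Ind_class (X : lmodType R -> Prop) (V : lmodType T) : Prop :=
  exists2 A, X A & isomorphic V (Ind M N A).
Definition Coind_class (Y : lmodType (op R) -> Prop) (V : lmodType (op T)) :
  Prop :=
  exists2 A, Y A & isomorphic V (Coind M N A).

Definition compatible (X : lmodType R -> Prop) : Prop :=
  forall Q : complex T, complete_proj_resolution (Ind_class X) Q ->
    (forall i, exact_at (tensor_map M (forget_map (cdiff Q i)))
                        (tensor_map M (forget_map (cdiff Q (i + 1))))) /\
    (forall A, X A -> hom_to_exact Q (Ind M N (tensor M A))).

Definition admissible (X : lmodType R -> Prop) : Prop :=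
  forall G A (i : nat), Gorenstein_projective X G -> X A ->
    Ext1_vanishes G (tensor (tensor_pow M i) A) /\
    Tor1_vanishes M (tensor (tensor_pow M i) G).

Definition cocompatible (Y : lmodType (op R) -> Prop) : Prop :=
  forall I : complex (op T), complete_inj_resolution (Coind_class Y) I ->
    (forall i,
       exact_at
         (fun g : hom (rmod M) (forget_op (I i)) =>
            hom_post (forget_op_map (cdiff I i)) g)
         (fun g : hom (rmod M) (forget_op (I (i + 1))) =>
            hom_post (forget_op_map (cdiff I (i + 1))) g)) /\
    (forall A, Y A -> hom_from_exact (Coind M N (rhom M A)) I).

Definition coadmissible (Y : lmodType (op R) -> Prop) : Prop :=
  forall H A (i : nat), Gorenstein_injective Y H -> Y A ->
    Ext1_vanishes (rhom (tensor_pow M i) A : lmodType (op R)) H /\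
    Ext1_vanishes (rmod M : lmodType (op R))
      (rhom (tensor_pow M i) H : lmodType (op R)).

End Conditions.

(* Main.v *)
Require Import Defs.
From HB Require Import structures.
From mathcomp Require Import all_boot all_algebra.
From mathcomp Require Import boolp.
From mathcomp.multinomials Require Import freeg.

Set Implicit Arguments.
Unset Strict Implicit.
Unset Printing Implicit Defensive.

Import GRing.Theory.
Local Open Scope ring_scope.

(** A left module over T = T_R(M) is an R-module V with a map F V -> V, where
    F = M (x) - is right exact and F^(N+1) = 0; a right module is a right
    R-module V with a map V -> H V, where H = Hom(M, -) is left exact and
    H^(N+1) = 0. The two halves of the theorem are dual to each other. Each is
    proved for an arbitrary functor of this kind (algebra_setting and
    coalgebra_setting), and T is an instance because T = R + M (x) T as
    R-bimodules (tring_case). The cokernel of F V -> V is called the top of V,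
    the kernel of V -> H V its socle. What follows describes the left modules.

    A module is Gorenstein projective when it occurs in a chain, infinite in
    both directions, of syzygies 0 -> A -> P -> A' -> 0 with P projective such
    that every map from A to a module of the given class extends to P
    (Gorenstein_projectiveP). Complexes are used only to pass to such chains and
    back; everything else concerns one syzygy at a time.

    From T to R (Gorenstein_projective_ind_top). Let Q be a complete resolution
    over T and Z one of its syzygies. Projective T-modules have injective
    structure maps and projective tops. As F Q is exact, F Z -> F Q is injective,
    so the structure map of Z is injective as well, and then the tops of the
    syzygies form again a chain of syzygies. A map from the top of Z to a module
    A in X extends to the top of Q: the kernel of Ind A -> A is Ind (F A)
    (ind_radical), hence the exactness of Hom(Q, Ind (F A)) lifts the map to
    Z -> Ind A, and the exactness of Hom(Q, Ind A) extends this lift to Q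
    (proj_step_top).

    From R to T (Gorenstein_projective_of_top). The modules V with injective
    structure map and Gorenstein projective top G are closed under taking next
    and previous syzygies, hence Gorenstein projective by coinduction. Take a
    syzygy 0 -> G -> P -> G' -> 0. The map G -> P is lifted to V -> Ind P one
    degree at a time, by the vanishing of Ext^1(G, F^k P) (lift_to_ind). It is
    injective because all F^k G -> F^k P are, by the vanishing of Tor_1
    (mono_over_top), and its cokernel has top G' and an injective structure map
    (next_syzygy). Previous syzygies are kernels of the maps Ind P -> V given by
    the projectivity of P (previous_syzygy). Maps from V to Ind A, with A in X,
    extend to Ind P: extending the induced map of tops reduces the problem to
    maps from V to Ind (F A), and F is nilpotent (extends_ind). *)

(** * Linear maps and exact sequences *)

Section LinearMaps.
Variable S : nzRingType.
Implicit Types U V W A B C E P : lmodType S.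

Definition mk_linear V W (f : V -> W) (f_lin : linear f) : {linear V -> W} :=
  HB.pack f (GRing.isLinear.Build S V W *:%R f f_lin).

Definition lcomp U V W (g : {linear V -> W}) (f : {linear U -> V}) :
  {linear U -> W} := g \o f.
Definition ladd V W (f g : {linear V -> W}) : {linear V -> W} := f \+ g.
Definition lsub V W (f g : {linear V -> W}) : {linear V -> W} := f \- g.
Definition lopp V W (f : {linear V -> W}) : {linear V -> W} := \- f.
Definition lzero V W : {linear V -> W} := \0.
Definition lid V : {linear V -> V} := idfun.

Definition mono V W (f : {linear V -> W}) : Prop := forall x, f x = 0 -> x = 0.
Definition epi V W (f : {linear V -> W}) : Prop := forall w, exists v, f v = w.

Lemma mono_injective V W (f : {linear V -> W}) : mono f <-> injective f.
Proof.
split=> [f_mono|f_inj x fx0]; first exact: raddf_inj.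
by apply: f_inj; rewrite fx0 linear0.
Qed.

Definition im_is_ker U V W (f : {linear U -> V}) (g : {linear V -> W}) : Prop :=
  (forall x, g (f x) = 0) /\ (forall y, g y = 0 -> exists x, f x = y).

Lemma im_is_kerP U V W (f : {linear U -> V}) (g : {linear V -> W}) :
  exact_at f g <-> im_is_ker f g.
Proof.
split=> [ex|[gf0 ker_g] y].
  by split=> [x|y]; [apply/ex; exists x | move/ex].
by split=> [/ker_g //|[x <-]].
Qed.

Definition left_ex U V W (f : {linear U -> V}) (g : {linear V -> W}) : Prop :=
  mono f /\ im_is_ker f g.
Definition right_ex U V W (f : {linear U -> V}) (g : {linear V -> W}) : Prop :=
  im_is_ker f g /\ epi g.
Definition short_exact U V W (f : {linear U -> V}) (g : {linear V -> W}) : Prop :=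
  [/\ mono f, im_is_ker f g & epi g].

Lemma factor_epi E P B (e : {linear E -> P}) (t : {linear E -> B}) :
  epi e -> (forall x, e x = 0 -> t x = 0) ->
  exists h : {linear P -> B}, forall x, h (e x) = t x.
Proof.
move=> e_epi et; pose s p := projT1 (cid (e_epi p)).
have sK p : e (s p) = p by rewrite /s; case: cid.
have t_eq x y : e x = e y -> t x = t y.
  by move=> exy; apply/subr0_eq; rewrite -linearB et // linearB exy subrr.
have h_lin : linear (t \o s).
  move=> a p q /=; rewrite -linearP; apply: t_eq.
  by rewrite linearP !sK.
by exists (mk_linear h_lin) => x; apply: t_eq; rewrite sK.
Qed.

Lemma factor_mono E A P (i : {linear A -> P}) (t : {linear E -> P}) :
  mono i -> (forall x, exists a, i a = t x) ->
  exists h : {linear E -> A}, forall x, i (h x) = t x.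
Proof.
move=> /mono_injective i_inj it; pose h x := projT1 (cid (it x)).
have hE x : i (h x) = t x by rewrite /h; case: cid.
have h_lin : linear h by move=> a x y; apply: i_inj; rewrite linearP !hE linearP.
by exists (mk_linear h_lin).
Qed.

Lemma linl_linear A B : linear (fun a : A => (a, 0) : A * B)%type.
Proof. by move=> c a a'; congr (_, _); apply/esym; rewrite /= scaler0 addr0. Qed.
Lemma linr_linear A B : linear (fun b : B => (0, b) : A * B)%type.
Proof. by move=> c b b'; congr (_, _); apply/esym; rewrite /= scaler0 addr0. Qed.
Definition linl A B : {linear A -> (A * B)%type} := mk_linear (@linl_linear A B).
Definition linr A B : {linear B -> (A * B)%type} := mk_linear (@linr_linear A B).
Definition lfst A B : {linear (A * B)%type -> A} := fst.
Definition lsnd A B : {linear (A * B)%type -> B} := snd.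
Definition lcopair A B C (f : {linear A -> C}) (g : {linear B -> C}) :
  {linear (A * B)%type -> C} := ladd (lcomp f (lfst A B)) (lcomp g (lsnd A B)).
Definition lpair A B C (f : {linear C -> A}) (g : {linear C -> B}) :
  {linear C -> (A * B)%type} :=
  ladd (lcomp (linl A B) f) (lcomp (linr A B) g).

Lemma lpairE A B C (f : {linear C -> A}) (g : {linear C -> B}) x :
  lpair f g x = (f x, g x).
Proof. exact: (congr2 pair (addr0 _) (add0r _)). Qed.

Lemma coker_linear V W (f : {linear V -> W}) : linear (coker_proj f).
Proof.
move=> a x y.
rewrite [RHS](_ : _ = coker_add (coker_scale a (coker_proj f x)) (coker_proj f y)) //.
by rewrite coker_scaleE coker_addE.
Qed.
Definition coker_map V W (f : {linear V -> W}) : {linear W -> coker f} :=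
  mk_linear (@coker_linear V W f).

Lemma coker_map_right_ex V W (f : {linear V -> W}) : right_ex f (coker_map f).
Proof.
have ker_eq x : coker_map f x = 0 <-> exists v, f v = x.
  split=> [|[v <-]].
    by move/(@coker_projP _ _ _ f x 0); rewrite subr0 => /asboolP.
  by apply/(@coker_projP _ _ _ f _ 0); rewrite subr0; apply/asboolP; exists v.
split; last by elim/coker_ind=> w; exists w.
by split=> [x|y /ker_eq //]; apply/ker_eq; exists x.
Qed.

Definition ker_incl V W (f : {linear V -> W}) : {linear kernel f -> V} := \val.

Lemma ker_incl_left_ex V W (f : {linear V -> W}) : left_ex (ker_incl f) f.
Proof.
split; first by move=> x /= x0; apply: val_inj.
split=> [[x /= /eqP //]|y /eqP fy].
by exists (Kernel fy).
Qed.

Definition im_incl V W (f : {linear V -> W}) : {linear image_mod f -> W} := \val.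

Lemma im_incl_factor V W (f : {linear V -> W}) :
  mono (im_incl f) /\
  exists2 p : {linear V -> image_mod f}, epi p & forall x, im_incl f (p x) = f x.
Proof.
have im_incl_mono : mono (im_incl f) by move=> x /= x0; apply: val_inj.
split=> //; have [|p pE] := @factor_mono V _ _ (im_incl f) f im_incl_mono.
  move=> x; have fx : f x \in im_pred f by apply/asboolP; exists x.
  by exists (ImageMod fx).
exists p => // -[w w_im]; have /asboolP[v fv] := w_im.
by exists v; apply: val_inj; rewrite [LHS]pE.
Qed.

Lemma isomorphic_refl V : isomorphic V V.
Proof. by exists (lid V); exists id. Qed.

Lemma isomorphic_inv V W (f : {linear V -> W}) : bijective f ->
  exists g : {linear W -> V}, cancel f g /\ cancel g f.
Proof.
case=> g fK gK; have g_lin : linear g.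
  by move=> a x y; apply: (can_inj fK); rewrite linearP !gK.
by exists (mk_linear g_lin).
Qed.

Lemma isomorphicP V W : isomorphic V W <->
  exists (f : {linear V -> W}) (g : {linear W -> V}), cancel f g /\ cancel g f.
Proof.
split=> [[f /isomorphic_inv[g ?]]|[f [g [fK gK]]]]; first by exists f, g.
by exists f; exists g.
Qed.

Lemma isomorphic_sym V W : isomorphic V W -> isomorphic W V.
Proof. by move=> /isomorphicP[f [g [fK gK]]]; apply/isomorphicP; exists g, f. Qed.

Lemma isomorphic_trans V W U :
  isomorphic V W -> isomorphic W U -> isomorphic V U.
Proof.
move=> [f f_bij] [g g_bij]; exists (lcomp g f); exact: bij_comp g_bij f_bij.
Qed.

Lemma mono_epi_isomorphic V W (f : {linear V -> W}) :
  mono f -> epi f -> isomorphic V W.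
Proof.
move=> f_mono f_epi; have [|g gE] := factor_mono (t := lid W) f_mono.
  exact: f_epi.
exists f; exists g => // x; apply: (iffLR (mono_injective f) f_mono); exact: gE.
Qed.

Lemma epi_unique V W W' (e : {linear V -> W}) (e' : {linear V -> W'}) :
  epi e -> epi e' -> (forall x, e x = 0 <-> e' x = 0) -> isomorphic W W'.
Proof.
move=> e_epi e'_epi ker_eq.
have [|h hE] := factor_epi (t := e') e_epi; first by move=> x /ker_eq.
apply: (@mono_epi_isomorphic _ _ h) => [w|w'].
  by have [v <-] := e_epi w; rewrite hE => /ker_eq.
by have [v <-] := e'_epi w'; exists (e v).
Qed.

Lemma mono_unique V V' W (i : {linear V -> W}) (i' : {linear V' -> W}) :
  mono i -> mono i' ->
  (forall w, (exists v, i v = w) <-> (exists v', i' v' = w)) ->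
  isomorphic V V'.
Proof.
move=> i_mono i'_mono im_eq.
have [|h hE] := factor_mono (t := i) i'_mono.
  by move=> x; apply/im_eq; exists x.
apply: (@mono_epi_isomorphic _ _ h) => [x hx|v'].
  by apply: i_mono; rewrite -hE hx linear0.
have [|v iv] := iffRL (im_eq (i' v')); first by exists v'.
by exists v; apply: (iffLR (mono_injective i') i'_mono); rewrite hE.
Qed.

End LinearMaps.

(** * Functors on a module category *)

(** Additive endofunctors suffice: M (x) - and Hom(M, -) are iterated. *)
Record functor (S : nzRingType) := Functor {
  fobj :> lmodType S -> lmodType S;
  fmap : forall V W : lmodType S, {linear V -> W} -> {linear fobj V -> fobj W};
  fmap_id : forall (V : lmodType S) x, fmap (lid V) x = x;
  fmap_comp : forall (U V W : lmodType S) (g : {linear V -> W}) (f : {linear U -> V}) x,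
    fmap (lcomp g f) x = fmap g (fmap f x);
  fmap_add : forall (V W : lmodType S) (f g : {linear V -> W}) x,
    fmap (ladd f g) x = fmap f x + fmap g x
}.
Arguments fmap {S} F {V W} f : rename.
Arguments fmap_id {S} F {V} x : rename.

Section Functors.
Variable S : nzRingType.
Implicit Types (F G : functor S) (U V W A B : lmodType S).

Lemma fmap_ext F V W (f g : {linear V -> W}) : f =1 g -> fmap F f =1 fmap F g.
Proof. by move=> fg x; rewrite (hom_ext (f := f) (g := g) fg). Qed.

Lemma fmap_zero F V W (f : {linear V -> W}) :
  (forall x, f x = 0) -> forall x, fmap F f x = 0.
Proof.
move=> f0 x; apply: (addrI (fmap F f x)); rewrite addr0 -fmap_add.
by apply: fmap_ext => y /=; rewrite f0 addr0.
Qed.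

(** Functoriality is used pointwise, because the maps that occur agree without
    being composites syntactically. *)
Lemma fmap_tri F U V W (g : {linear V -> W}) (f : {linear U -> V})
    (h : {linear U -> W}) :
  (forall x, g (f x) = h x) -> forall x, fmap F g (fmap F f x) = fmap F h x.
Proof. by move=> gf x; rewrite -fmap_comp; apply: fmap_ext. Qed.

Lemma fmap_sq F U V V' W (g : {linear V -> W}) (f : {linear U -> V})
    (g' : {linear V' -> W}) (f' : {linear U -> V'}) :
  (forall x, g (f x) = g' (f' x)) ->
  forall x, fmap F g (fmap F f x) = fmap F g' (fmap F f' x).
Proof. by move=> gf x; rewrite -!fmap_comp; apply: fmap_ext. Qed.

Lemma fmap_null F U V W (g : {linear V -> W}) (f : {linear U -> V}) :
  (forall x, g (f x) = 0) -> forall x, fmap F g (fmap F f x) = 0.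
Proof. by move=> gf x; rewrite -fmap_comp fmap_zero. Qed.

Lemma fmap_cancel F V W (g : {linear V -> W}) (f : {linear W -> V}) :
  (forall x, g (f x) = x) -> forall x, fmap F g (fmap F f x) = x.
Proof. by move=> gf x; rewrite (fmap_tri _ (h := lid W)) ?fmap_id. Qed.

Lemma fmap_split F V A B (e : {linear V -> A}) (n : {linear A -> V})
    (r : {linear V -> B}) (s : {linear B -> V}) :
  (forall x, n (e x) + s (r x) = x) ->
  forall x, fmap F n (fmap F e x) + fmap F s (fmap F r x) = x.
Proof.
move=> nesr x; rewrite -!fmap_comp -fmap_add -[RHS](fmap_id F).
by apply: fmap_ext => y; apply: nesr.
Qed.

Lemma fmap_iso F V W : isomorphic V W -> isomorphic (F V) (F W).
Proof.
move=> /isomorphicP[f [g [fK gK]]]; apply/isomorphicP; exists (fmap F f), (fmap F g).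
by split; apply: fmap_cancel.
Qed.

Definition right_exact F : Prop :=
  forall U V W (f : {linear U -> V}) (g : {linear V -> W}),
    right_ex f g -> right_ex (fmap F f) (fmap F g).
Definition left_exact F : Prop :=
  forall U V W (f : {linear U -> V}) (g : {linear V -> W}),
    left_ex f g -> left_ex (fmap F f) (fmap F g).

Lemma right_exact_epi F V W (g : {linear V -> W}) :
  right_exact F -> epi g -> epi (fmap F g).
Proof.
move=> Frex g_epi; apply: (proj2 (Frex _ _ _ (ker_incl g) g _)).
by split=> //; case: (ker_incl_left_ex g).
Qed.

Lemma left_exact_mono F V W (f : {linear V -> W}) :
  left_exact F -> mono f -> mono (fmap F f).
Proof.
move=> Flex f_mono; apply: (proj1 (Flex _ _ _ f (coker_map f) _)).
by split=> //; case: (coker_map_right_ex f).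
Qed.

Definition fun_id : functor S :=
  @Functor S id (fun V W f => f) (fun V x => erefl) (fun U V W g f x => erefl)
    (fun V W f g x => erefl).

Section Composition.
Variables F G : functor S.
Fact fun_comp_id V x : fmap F (fmap G (lid V)) x = x.
Proof. by rewrite -[RHS](fmap_id F); apply: fmap_ext; apply: fmap_id. Qed.
Fact fun_comp_comp U V W (g : {linear V -> W}) (f : {linear U -> V}) x :
  fmap F (fmap G (lcomp g f)) x = fmap F (fmap G g) (fmap F (fmap G f) x).
Proof. by rewrite -fmap_comp; apply: fmap_ext; apply: fmap_comp. Qed.
Fact fun_comp_add V W (f g : {linear V -> W}) x :
  fmap F (fmap G (ladd f g)) x = fmap F (fmap G f) x + fmap F (fmap G g) x.
Proof. by rewrite -fmap_add; apply: fmap_ext; apply: fmap_add. Qed.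
Definition fun_comp : functor S :=
  @Functor S (fun V => F (G V)) (fun V W f => fmap F (fmap G f))
    fun_comp_id fun_comp_comp fun_comp_add.
End Composition.

(** The new factor is applied first, so that F^(k+1) V is F^k (F V) by
    definition: a structure map of V then induces F^(k+1) V -> F^k V, or a map
    in the other direction, without any transport. *)
Fixpoint fun_pow F k : functor S :=
  if k is k'.+1 then fun_comp (fun_pow F k') F else fun_id.

Lemma fun_pow_right_exact F k : right_exact F -> right_exact (fun_pow F k).
Proof.
move=> Frex; elim: k => [|k IHk] U V W f g fg //=.
exact: IHk (Frex _ _ _ _ _ fg).
Qed.

Lemma fun_pow_left_exact F k : left_exact F -> left_exact (fun_pow F k).
Proof.
move=> Flex; elim: k => [|k IHk] U V W f g fg //=.
exact: IHk (Flex _ _ _ _ _ fg).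
Qed.

Definition nilpotent_functor F n : Prop :=
  forall A (x : fun_pow F n A), x = 0.

Lemma nilpotent_functor_add F m n :
  nilpotent_functor F n -> nilpotent_functor F (m + n).
Proof. by move=> F_nil; elim: m => // m IHm A; apply: IHm. Qed.

End Functors.

Arguments fmap_ext {S} F {V W f g} fg x : rename.
Arguments fmap_zero {S} F {V W f} f0 x : rename.
Arguments fmap_tri {S} F {U V W g f h} gf x : rename.
Arguments fmap_sq {S} F {U V V' W g f g' f'} gf x : rename.
Arguments fmap_null {S} F {U V W g f} gf x : rename.
Arguments fmap_cancel {S} F {V W g f} gf x : rename.
Arguments fmap_split {S} F {V A B e n r s} nesr x : rename.

Lemma fun_pow_succ (S : nzRingType) (F : functor S) k (V W : lmodType S)
    (f : {linear V -> W}) (x : fun_pow F k.+1 V) :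
  fmap (fun_pow F k.+1) f x = fmap (fun_pow F k) (fmap F f) x.
Proof. by []. Qed.

(** * Projective resolutions and first derived functors *)

Section Resolutions.
Variable S : nzRingType.
Implicit Types U V W A B C D E P : lmodType S.

Lemma fglift_linear (K : choiceType) V (f : K -> V) :
  linear (fglift f : {freeg K / S} -> V).
Proof.
have fgB := lift_is_additive f.
have fg0 : fglift f 0 = 0 by rewrite -(subrr (0 : {freeg K / S})) fgB subrr.
have fgD (D D' : {freeg K / S}) : fglift f (D + D') = fglift f D + fglift f D'.
  by rewrite -[in LHS](opprK D') fgB -(sub0r D') fgB fg0 sub0r opprK.
move=> a D D'; rewrite fgD; congr (_ + _).
rewrite -{2}(freeg_sumE D) [a *: D]/(fgscale a D) /fgscale.
rewrite !(big_morph _ fgD fg0) scaler_sumr.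
by apply: eq_bigr => x _; rewrite !liftU scalerA.
Qed.

Definition free_cover V : {linear {freeg V / S} -> V} :=
  mk_linear (@fglift_linear V V id).

Lemma free_cover_epi V : epi (free_cover V).
Proof. by move=> v; exists << 1 *g v >>%R; rewrite /= liftU scale1r. Qed.

Lemma free_projective (K : choiceType) : projective ({freeg K / S} : lmodType S).
Proof.
move=> V W g f g_epi.
pose s k := projT1 (cid (g_epi (f << 1 *g k >>))).
exists (mk_linear (fglift_linear s)) => D /=.
rewrite -(freeg_sumE D).
pose h := mk_linear (fglift_linear s); rewrite -[fglift s _]/(h _) !linear_sum /=.
apply: eq_bigr => k _.
have -> c : << c *g k >> = c *: << 1 *g k >> :> {freeg K / S}.
  apply/eqP/freeg_eqP => x; rewrite coeffZ !coeffU mul1r //.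
rewrite -[fglift s _]/(h _) !linearZ /=; congr (_ *: _).
by rewrite liftU scale1r /s; case: cid.
Qed.

Fixpoint syzygy V n : lmodType S :=
  if n is n'.+1 then kernel (free_cover (syzygy V n')) else V.

Definition syzygy_diff V n :
  {linear {freeg (syzygy V n.+1) / S} -> {freeg (syzygy V n) / S}} :=
  lcomp (ker_incl (free_cover (syzygy V n))) (free_cover (syzygy V n.+1)).

Lemma ker_cover_exact V W (g : {linear V -> W}) :
  exact_at (lcomp (ker_incl g) (free_cover (kernel g))) g.
Proof.
apply/im_is_kerP; split=> [x|y gy0].
  by have [_ [gk0 _]] := ker_incl_left_ex g; apply: gk0.
have [_ [_ /(_ y gy0)[k ky]]] := ker_incl_left_ex g.
by have [x xk] := free_cover_epi k; exists x; rewrite -ky -xk.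
Qed.

Lemma mono_comp_exact U V W W' (f : {linear U -> V}) (g : {linear V -> W})
  (i : {linear W -> W'}) : mono i -> exact_at f g -> exact_at f (lcomp i g).
Proof.
move=> i_mono fg y; split=> [/i_mono /fg //|/fg gy0].
by rewrite /= gy0 linear0.
Qed.

Definition free_resolution V : proj_resolution V :=
  @ProjResolution S V (fun n => {freeg (syzygy V n) / S} : lmodType S)
    (syzygy_diff V) (free_cover V) (fun n => @free_projective (syzygy V n))
    (@free_cover_epi V) (ker_cover_exact (free_cover V))
    (fun n => mono_comp_exact (proj1 (ker_incl_left_ex _))
       (ker_cover_exact (free_cover (syzygy V n.+1)))).

(** The start of the comparison map from a projective resolution of C to the
    exact sequence 0 -> A -> E -> D -> 0, over a map C -> D. *)
Lemma resolution_lift A E D C (i : {linear A -> E}) (q : {linear E -> D})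
    (h : {linear C -> D}) (L : proj_resolution C) :
  short_exact i q ->
  exists (l : {linear L 0 -> E}) (m : {linear L 1 -> A}),
    [/\ forall x, q (l x) = h (paug L x), forall x, i (m x) = l (pdiff L 0 x) &
        forall x, m (pdiff L 1 x) = 0].
Proof.
case=> i_mono [qi0 ker_q] q_epi.
have [augd0 _] := iffLR (im_is_kerP _ _) (@paug_exact _ _ L).
have [dd0 _] := iffLR (im_is_kerP _ _) (@pdiff_exact _ _ L 0).
have [l lE] := @pobj_proj _ _ L 0 _ _ q (lcomp h (paug L)) q_epi.
have [|m mE] := factor_mono (t := lcomp l (pdiff L 0)) i_mono.
  by move=> x; apply: ker_q; rewrite /= lE /= augd0 linear0.
exists l, m; split=> // x; apply: i_mono; rewrite mE /= dd0 linear0 //.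
Qed.

(** Lifting C -> D to the first term of a projective resolution leaves a cocycle
    with values in B as the obstruction to descending to C. *)
Lemma Ext1_vanishes_lifts C B E D (i : {linear B -> E}) (q : {linear E -> D}) :
  Ext1_vanishes C B -> short_exact i q ->
  forall h : {linear C -> D}, exists h' : {linear C -> E}, forall x, q (h' x) = h x.
Proof.
move=> ext iq h; pose L := free_resolution C.
have [l [m [lE mE md0]]] := resolution_lift h L iq.
have [_ [qi0 _] _] := iq.
have [|t tE] := iffLR (ext L m); first by apply: hom_ext => x; apply: md0.
have {}tE x : t (pdiff L 0 x) = m x by rewrite -tE.
have [augd0 ker_aug] := iffLR (im_is_kerP _ _) (@paug_exact _ _ L).
have [|h' h'E] := @factor_epi _ _ _ _ (paug L) (lsub l (lcomp i t)) (@paug_surj _ _ L).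
  by move=> x /ker_aug[y <-]; rewrite /= tE mE subrr.
exists h' => c; have [x <-] := @paug_surj _ _ L c.
by rewrite h'E /= linearB /= qi0 subr0.
Qed.

(** P is the pushout of A <- L1 -> L0; a right exact functor preserves this
    presentation, and both Ext^1 and Tor_1 are read off from it. *)
Lemma resolution_pushout A P C (i : {linear A -> P}) (q : {linear P -> C})
    (L : proj_resolution C) :
  short_exact i q ->
  exists (l : {linear L 0 -> P}) (m : {linear L 1 -> A}),
    (forall x, m (pdiff L 1 x) = 0) /\
    right_ex (lpair (lopp m) (pdiff L 0)) (lcopair i l).
Proof.
move=> iq; have [l [m [lE mE md0]]] := resolution_lift (lid C) L iq.
have [i_mono [qi0 ker_q] q_epi] := iq.
have [augd0 ker_aug] := iffLR (im_is_kerP _ _) (@paug_exact _ _ L).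
exists l, m; split=> //; split; last first.
  move=> p; have [x xE] := @paug_surj _ _ L (q p).
  have [a aE] : exists a, i a = p - l x.
    by apply: ker_q; rewrite linearB lE /= xE subrr.
  by exists (a, x); rewrite /= aE subrK.
split=> [x|[a x] ax0]; first by rewrite lpairE /= linearN mE addNr.
have {}ax0 : i a + l x = 0 := ax0.
have [|y yx] := ker_aug x.
  move: (congr1 q ax0); rewrite linearD qi0 add0r lE /= => ->.
  by rewrite linear0.
exists y; rewrite lpairE /= yx; congr (_, _); apply/subr0_eq/i_mono.
by rewrite linearB linearN mE yx /= -opprD addrC ax0 oppr0.
Qed.

(** A map on A gives a cocycle on L1; a cochain on L0 that bounds it is what is
    needed to extend the map to the pushout P. *)
Lemma Ext1_vanishes_extends A P C B (i : {linear A -> P}) (q : {linear P -> C}) :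
  Ext1_vanishes C B -> short_exact i q ->
  forall h : {linear A -> B}, exists h' : {linear P -> B}, forall x, h' (i x) = h x.
Proof.
move=> ext iq h; pose L := free_resolution C.
have [l [m [md0 [[_ ker_il] il_epi]]]] := resolution_pushout L iq.
have [|t tE] := iffLR (ext L (lcomp h m)).
  by apply: hom_ext => x; rewrite /= md0 linear0.
have {}tE x : t (pdiff L 0 x) = h (m x).
  by rewrite -[RHS]/(lcomp h m x) -tE.
have [|h' h'E] := factor_epi (t := lcopair h t) il_epi.
  move=> p /ker_il[y <-]; rewrite lpairE /= linearN tE addNr //.
exists h' => a; have := h'E (a, 0).
by rewrite /= !linear0 !addr0.
Qed.

(** All resolutions are allowed, as in Tor1_vanishes, which is the case of the
    functor M (x) -. *)
Definition derived1_vanishes (F : functor S) C : Prop :=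
  forall L : proj_resolution C,
    exact_at (fmap F (pdiff L 1)) (fmap F (pdiff L 0)).

(** An element that F i kills comes from a cycle of F L1, which is a boundary. *)
Lemma derived1_vanishes_mono (F : functor S) A P C
    (i : {linear A -> P}) (q : {linear P -> C}) :
  right_exact F -> derived1_vanishes F C -> short_exact i q -> mono (fmap F i).
Proof.
move=> Frex tor iq z iz0; pose L := free_resolution C.
have [l [m [md0 il]]] := resolution_pushout L iq.
have [[_ ker_Fil] _] := Frex _ _ _ _ _ il.
have [|w wE] := ker_Fil (fmap F (linl A (L 0)) z).
  rewrite (@fmap_tri _ _ _ _ _ _ _ i) // => x.
  by rewrite /= linear0 addr0.
have w0 : fmap F (pdiff L 0) w = 0.
  rewrite -(@fmap_tri _ F _ _ _ (lsnd A (L 0)) (lpair (lopp m) (pdiff L 0))).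
    by rewrite wE fmap_null.
  by move=> x; rewrite lpairE.
have /tor[w' ww'] := w0.
have -> : z = fmap F (lopp m) w.
  rewrite -(@fmap_tri _ F _ _ _ (lfst A (L 0)) (lpair (lopp m) (pdiff L 0))).
    by rewrite wE fmap_cancel.
  by move=> x; rewrite lpairE.
by rewrite -ww' fmap_null // => x; rewrite /= md0 oppr0.
Qed.

Lemma transport_epi P C C' (a : {linear P -> C}) (u : {linear C -> C'})
  (v : {linear C' -> C}) : cancel v u -> epi a -> epi (lcomp u a).
Proof.
by move=> vK a_epi x; have [y yE] := a_epi (v x); exists y; rewrite /= yE vK.
Qed.

Definition resolution_transport C C' (u : {linear C -> C'}) (v : {linear C' -> C})
    (vK : cancel v u) (uK : cancel u v) (L : proj_resolution C) :
  proj_resolution C' :=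
  @ProjResolution S C' L (pdiff L) (lcomp u (paug L)) (@pobj_proj _ _ L)
    (transport_epi vK (@paug_surj _ _ L))
    (mono_comp_exact (iffRL (mono_injective u) (can_inj uK)) (@paug_exact _ _ L))
    (@pdiff_exact _ _ L).

Lemma derived1_vanishes_iso (F : functor S) C C' :
  isomorphic C C' -> derived1_vanishes F C -> derived1_vanishes F C'.
Proof.
move=> /isomorphicP[u [v [uK vK]]] der L; exact: der (resolution_transport uK vK L).
Qed.

Lemma Ext1_vanishes_iso_l C C' B :
  isomorphic C C' -> Ext1_vanishes C B -> Ext1_vanishes C' B.
Proof.
move=> /isomorphicP[u [v [uK vK]]] ext L; exact: ext (resolution_transport uK vK L).
Qed.

Lemma Ext1_vanishes_iso_r C B B' :
  isomorphic B B' -> Ext1_vanishes C B -> Ext1_vanishes C B'.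
Proof.
move=> /isomorphicP[u [v [uK vK]]] ext L g; split=> [gd0|[h <-]]; last first.
  have [dd0 _] := iffLR (im_is_kerP _ _) (@pdiff_exact _ _ L 0).
  by apply: hom_ext => x; rewrite /= dd0 linear0.
have [|h hE] := iffLR (ext L (lcomp v g)).
  apply: hom_ext => x; rewrite -[LHS]/(v (hom_pre (pdiff L 1) g x)) gd0.
  exact: linear0.
exists (lcomp u h); apply: hom_ext => x.
rewrite -[LHS]/(u (hom_pre (pdiff L 0) h x)) hE; exact: vK.
Qed.
End Resolutions.

(** * Gorenstein modules as syzygies in a chain *)

(** Exactness of a complex is stated at the objects with index i + 1, so that
    properties of its syzygies are first obtained there. *)
Lemma int_succ_ind (P : int -> Prop) : (forall i, P (i + 1)) -> forall i, P i.
Proof. by move=> P1 i; rewrite -(subrK 1 i). Qed.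

Lemma biinfinite_chain (T : Type) (K : T -> Prop) (r : T -> T -> Prop) :
  (forall x, K x -> exists2 y, K y & r x y) ->
  (forall x, K x -> exists2 y, K y & r y x) ->
  forall x, K x -> exists2 Z : int -> T, Z 0 = x & forall i, r (Z i) (Z (i + 1)).
Proof.
move=> right left x Kx.
have choose (s : T -> T -> Prop) : (forall x, K x -> exists2 y, K y & s x y) ->
    exists f, forall x, K x -> K (f x) /\ s x (f x).
  move=> step; suff /choice[f fP] : forall y, exists z, K y -> K z /\ s y z by exists f.
  move=> y.
  have [/step[z Kz syz]|nKy] := pselect (K y); first by exists z.
  by exists y => /nKy.
have [nx nxP] := choose r right; have [pv pvP] := choose (fun a b => r b a) left.
have Knx n : K (iter n nx x) by elim: n => //= n /nxP[].
have Kpv n : K (iter n pv x) by elim: n => //= n /pvP[].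
exists (fun i => match i with Posz n => iter n nx x | Negz n => iter n.+1 pv x end).
  by [].
case=> [n|[|n]].
- by rewrite -PoszD addn1; have [] := nxP _ (Knx n).
- by rewrite NegzE addNr; have [] := pvP _ Kx.
- have -> : Negz n.+1 + 1 = Negz n by rewrite !NegzE -addn1 PoszD opprD subrK.
  by have [] := pvP _ (Kpv n.+1).
Qed.

Section Chains.
Variable S : nzRingType.
Implicit Types V W A B P X Y : lmodType S.

Definition extends A P (f : {linear A -> P}) W : Prop :=
  forall h : {linear A -> W}, exists h' : {linear P -> W}, forall x, h' (f x) = h x.
Definition lifts P B (g : {linear P -> B}) V : Prop :=
  forall h : {linear V -> B}, exists h' : {linear V -> P}, forall x, g (h' x) = h x.

(** A and B are consecutive syzygies of a complete resolution. As a bare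
    proposition about A and B, a step is transported along equalities of integer
    indices by rewriting, which the differentials of a complex are not. *)
Definition proj_step (W : lmodType S -> Prop) A B : Prop :=
  exists P (f : {linear A -> P}) (g : {linear P -> B}),
    [/\ projective P, short_exact f g & forall X, W X -> extends f X].
Definition inj_step (V : lmodType S -> Prop) A B : Prop :=
  exists (I : lmodType S) (f : {linear A -> I}) (g : {linear I -> B}),
    [/\ injective_module I, short_exact f g & forall X, V X -> lifts g X].

Lemma extends_iso A P (f : {linear A -> P}) W W' :
  isomorphic W W' -> extends f W -> extends f W'.
Proof.
move=> /isomorphicP[u [v [uK vK]]] fW h; have [h' h'E] := fW (lcomp v h).
by exists (lcomp u h') => x; rewrite /= h'E /= vK.
Qed.

Lemma lifts_iso P B (g : {linear P -> B}) V V' :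
  isomorphic V V' -> lifts g V -> lifts g V'.
Proof.
move=> /isomorphicP[u [v [uK vK]]] gV h; have [h' h'E] := gV (lcomp h u).
by exists (lcomp h' v) => x; rewrite /= h'E /= vK.
Qed.

Lemma complex_slice (C : complex S) : exact_complex C -> forall i,
  exists g : {linear C i -> kernel (cdiff C (i + 1))},
    (forall x, ker_incl _ (g x) = cdiff C i x) /\ short_exact (ker_incl (cdiff C i)) g.
Proof.
move=> exC i; have [k_mono [dk0 ker_d]] := ker_incl_left_ex (cdiff C i).
have [k'_mono [dk'0 ker_d']] := ker_incl_left_ex (cdiff C (i + 1)).
have [dd0 ex_d] := iffLR (im_is_kerP _ _) (exC i).
have [|g gE] := factor_mono (t := cdiff C i) k'_mono.
  by move=> x; apply: ker_d'.
exists g; split=> //; split=> // [|z].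
  split=> [x|y gy0]; first by apply: k'_mono; rewrite gE dk0.
  by apply: ker_d; rewrite -gE gy0 linear0.
have [x xE] := ex_d _ (dk'0 z).
by exists x; apply: (iffLR (mono_injective _) k'_mono); rewrite gE.
Qed.

(** A map on the syzygy is a map on the preceding object of C that vanishes on
    boundaries. *)
Lemma hom_to_exact_extends (C : complex S) W : exact_complex C ->
  hom_to_exact C W -> forall i, extends (ker_incl (cdiff C i)) W.
Proof.
move=> exC CW; apply: int_succ_ind; apply: int_succ_ind => i h.
have [g [gE [_ [g0 _] g_epi]]] := complex_slice exC (i + 1).
have [dd0 _] := iffLR (im_is_kerP _ _) (exC i).
have [_ [_ ker_d]] := ker_incl_left_ex (cdiff C (i + 1)).
have [|h' h'E] := iffLR (CW i (lcomp h g)).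
  apply: hom_ext => x /=.
  by have [y <-] := ker_d _ (dd0 x); rewrite g0 linear0.
exists h' => k; have [x <-] := g_epi k; rewrite gE.
by rewrite -[RHS]/(lcomp h g x) -h'E.
Qed.

Lemma hom_from_exact_lifts (C : complex S) V : exact_complex C ->
  hom_from_exact V C -> forall i (g : {linear C i -> kernel (cdiff C (i + 1))}),
    (forall x, ker_incl _ (g x) = cdiff C i x) -> lifts g V.
Proof.
move=> exC CV i g gE h; have [k_mono [dk0 _]] := ker_incl_left_ex (cdiff C (i + 1)).
have [|h' h'E] := iffLR (CV i (lcomp (ker_incl _) h)).
  by apply: hom_ext => x; apply: dk0.
exists h' => x; apply: (iffLR (mono_injective _) k_mono).
by rewrite gE -[RHS]/(lcomp (ker_incl (cdiff C (i + 1))) h x) -h'E.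
Qed.

(** The inverse of slicing: the differentials are the composites
    C i -> Z (i + 1) -> C (i + 1). *)
Lemma splice (cond : forall A P B, {linear A -> P} -> {linear P -> B} -> Prop)
    (Z : int -> lmodType S) :
  (forall i, exists P (f : {linear Z i -> P}) (g : {linear P -> Z (i + 1)}),
     short_exact f g /\ cond _ _ _ f g) ->
  exists (C : complex S) (f : forall i, {linear Z i -> C i})
      (g : forall i, {linear C i -> Z (i + 1)}),
    [/\ exact_complex C, forall i x, cdiff C i x = f (i + 1) (g i x),
        forall i, short_exact (f i) (g i) & forall i, cond _ _ _ (f i) (g i)].
Proof.
move=> step.
pose T i := {P : lmodType S & ({linear Z i -> P} * {linear P -> Z (i + 1)%R})%type}.
have {}step i : exists s : T i, short_exact (projT2 s).1 (projT2 s).2 /\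
    cond _ _ _ (projT2 s).1 (projT2 s).2.
  by have [P [f [g fgP]]] := step i; exists (existT _ P (f, g)).
pose P i := projT1 (projT1 (cid (step i))).
pose f i : {linear Z i -> P i} := (projT2 (projT1 (cid (step i)))).1.
pose g i : {linear P i -> Z (i + 1)} := (projT2 (projT1 (cid (step i)))).2.
have fgP i : short_exact (f i) (g i) /\ cond _ _ _ (f i) (g i) :=
  projT2 (cid (step i)).
have fg_ex i := proj1 (fgP i).
move: P f g fgP fg_ex => P f g fgP fg_ex.
have d0 i x : lcomp (f (i + 1 + 1)) (g (i + 1)) (lcomp (f (i + 1)) (g i) x) = 0.
  by have [_ [gf0 _] _] := fg_ex (i + 1); rewrite /= gf0 linear0.
exists (Complex d0), f, g; split=> // i; last by case: (fgP i).
apply/im_is_kerP; split=> // y.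
have [f_mono [_ ker_g] _] := fg_ex (i + 1).
have [f'_mono _ _] := fg_ex (i + 1 + 1); have [_ _ g_epi] := fg_ex i.
move=> /f'_mono /ker_g[z <-]; have [x <-] := g_epi z.
by exists x.
Qed.

Lemma image_kernel_iso (C : complex S) : exact_complex C ->
  isomorphic (image_mod (cdiff C (-1))) (kernel (cdiff C 0)).
Proof.
move=> exC; pose d : {linear C (-1) -> C 0} := cdiff C (-1).
have [i_mono [p p_epi pE]] := im_incl_factor d.
have [k_mono [dk0 ker_d]] := ker_incl_left_ex (cdiff C 0).
have [dd0 ex_d] := iffLR (im_is_kerP _ _) (exC (-1)).
apply: (mono_unique i_mono k_mono) => y; split=> [[v <-]|[v <-]].
  by have [x <-] := p_epi v; apply: ker_d; rewrite pE; apply: dd0.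
by have [x xE] := ex_d _ (dk0 v); exists (p x); rewrite pE.
Qed.

Lemma Gorenstein_projectiveP (W : lmodType S -> Prop) V :
  Gorenstein_projective W V <->
  exists2 Z : int -> lmodType S, forall i, proj_step W (Z i) (Z (i + 1)) &
    isomorphic V (Z 0).
Proof.
split=> [[C [C_proj exC CW] V_iso]|[Z stepZ V_iso]].
  exists (fun i => kernel (cdiff C i)) => [i|].
    have [g [_ kg_ex]] := complex_slice exC i.
    exists (C i), (ker_incl (cdiff C i)), g; split=> // X /CW CX.
    exact: hom_to_exact_extends.
  exact: isomorphic_trans V_iso (image_kernel_iso exC).
have [|C [f [g [exC dE fg_ex fg_cond]]]] := @splice
    (fun A P B f g => projective P /\ forall X, W X -> extends f X) Z.
  by move=> i; have [P [f [g [? ? ?]]]] := stepZ i; exists P, f, g.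
exists C; last first.
  apply: isomorphic_trans V_iso _; pose d : {linear C (-1) -> C 0} := cdiff C (-1).
  have [i_mono [p p_epi pE]] := im_incl_factor d.
  have [f_mono _ _] := fg_ex 0; have [_ _ g_epi] := fg_ex (-1).
  apply: (mono_unique f_mono i_mono) => y; split=> [[v <-]|[v <-]].
    by have [x <-] := g_epi v; exists (p x); rewrite pE; exact: (dE (-1) x).
  by have [x <-] := p_epi v; exists (g (-1) x); rewrite pE; exact: esym (dE (-1) x).
split=> // [i|X WX i]; first by have [] := fg_cond i.
move=> h; split=> [hd0|[h' <-]]; last first.
  apply: hom_ext => x; have [dd0 _] := iffLR (im_is_kerP _ _) (exC i).
  by rewrite /= dd0 linear0.
have [f_mono [gf0 ker_g] g_epi] := fg_ex (i + 1); have [_ _ g'_epi] := fg_ex i.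
have [|k kE] := factor_epi (t := h) g_epi.
  move=> y /ker_g[z <-]; have [x <-] := g'_epi z.
  by rewrite -dE -[LHS]/(hom_pre (cdiff C i) h x) hd0.
have [_ /(_ X WX k)[h' h'E]] := fg_cond (i + 1 + 1).
by exists h'; apply: hom_ext => x; rewrite /= dE h'E kE.
Qed.

Lemma Gorenstein_injectiveP (W : lmodType S -> Prop) V :
  Gorenstein_injective W V <->
  exists2 Z : int -> lmodType S, forall i, inj_step W (Z i) (Z (i + 1)) &
    isomorphic V (Z 0).
Proof.
split=> [[C [C_inj exC CW] V_iso]|[Z stepZ V_iso]].
  exists (fun i => kernel (cdiff C i)) => [i|//].
  have [g [gE kg_ex]] := complex_slice exC i.
  exists (C i), (ker_incl (cdiff C i)), g; split=> // X /CW CX.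
  exact: hom_from_exact_lifts.
have [|C [f [g [exC dE fg_ex fg_cond]]]] := @splice
    (fun A I B f g => injective_module I /\ forall X, W X -> lifts g X) Z.
  by move=> i; have [P [f [g [? ? ?]]]] := stepZ i; exists P, f, g.
exists C; last first.
  apply: isomorphic_trans V_iso _.
  have [k_mono [dk0 ker_d]] := ker_incl_left_ex (cdiff C 0).
  have [f_mono [gf0 ker_g] _] := fg_ex 0; have [f'_mono _ _] := fg_ex (0 + 1).
  apply: (mono_unique f_mono k_mono) => y; split=> [[v <-]|[v <-]].
    by apply: ker_d; rewrite dE gf0 linear0.
  by apply: ker_g; apply: f'_mono; rewrite -dE dk0.
split=> // [i|X WX i]; first by have [] := fg_cond i.
move=> h; split=> [hd0|[h' <-]]; last first.
  apply: hom_ext => x; have [dd0 _] := iffLR (im_is_kerP _ _) (exC i).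
  by rewrite /= dd0.
have [f_mono [gf0 ker_g] g_epi] := fg_ex (i + 1).
have [f'_mono _ _] := fg_ex (i + 1 + 1).
have [|k kE] := factor_mono (t := h) f_mono.
  move=> x; apply: ker_g; apply: f'_mono; rewrite -dE.
  by rewrite -[LHS]/(hom_post (cdiff C (i + 1)) h x) hd0.
have [_ /(_ X WX k)[h' h'E]] := fg_cond i.
by exists h'; apply: hom_ext => x; rewrite /= dE h'E kE.
Qed.

Lemma proj_chain_Gorenstein (W : lmodType S -> Prop) (Z : int -> lmodType S) :
  (forall i, proj_step W (Z i) (Z (i + 1))) ->
  forall i V, isomorphic V (Z i) -> Gorenstein_projective W V.
Proof.
move=> stepZ i V V_iso; apply/Gorenstein_projectiveP.
by exists (fun j => Z (i + j)) => [j|]; rewrite ?addrA ?addr0.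
Qed.

Lemma inj_chain_Gorenstein (W : lmodType S -> Prop) (Z : int -> lmodType S) :
  (forall i, inj_step W (Z i) (Z (i + 1))) ->
  forall i V, isomorphic V (Z i) -> Gorenstein_injective W V.
Proof.
move=> stepZ i V V_iso; apply/Gorenstein_injectiveP.
by exists (fun j => Z (i + j)) => [j|]; rewrite ?addrA ?addr0.
Qed.

Lemma short_exact_iso A P B A' B' (f : {linear A -> P}) (g : {linear P -> B})
    (u : {linear A' -> A}) (v : {linear B -> B'}) :
  bijective u -> bijective v -> short_exact f g ->
  short_exact (lcomp f u) (lcomp v g).
Proof.
move=> u_bij v_bij [f_mono [gf0 ker_g] g_epi].
have /mono_injective u_mono := bij_inj u_bij.
have /mono_injective v_mono := bij_inj v_bij.
have [u' uK uK'] := u_bij; have [v' vK vK'] := v_bij.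
split=> [x /f_mono /u_mono //||b]; last first.
  by have [x xb] := g_epi (v' b); exists x; rewrite /= xb vK'.
split=> [x|y /v_mono /ker_g[x <-]]; first by rewrite /= gf0 linear0.
by exists (u' x); rewrite /= uK'.
Qed.

Lemma proj_step_iso (W : lmodType S -> Prop) A B A' B' :
  isomorphic A' A -> isomorphic B B' ->
  proj_step W A B -> proj_step W A' B'.
Proof.
move=> [u u_bij] [v v_bij] [P [f [g [P_proj fg fW]]]].
exists P, (lcomp f u), (lcomp v g); split=> // [|X WX h].
  exact: short_exact_iso.
have [u' [uK _]] := isomorphic_inv u_bij.
have [h' h'E] := fW X WX (lcomp h u').
by exists h' => x; rewrite /= h'E /= uK.
Qed.

Lemma inj_step_iso (W : lmodType S -> Prop) A B A' B' :
  isomorphic A' A -> isomorphic B B' ->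
  inj_step W A B -> inj_step W A' B'.
Proof.
move=> [u u_bij] [v v_bij] [P [f [g [P_inj fg gW]]]].
exists P, (lcomp f u), (lcomp v g); split=> // [|X WX h].
  exact: short_exact_iso.
have [v' [_ v'K]] := isomorphic_inv v_bij.
have [h' h'E] := gW X WX (lcomp v' h).
by exists h' => x; rewrite /= h'E /= v'K.
Qed.

Lemma Gorenstein_projective_steps (W : lmodType S -> Prop) V :
  Gorenstein_projective W V ->
  (exists2 V', Gorenstein_projective W V' & proj_step W V V') /\
  (exists2 V', Gorenstein_projective W V' & proj_step W V' V).
Proof.
move=> /Gorenstein_projectiveP[Z stepZ V_iso]; split.
  exists (Z (0 + 1)); first exact: (proj_chain_Gorenstein stepZ) (isomorphic_refl _).
  exact: proj_step_iso V_iso (isomorphic_refl _) (stepZ 0).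
exists (Z (-1)); first exact: (proj_chain_Gorenstein stepZ) (isomorphic_refl _).
exact: proj_step_iso (isomorphic_refl _) (isomorphic_sym V_iso) (stepZ (-1)).
Qed.

Lemma Gorenstein_injective_steps (W : lmodType S -> Prop) V :
  Gorenstein_injective W V ->
  (exists2 V', Gorenstein_injective W V' & inj_step W V V') /\
  (exists2 V', Gorenstein_injective W V' & inj_step W V' V).
Proof.
move=> /Gorenstein_injectiveP[Z stepZ V_iso]; split.
  exists (Z (0 + 1)); first exact: (inj_chain_Gorenstein stepZ) (isomorphic_refl _).
  exact: inj_step_iso V_iso (isomorphic_refl _) (stepZ 0).
exists (Z (-1)); first exact: (inj_chain_Gorenstein stepZ) (isomorphic_refl _).
exact: inj_step_iso (isomorphic_refl _) (isomorphic_sym V_iso) (stepZ (-1)).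
Qed.

(** Choosing steps again and again, in both directions, yields a complete
    resolution. *)
Lemma Gorenstein_projective_coind (W K : lmodType S -> Prop) :
  (forall V, K V -> exists2 V', K V' & proj_step W V V') ->
  (forall V, K V -> exists2 V', K V' & proj_step W V' V) ->
  forall V, K V -> Gorenstein_projective W V.
Proof.
move=> right left V /(biinfinite_chain right left)[Z Z0 stepZ].
by apply/Gorenstein_projectiveP; exists Z; rewrite // Z0; apply: isomorphic_refl.
Qed.

Lemma Gorenstein_injective_coind (W K : lmodType S -> Prop) :
  (forall V, K V -> exists2 V', K V' & inj_step W V V') ->
  (forall V, K V -> exists2 V', K V' & inj_step W V' V) ->
  forall V, K V -> Gorenstein_injective W V.
Proof.
move=> right left V /(biinfinite_chain right left)[Z Z0 stepZ].
by apply/Gorenstein_injectiveP; exists Z; rewrite // Z0; apply: isomorphic_refl.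
Qed.

End Chains.

(** * The functors M (x) - and Hom(M, -) *)

Section TensorAndHomFunctors.
Variables (R : nzRingType) (M : bimodule R R).

Section TensorMaps.
Variables (V W : lmodType R) (f : {linear V -> W}).
Lemma tensor_map_tens m v : tensor_map M f (tens m v) = tens m (f v).
Proof. exact: (tensor_lift_tens (tensor_map_bal M f)). Qed.
Lemma tensor_map0 : tensor_map M f 0 = 0.
Proof. exact: linear0. Qed.
Lemma tensor_mapD x y :
  tensor_map M f (x + y) = tensor_map M f x + tensor_map M f y.
Proof. exact: linearD. Qed.
End TensorMaps.

Fact tensor_functor_id (V : lmodType R) x : tensor_map M (lid V) x = x.
Proof.
elim/tensor_ind: x => [|m v|x y IHx IHy]; first exact: tensor_map0.
  exact: tensor_map_tens.
by rewrite tensor_mapD IHx IHy.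
Qed.
Fact tensor_functor_comp (U V W : lmodType R) (g : {linear V -> W})
  (f : {linear U -> V}) x :
  tensor_map M (lcomp g f) x = tensor_map M g (tensor_map M f x).
Proof.
elim/tensor_ind: x => [|m v|x y IHx IHy]; first by rewrite !tensor_map0.
  by rewrite !tensor_map_tens.
by rewrite !tensor_mapD IHx IHy.
Qed.
Fact tensor_functor_add (V W : lmodType R) (f g : {linear V -> W}) x :
  tensor_map M (ladd f g) x = tensor_map M f x + tensor_map M g x.
Proof.
elim/tensor_ind: x => [|m v|x y IHx IHy]; first by rewrite !tensor_map0 addr0.
  by rewrite !tensor_map_tens tensDr.
by rewrite !tensor_mapD IHx IHy addrACA.
Qed.
Definition tensor_functor : functor R :=
  @Functor R (fun V => tensor M V) (fun V W f => tensor_map M f)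
    tensor_functor_id tensor_functor_comp tensor_functor_add.

(** The inverse W -> V of g, defined up to the image of f, induces a map from
    M (x) W to the cokernel of M (x) f. *)
Lemma tensor_right_exact : right_exact tensor_functor.
Proof.
move=> U V W f g [[gf0 ker_g] g_epi]; split; first split.
- exact: (@fmap_null _ tensor_functor _ _ _ g f).
- have [[cf0 ker_c] c_epi] := coker_map_right_ex (tensor_map M f).
  set c := coker_map _ in cf0 ker_c c_epi.
  pose s w := projT1 (cid (g_epi w)).
  have sK w : g (s w) = w by rewrite /s; case: cid.
  have cE m v v' : g v = g v' -> c (tens m v) = c (tens m v').
    move=> gv; have [|u uE] := ker_g (v - v'); first by rewrite linearB gv subrr.
    rewrite -(subrK v' v) -uE tensDr linearD -(tensor_map_tens f).
    by rewrite [c _]cf0 add0r.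
  pose phi m w := c (tens m (s w)).
  have phi_bal : balanced phi.
    split=> [m m' w|m w w'|m r w]; rewrite /phi.
    + by rewrite tensDl linearD.
    + by rewrite -linearD -tensDr; apply: cE; rewrite linearD !sK.
    + by rewrite tens_bal; apply: cE; rewrite linearZ /= !sK.
  have phiE x : tensor_lift phi (tensor_map M g x) = c x.
    elim/tensor_ind: x => [|m v|x y IHx IHy].
    + by rewrite tensor_map0 (tensor_lift0 phi_bal) linear0.
    + by rewrite tensor_map_tens (tensor_lift_tens phi_bal); apply: cE; rewrite sK.
    + by rewrite tensor_mapD (tensor_liftD phi_bal) IHx IHy linearD.
  move=> x gx0; apply: ker_c; rewrite -phiE.
  by rewrite [tensor_map M g x]gx0 (tensor_lift0 phi_bal).
- move=> /=; elim/tensor_ind => [|m w|x y [x' <-] [y' <-]].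
  + by exists 0; apply: tensor_map0.
  + by have [v <-] := g_epi w; exists (tens m v); apply: tensor_map_tens.
  + by exists (x' + y'); apply: tensor_mapD.
Qed.

Section HomMap.
Variables (V W : lmodType (op R)) (f : {linear V -> W}).
Fact hom_map_linear : linear (fun g : rhom M V => hom_post f g : rhom M W).
Proof. by move=> a g h; apply: hom_ext => m /=; rewrite linearD. Qed.
Definition hom_map : {linear rhom M V -> rhom M W} := mk_linear hom_map_linear.
End HomMap.

Fact hom_functor_id (V : lmodType (op R)) x : hom_map (lid V) x = x.
Proof. exact: hom_ext. Qed.
Fact hom_functor_comp (U V W : lmodType (op R)) (g : {linear V -> W})
  (f : {linear U -> V}) x : hom_map (lcomp g f) x = hom_map g (hom_map f x).
Proof. exact: hom_ext. Qed.
Fact hom_functor_add (V W : lmodType (op R)) (f g : {linear V -> W}) x :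
  hom_map (ladd f g) x = hom_map f x + hom_map g x.
Proof. exact: hom_ext. Qed.
Definition hom_functor : functor (op R) :=
  @Functor (op R) (fun V => rhom M V) hom_map
    hom_functor_id hom_functor_comp hom_functor_add.

Lemma hom_left_exact : left_exact hom_functor.
Proof.
move=> U V W f g [f_mono [gf0 ker_g]]; split; last split.
- move=> h fh0; apply: hom_ext => m; apply: f_mono.
  by rewrite -[LHS]/(fmap hom_functor f h m) fh0.
- exact: (@fmap_null _ hom_functor _ _ _ g f).
- move=> h gh0; have [|k kE] := factor_mono (t := h) f_mono.
    by move=> m; apply: ker_g; rewrite -[LHS]/(fmap hom_functor g h m) gh0.
  by exists k; apply: hom_ext.
Qed.

End TensorAndHomFunctors.

(** * Powers of the bimodule *)

Section Powers.
Variables (R : nzRingType).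

Section TensorAssoc.
Variables (B C : bimodule R R) (A : lmodType R).
Notation BC := (tensor_bimod B C).

Definition assoc_slice (a : A) (t : BC) : tensor B (tensor C A) :=
  tensor_lift (fun b c => tens b (tens c a)) t.
Lemma assoc_slice_bal a :
  balanced (fun (b : B) (c : C) => tens b (tens c a : tensor C A)).
Proof. by split=> *; rewrite ?tensDl ?tensDr // tens_bal scale_tens. Qed.
Lemma assoc_slice_tens a b c : assoc_slice a (tens b c) = tens b (tens c a).
Proof. exact: (tensor_lift_tens (assoc_slice_bal a)). Qed.
Lemma assoc_sliceD a t u :
  assoc_slice a (t + u) = assoc_slice a t + assoc_slice a u.
Proof. exact: (tensor_liftD (assoc_slice_bal a)). Qed.
Lemma assoc_slice0 a : assoc_slice a 0 = 0.
Proof. exact: (tensor_lift0 (assoc_slice_bal a)). Qed.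

Lemma assoc_bal : balanced (fun (t : BC) (a : A) => assoc_slice a t).
Proof.
split=> [t t' a|t a a'|t r a]; first exact: assoc_sliceD.
  elim/tensor_ind: t => [|b c|t u IHt IHu]; first by rewrite !assoc_slice0 addr0.
    by rewrite !assoc_slice_tens !tensDr.
  by rewrite !assoc_sliceD IHt IHu addrACA.
elim/tensor_ind: t => [|b c|t u IHt IHu].
- by rewrite [ract _ _]tensor_ract0 !assoc_slice0.
- by rewrite [ract _ _]tensor_ract_tens !assoc_slice_tens tens_bal.
- by rewrite [ract _ _]tensor_ractDl !assoc_sliceD -IHt -IHu.
Qed.

Definition assoc_fun (x : tensor BC A) : tensor B (tensor C A) :=
  tensor_lift (fun t a => assoc_slice a t) x.
Lemma assoc_tens t a : assoc_fun (tens t a) = assoc_slice a t.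
Proof. exact: (tensor_lift_tens assoc_bal). Qed.
Lemma assocD x y : assoc_fun (x + y) = assoc_fun x + assoc_fun y.
Proof. exact: (tensor_liftD assoc_bal). Qed.
Lemma assoc0 : assoc_fun 0 = 0.
Proof. exact: (tensor_lift0 assoc_bal). Qed.

Lemma assoc_linear : linear assoc_fun.
Proof.
move=> r x y; rewrite assocD; congr (_ + _).
elim/tensor_ind: x => [|t a|x x' IHx IHx']; first by rewrite scaler0 assoc0 scaler0.
  rewrite scale_tens !assoc_tens.
  elim/tensor_ind: t => [|b c|t u IHt IHu].
  - by rewrite scaler0 assoc_slice0 scaler0.
  - by rewrite scale_tens !assoc_slice_tens scale_tens.
  - by rewrite scalerDr !assoc_sliceD scalerDr IHt IHu.
by rewrite scalerDr !assocD scalerDr IHx IHx'.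
Qed.

Definition assoc_inv_slice (b : B) (x : tensor C A) : tensor BC A :=
  tensor_lift (fun c a => tens (tens b c : BC) a) x.
Lemma assoc_inv_slice_bal b :
  balanced (fun (c : C) (a : A) => tens (tens b c : BC) a).
Proof.
split=> [c c' a|c a a'|c r a]; rewrite ?tensDr ?tensDl //.
by rewrite -tens_bal; congr (tens _ a); apply/esym/tensor_ract_tens.
Qed.
Lemma assoc_inv_slice_tens b c a :
  assoc_inv_slice b (tens c a) = tens (tens b c : BC) a.
Proof. exact: (tensor_lift_tens (assoc_inv_slice_bal b)). Qed.
Lemma assoc_inv_sliceD b x y :
  assoc_inv_slice b (x + y) = assoc_inv_slice b x + assoc_inv_slice b y.
Proof. exact: (tensor_liftD (assoc_inv_slice_bal b)). Qed.
Lemma assoc_inv_slice0 b : assoc_inv_slice b 0 = 0.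
Proof. exact: (tensor_lift0 (assoc_inv_slice_bal b)). Qed.

Lemma assoc_inv_bal : balanced assoc_inv_slice.
Proof.
split=> [b b' x|b x x'|b r x]; last 2 first.
- exact: assoc_inv_sliceD.
- elim/tensor_ind: x => [|c a|x y IHx IHy]; first by rewrite scaler0 !assoc_inv_slice0.
    by rewrite scale_tens !assoc_inv_slice_tens tens_bal.
  by rewrite scalerDr !assoc_inv_sliceD IHx IHy.
elim/tensor_ind: x => [|c a|x y IHx IHy]; first by rewrite !assoc_inv_slice0 addr0.
  by rewrite !assoc_inv_slice_tens -tensDl tensDl.
by rewrite !assoc_inv_sliceD IHx IHy addrACA.
Qed.

Lemma tensor_assoc : isomorphic (tensor BC A) (tensor B (tensor C A)).
Proof.
exists (mk_linear assoc_linear).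
have invD := tensor_liftD assoc_inv_bal; have inv0 := tensor_lift0 assoc_inv_bal.
have inv_tens := tensor_lift_tens assoc_inv_bal.
exists (tensor_lift assoc_inv_slice) => x /=.
  elim/tensor_ind: x => [|t a|x y IHx IHy]; first by rewrite assoc0.
    rewrite assoc_tens; elim/tensor_ind: t => [|b c|t u IHt IHu].
    - by rewrite assoc_slice0 inv0 tens0l.
    - by rewrite assoc_slice_tens inv_tens assoc_inv_slice_tens.
    - by rewrite assoc_sliceD invD IHt IHu tensDl.
  by rewrite assocD invD IHx IHy.
elim/tensor_ind: x => [|b x|x y IHx IHy]; first by rewrite inv0 assoc0.
  rewrite inv_tens; elim/tensor_ind: x => [|c a|x y IHx IHy].
  - by rewrite assoc_inv_slice0 assoc0 tens0r.
  - by rewrite assoc_inv_slice_tens assoc_tens assoc_slice_tens.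
  - by rewrite assoc_inv_sliceD assocD IHx IHy tensDr.
by rewrite invD assocD IHx IHy.
Qed.

End TensorAssoc.

Lemma tensor_regular (A : lmodType R) : isomorphic (tensor (regular_bimod R) A) A.
Proof.
have bal : balanced (fun (r : regular_bimod R) (a : A) => (r : R) *: a).
  split=> [r s a|r a b|s r a]; [exact: scalerDl|exact: scalerDr|].
  by rewrite scalerA.
have lin : linear (tensor_lift (fun (r : regular_bimod R) (a : A) => (r : R) *: a)).
  move=> c x y; rewrite (tensor_liftD bal); congr (_ + _).
  elim/tensor_ind: x => [|r a|x x' IHx IHx'].
  - by rewrite scaler0 (tensor_lift0 bal) scaler0.
  - by rewrite scale_tens !(tensor_lift_tens bal) scalerA.
  - by rewrite scalerDr !(tensor_liftD bal) IHx IHx' scalerDr.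
exists (mk_linear lin).
exists (fun a => tens (1 : regular_bimod R) a) => [x|a] /=; last first.
  by rewrite (tensor_lift_tens bal) scale1r.
elim/tensor_ind: x => [|r a|x y IHx IHy].
- by rewrite (tensor_lift0 bal) tens0r.
- rewrite (tensor_lift_tens bal) -tens_bal; congr tens; exact: mul1r.
- by rewrite (tensor_liftD bal) tensDr IHx IHy.
Qed.

Section HomAdjunction.
Variables (B C : bimodule R R) (Y : lmodType (op R)).
Notation BC := (tensor_bimod B C).

Section Curry.
Variable h : rhom BC Y.
Fact curry_fun_linear (b : rmod B) :
  linear (fun c : rmod C => h (tens (b : B) (c : C) : rmod BC)).
Proof.
move=> r c c'; rewrite tensDr linearD; congr (_ + _).
rewrite -linearZ; congr (h _); exact/esym/tensor_ract_tens.
Qed.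
Definition curry_fun (b : rmod B) : rhom C Y := mk_linear (curry_fun_linear b).
Fact curry_linear : linear curry_fun.
Proof.
move=> r b b'; apply: hom_ext => c /=; rewrite tensDl linearD; congr (_ + _).
by congr (h _); apply: tens_bal.
Qed.
Definition curry : rhom B (rhom C Y) := mk_linear curry_linear.
End Curry.

Fact curry_map_linear : linear curry.
Proof.
move=> r h h'; apply: hom_ext => b; apply: hom_ext => c /=.
by rewrite /rhom_scale /= /bimod_lmul scale_tens.
Qed.

Lemma rhom_tensor : isomorphic (rhom BC Y) (rhom B (rhom C Y)).
Proof.
apply: (@mono_epi_isomorphic _ _ _ (mk_linear curry_map_linear)) => [h h0|k].
  apply: hom_ext => x; rewrite [RHS]/=.
  elim/tensor_ind: (x : tensor B C) => [|b c|t u IHt IHu]; first exact: linear0.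
    by rewrite -[LHS]/(curry h b c) [curry h]h0.
  by rewrite [LHS]linearD IHt IHu addr0.
have bal : balanced (fun (b : B) (c : C) => (k (b : rmod B) : rhom C Y) (c : rmod C)).
  split=> [b b' c|b c c'|b r c]; first by rewrite linearD.
    by rewrite linearD.
  by rewrite [ract b r]/((r : op R) *: (b : rmod B)) linearZ.
have lin : linear (tensor_lift (fun (b : B) (c : C) =>
    (k (b : rmod B) : rhom C Y) (c : rmod C)) : rmod BC -> Y).
  move=> r x y; rewrite [LHS](tensor_liftD bal); congr (_ + _).
  elim/tensor_ind: (x : tensor B C) => [|b c|t u IHt IHu].
  - by rewrite [_ *: _]tensor_ract0 (tensor_lift0 bal) scaler0.
  - rewrite [_ *: _]tensor_ract_tens !(tensor_lift_tens bal).
    by rewrite [ract c r]/((r : op R) *: (c : rmod C)) linearZ.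
  - by rewrite [_ *: _]tensor_ractDl !(tensor_liftD bal) scalerDr -IHt -IHu.
exists (mk_linear lin); apply: hom_ext => b; apply: hom_ext => c /=.
exact: (tensor_lift_tens bal).
Qed.
End HomAdjunction.

Lemma rhom_regular (Y : lmodType (op R)) : isomorphic (rhom (regular_bimod R) Y) Y.
Proof.
pose one : rmod (regular_bimod R) := (1 : R).
have lin : linear (fun h : rhom (regular_bimod R) Y => h one).
  move=> r h h' /=; congr (_ + _); rewrite -linearZ; congr (h _).
  by rewrite /bimod_lmul [LHS]mulr1 [RHS]mul1r.
apply: (@mono_epi_isomorphic _ _ _ (mk_linear lin)) => [h /= h0|y].
  apply: hom_ext => r; have -> : r = (r : op R) *: one by rewrite [RHS]mul1r.
  by rewrite linearZ /= h0 scaler0.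
have lin' : linear (fun r : rmod (regular_bimod R) => (r : op R) *: y).
  move=> a r s; rewrite [LHS](@scalerDl _ Y y); congr (_ + _).
  by rewrite scalerA.
by exists (mk_linear lin') => /=; rewrite scale1r.
Qed.

Variable M : bimodule R R.

Lemma tensor_pow_succ i (A : lmodType R) :
  isomorphic (tensor_functor M (tensor (tensor_pow M i) A))
             (tensor (tensor_pow M i.+1) A).
Proof. exact/isomorphic_sym/tensor_assoc. Qed.

Lemma rhom_pow_succ i (Y : lmodType (op R)) :
  isomorphic (hom_functor M (rhom (tensor_pow M i) Y)) (rhom (tensor_pow M i.+1) Y).
Proof. exact/isomorphic_sym/rhom_tensor. Qed.

(** tensor_pow adds a new factor on the outside and fun_pow on the inside; the
    factors accumulated in V reconcile the two. *)
Lemma fun_pow_tensor k i (A : lmodType R) V :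
  isomorphic V (tensor (tensor_pow M i) A) ->
  isomorphic (fun_pow (tensor_functor M) k V) (tensor (tensor_pow M (k + i)) A).
Proof.
elim: k i V => [|k IHk] i V // V_iso; rewrite addSnnS.
apply: (IHk i.+1 (tensor_functor M V)).
exact: isomorphic_trans (fmap_iso (tensor_functor M) V_iso) (tensor_pow_succ i A).
Qed.

Lemma fun_pow_rhom k i (Y : lmodType (op R)) V :
  isomorphic V (rhom (tensor_pow M i) Y) ->
  isomorphic (fun_pow (hom_functor M) k V) (rhom (tensor_pow M (k + i)) Y).
Proof.
elim: k i V => [|k IHk] i V // V_iso; rewrite addSnnS.
apply: (IHk i.+1 (hom_functor M V)).
exact: isomorphic_trans (fmap_iso (hom_functor M) V_iso) (rhom_pow_succ i Y).
Qed.

Lemma isomorphic_zero (S : nzRingType) (V W : lmodType S) :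
  isomorphic V W -> (forall w : W, w = 0) -> forall v : V, v = 0.
Proof.
by move=> /isomorphicP[f [g [fK _]]] W0 v; rewrite -(fK v) (W0 (f v)) linear0.
Qed.

Lemma tensor_functor_nilpotent N :
  nilpotent_bimod M N -> nilpotent_functor (tensor_functor M) N.+1.
Proof.
move=> M_nil A; have A_iso := isomorphic_sym (tensor_regular A).
apply: isomorphic_zero (fun_pow_tensor N.+1 (i := 0) A_iso) _.
rewrite addn0; elim/tensor_ind => // [t a|t u -> ->]; last exact: addr0.
by rewrite (M_nil t) tens0l.
Qed.

Lemma hom_functor_nilpotent N :
  nilpotent_bimod M N -> nilpotent_functor (hom_functor M) N.+1.
Proof.
move=> M_nil Y; have Y_iso := isomorphic_sym (rhom_regular Y).
apply: isomorphic_zero (fun_pow_rhom N.+1 (i := 0) Y_iso) _.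
rewrite addn0 => h; apply: hom_ext => t.
by rewrite (M_nil t : t = 0) linear0.
Qed.

End Powers.

(** * Modules over the tensor ring *)

Section TensorRingInduction.
Variables (R : nzRingType) (M : bimodule R R) (N : nat).
Notation T := (tensor_ring M N).
Notation inR := (tring_of_ring M N).
Notation inM := (tring_of_bimod N).

Lemma tring_of_bimod_mul (m : M) (t : T) : inM m * t = tring_shift m t.
Proof.
rewrite [LHS]tring_mul_shift; congr tring_shift; exact: tring_mul1l.
Qed.

Lemma tring_sum_lmul (t : T) : t = \sum_(i < N.+1) tring_lmul (t i) (1 : T).
Proof. by rewrite -[LHS]mulr1. Qed.

(** T is generated by R and M; the second case peels off a factor on the left. *)
Lemma tring_ind (P : T -> Prop) :
  (forall r, P (inR r)) -> (forall m t, P t -> P (inM m * t)) ->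
  (forall s t, P s -> P t -> P (s + t)) -> forall t, P t.
Proof.
move=> PR PM PD t; have P0 : P 0 by rewrite -(rmorph0 inR); apply: PR.
have Plmul i (x : tensor_pow M i) : P (tring_lmul x (1 : T)).
  elim: i x => [|i IHi] x.
    have -> : tring_lmul x (1 : T) = inR x; last exact: PR.
    by rewrite -[RHS]mulr1; apply/esym/tring_mul_ring.
  elim/tensor_ind: x => [|m x|x y IHx IHy]; first by rewrite tring_lmul0l.
    by rewrite tring_lmul_tens -tring_of_bimod_mul; apply: PM.
  by rewrite tring_lmulDl; apply: PD.
rewrite (tring_sum_lmul t); elim/big_ind: _ => //.
Qed.

(** T is the direct sum of R and M (x) T, so an R-balanced f : M x T -> A
    extends to an additive map T -> A that vanishes on R; this is where the
    nilpotency of M enters. *)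
Section Case.
Variables (A : zmodType) (f : M -> T -> A).
Hypothesis fDl : forall m m' t, f (m + m') t = f m t + f m' t.
Hypothesis fDr : forall m t t', f m (t + t') = f m t + f m t'.
Hypothesis f_bal : forall m r t, f (ract m r) t = f m (inR r * t).

Definition tring_case_deg i : tensor_pow M i -> A :=
  match i with
  | 0 => fun=> 0
  | i'.+1 => fun x => tensor_lift (fun m x' => f m (tring_lmul x' (1 : T))) x
  end.
Definition tring_case (t : T) : A := \sum_(i < N.+1) tring_case_deg (t i).

Lemma tring_case_deg_bal i :
  balanced (fun (m : M) (x : tensor_pow M i) => f m (tring_lmul x (1 : T))).
Proof.
split=> [m m' x|m x x'|m r x]; first exact: fDl.
  by rewrite tring_lmulDl fDr.
by rewrite f_bal tring_lmulZ [inR r * _]tring_mul_ring.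
Qed.
Lemma tring_case_degD i (x y : tensor_pow M i) :
  tring_case_deg (x + y) = tring_case_deg x + tring_case_deg y.
Proof.
case: i x y => [|i] x y; first by rewrite addr0.
exact: (tensor_liftD (@tring_case_deg_bal i)).
Qed.
Lemma tring_case_deg0 i : tring_case_deg (0 : tensor_pow M i) = 0.
Proof. case: i => [|i] //; exact: (tensor_lift0 (@tring_case_deg_bal i)). Qed.

Lemma tring_caseD s t : tring_case (s + t) = tring_case s + tring_case t.
Proof.
by rewrite /tring_case -big_split; apply: eq_bigr => i _; apply: tring_case_degD.
Qed.
Lemma tring_case_ring r : tring_case (inR r) = 0.
Proof.
rewrite /tring_case big1 // => -[[|i] lt_i] _ //=.
exact: (tring_case_deg0 i.+1).
Qed.

Lemma tring_case_bimod (M_nilpotent : nilpotent_bimod M N) m t :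
  tring_case (inM m * t) = f m t.
Proof.
have f0 : f m 0 = 0 by apply: (addrI (f m 0)); rewrite -fDr !addr0.
rewrite tring_of_bimod_mul [in RHS](tring_sum_lmul t).
rewrite (big_morph (f m) (fDr m) f0) /tring_case big_ord_recl big_ord_recr /=.
rewrite add0r.
(* The top degree of t is lost in m t, but f m kills it since M^(N+1) = 0. *)
have -> : f m (tring_lmul (t ord_max) (1 : T)) = 0.
  rewrite -[RHS](tring_case_deg0 N.+1) -(M_nilpotent (tens m (t ord_max))).
  exact/esym/(tensor_lift_tens (@tring_case_deg_bal N)).
rewrite addr0; apply: eq_bigr => i _.
rewrite [LHS](tensor_lift_tens (@tring_case_deg_bal i)).
have E (p q : (i < N.+1)%N) : f m (tring_lmul (t (Ordinal p)) (1 : T)) =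
    f m (tring_lmul (t (Ordinal q)) (1 : T)) by rewrite (bool_irrelevance p q).
exact: E.
Qed.
End Case.

Definition tring_aug (t : T) : R := t ord0.
Fact tring_aug_additive : zmod_morphism tring_aug.
Proof. by []. Qed.
Fact tring_aug_multiplicative : monoid_morphism tring_aug.
Proof.
split=> // s t; rewrite /tring_aug [s * t]/(tring_mul s t) /tring_mul tring_sumE.
rewrite big_ord_recl big1 ?addr0 // => i _.
by rewrite tring_lmul_deg.
Qed.
HB.instance Definition _ := GRing.isZmodMorphism.Build T R tring_aug
  tring_aug_additive.
HB.instance Definition _ := GRing.isMonoidMorphism.Build T R tring_aug
  tring_aug_multiplicative.

Lemma tring_augM (s t : T) : tring_aug (s * t) = tring_aug s * tring_aug t.
Proof. exact: rmorphM. Qed.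
Lemma tring_augD (s t : T) : tring_aug (s + t) = tring_aug s + tring_aug t.
Proof. by []. Qed.
Lemma tring_aug_bimod m t : tring_aug (inM m * t) = 0.
Proof. by rewrite rmorphM /= mul0r. Qed.

End TensorRingInduction.

Section LeftModules.
Variables (R : nzRingType) (M : bimodule R R) (N : nat).
Notation T := (tensor_ring M N).
Notation inR := (tring_of_ring M N).
Notation inM := (tring_of_bimod N).
Notation F := (tensor_functor M).
Implicit Types (V W : lmodType T) (A : lmodType R).

Definition struct V : {linear F (forget V) -> forget V} := struct_map (V := V).

Lemma struct_tens V (m : M) (v : forget V) : struct V (tens m v) = inM m *: (v : V).
Proof. exact: (tensor_lift_tens (struct_map_bal V)). Qed.

Lemma struct_nat V W (f : {linear V -> W}) x :
  forget_map f (struct V x) = struct W (fmap F (forget_map f) x).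
Proof.
elim/tensor_ind: x => [|m v|x y IHx IHy]; first by rewrite !linear0.
  by rewrite struct_tens [fmap _ _ _]tensor_map_tens struct_tens; apply: linearZ.
by rewrite !linearD IHx IHy.
Qed.

Lemma tring_linear V W (f : {linear forget V -> forget W}) :
  (forall x, f (struct V x) = struct W (fmap F f x)) ->
  exists g : {linear V -> W}, forall v, g v = f v.
Proof.
move=> f_struct; have g_lin : linear (f : V -> W).
  move=> t u v; rewrite [LHS](linearD f); congr (_ + _).
  elim/tring_ind: t u => [r|m t IHt|s t IHs IHt] u.
  - exact: (linearZ_LR f r u).
  - rewrite -!scalerA -IHt -(@struct_tens V m) -(@struct_tens W m).
    by rewrite f_struct [fmap _ _ _]tensor_map_tens.
  - by rewrite !scalerDl -IHs -IHt; apply: (linearD f).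
by exists (mk_linear g_lin).
Qed.

(** The R-module A, on which M acts by zero. *)
Definition stalk A : lmodType T := restrict_scalars (tring_aug (M := M) (N := N)) A.

Fact stalk_val_linear A : linear (fun a : forget (stalk A) => a : A).
Proof. by move=> r a b; apply: (linearP (lid A)). Qed.
Definition stalk_val A : {linear forget (stalk A) -> A} :=
  mk_linear (@stalk_val_linear A).

Lemma stalk_val_struct A x : stalk_val A (struct (stalk A) x) = 0.
Proof.
elim/tensor_ind: x => [|m v|x y IHx IHy]; first by rewrite !linear0.
  by rewrite struct_tens [LHS](@scale0r R A).
by rewrite !linearD IHx IHy addr0.
Qed.

Section Induced.
Variable A : lmodType R.
Notation IndA := (forget (Ind M N A)).
Notation tensT t a := (@tens T R (tring_bimod M N) A t a).

Fact ind_unit_linear : linear (fun a : A => tensT 1 a : IndA).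
Proof.
move=> r a b; rewrite tensDr; congr (_ + _).
rewrite -tens_bal [RHS](@scale_tens T R (tring_bimod M N)); congr (tensT _ a).
by rewrite [LHS]mul1r [RHS]mulr1.
Qed.
Definition ind_unit : {linear A -> IndA} := mk_linear ind_unit_linear.

Lemma ind_top_bal :
  balanced (fun (t : tring_bimod M N) (a : A) => tring_aug (t : T) *: a).
Proof.
split=> [t u a|t a b|t r a]; [exact: scalerDl|exact: scalerDr|].
by rewrite scalerA [tring_aug _]rmorphM.
Qed.
Definition ind_top_fun : IndA -> A :=
  tensor_lift (fun (t : tring_bimod M N) (a : A) => tring_aug (t : T) *: a).
Lemma ind_top_tens t a : ind_top_fun (tensT t a) = tring_aug (t : T) *: a.
Proof. exact: (tensor_lift_tens ind_top_bal). Qed.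
Fact ind_top_linear : linear ind_top_fun.
Proof.
move=> r x y; rewrite [LHS](tensor_liftD ind_top_bal); congr (_ + _).
elim/tensor_ind: (x : Ind M N A) => [|t a|u v IHu IHv].
- rewrite scaler0 [ind_top_fun _](tensor_lift0 ind_top_bal).
  by rewrite scaler0 (tensor_lift0 ind_top_bal).
- rewrite [_ *: _](@scale_tens T R (tring_bimod M N)) ind_top_tens.
  by rewrite [LHS]ind_top_tens scalerA [tring_aug _]rmorphM.
- rewrite scalerDr [LHS](tensor_liftD ind_top_bal).
  by rewrite [ind_top_fun _](tensor_liftD ind_top_bal) scalerDr IHu IHv.
Qed.
Definition ind_top : {linear IndA -> A} := mk_linear ind_top_linear.

Hypothesis M_nilpotent : nilpotent_bimod M N.

(** The inverse of the structure map on its image: it sends m t (x) a to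
    m (x) (t (x) a) and R (x) A to 0. *)
Definition ind_retr_tens (a : A) : T -> F IndA :=
  tring_case (fun m t => tens m (tensT t a : IndA)).
Section RetrTens.
Variable a : A.
Fact ind_retr_Dl (m m' : M) (t : T) : tens (m + m') (tensT t a : IndA) =
  tens m (tensT t a : IndA) + tens m' (tensT t a : IndA).
Proof. exact: tensDl. Qed.
Fact ind_retr_Dr (m : M) (t t' : T) : tens m (tensT (t + t') a : IndA) =
  tens m (tensT t a : IndA) + tens m (tensT t' a : IndA).
Proof. by rewrite -tensDr -tensDl. Qed.
Fact ind_retr_bal (m : M) r (t : T) :
  tens (ract m r) (tensT t a : IndA) = tens m (tensT (inR r * t) a : IndA).
Proof.
by rewrite tens_bal; congr tens; apply: (@scale_tens T R (tring_bimod M N)).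
Qed.
Lemma ind_retr_tensD t u :
  ind_retr_tens a (t + u) = ind_retr_tens a t + ind_retr_tens a u.
Proof. exact: (tring_caseD ind_retr_Dl ind_retr_Dr ind_retr_bal). Qed.
Lemma ind_retr_ring r : ind_retr_tens a (inR r) = 0.
Proof. exact: (tring_case_ring ind_retr_Dl ind_retr_Dr ind_retr_bal). Qed.
Lemma ind_retr_bimod m t : ind_retr_tens a (inM m * t) = tens m (tensT t a : IndA).
Proof. exact: (tring_case_bimod ind_retr_Dl ind_retr_Dr ind_retr_bal). Qed.
End RetrTens.

Lemma ind_retr_tens_ract a (t : T) r :
  ind_retr_tens a (t * inR r) = ind_retr_tens (r *: a) t.
Proof.
elim/tring_ind: t => [s|m u _|u v IHu IHv].
- by rewrite -(rmorphM inR) !ind_retr_ring.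
- rewrite -mulrA !ind_retr_bimod; congr tens.
  exact: (@tens_bal T R (tring_bimod M N)).
- by rewrite mulrDl !ind_retr_tensD IHu IHv.
Qed.

Lemma ind_retr_tens_scale a r (t : T) :
  ind_retr_tens a (inR r * t) = r *: ind_retr_tens a t.
Proof.
elim/tring_ind: t => [s|m u _|u v IHu IHv].
- by rewrite -(rmorphM inR) !ind_retr_ring scaler0.
- by rewrite mulrA -tring_of_bimodZ !ind_retr_bimod -scale_tens.
- by rewrite mulrDr !ind_retr_tensD scalerDr IHu IHv.
Qed.

Lemma ind_retr_tens_bal :
  balanced (fun (t : tring_bimod M N) (a : A) => ind_retr_tens a (t : T)).
Proof.
split=> [t u a|t a b|t r a]; first exact: ind_retr_tensD.
  elim/tring_ind: (t : T) => [r|m u _|u v IHu IHv].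
  - by rewrite !ind_retr_ring addr0.
  - by rewrite !ind_retr_bimod -tensDr -tensDr.
  - by rewrite !ind_retr_tensD IHu IHv addrACA.
exact: ind_retr_tens_ract.
Qed.
Definition ind_retr_fun : IndA -> F IndA :=
  tensor_lift (fun (t : tring_bimod M N) (a : A) => ind_retr_tens a (t : T)).
Lemma ind_retr_funE t a : ind_retr_fun (tensT t a) = ind_retr_tens a t.
Proof. exact: (tensor_lift_tens ind_retr_tens_bal). Qed.
Lemma ind_retr_funD x y : ind_retr_fun (x + y) = ind_retr_fun x + ind_retr_fun y.
Proof. exact: (tensor_liftD ind_retr_tens_bal). Qed.
Lemma ind_retr_fun0 : ind_retr_fun 0 = 0.
Proof. exact: (tensor_lift0 ind_retr_tens_bal). Qed.

Fact ind_retr_linear : linear ind_retr_fun.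
Proof.
move=> r x y; rewrite ind_retr_funD; congr (_ + _).
elim/tensor_ind: (x : Ind M N A) => [|t a|u v IHu IHv].
- by rewrite scaler0 !ind_retr_fun0 scaler0.
- rewrite [_ *: _](@scale_tens T R (tring_bimod M N)) !ind_retr_funE.
  exact: ind_retr_tens_scale.
- by rewrite scalerDr !ind_retr_funD scalerDr IHu IHv.
Qed.
Definition ind_retr : {linear IndA -> F IndA} := mk_linear ind_retr_linear.

Lemma ind_top_unit a : ind_top (ind_unit a) = a.
Proof. by rewrite [LHS]ind_top_tens rmorph1 scale1r. Qed.

Lemma ind_top_struct x : ind_top (struct _ x) = 0.
Proof.
elim/tensor_ind: x => [|m v|x y IHx IHy]; first by rewrite !linear0.
  rewrite struct_tens; elim/tensor_ind: (v : Ind M N A) => [|t a|x y IHx IHy].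
  - by rewrite scaler0 linear0.
  - rewrite (@scale_tens T R (tring_bimod M N)) [LHS]ind_top_tens.
    by rewrite tring_aug_bimod scale0r.
  - by rewrite scalerDr [LHS](linearD ind_top) IHx IHy addr0.
by rewrite !linearD IHx IHy addr0.
Qed.

Lemma ind_retr_struct x : ind_retr (struct _ x) = x.
Proof.
elim/tensor_ind: x => [|m v|x y IHx IHy]; first by rewrite !linear0.
  rewrite struct_tens; elim/tensor_ind: (v : Ind M N A) => [|t a|x y IHx IHy].
  - by rewrite scaler0 linear0 tens0r.
  - rewrite (@scale_tens T R (tring_bimod M N)) [LHS]ind_retr_funE.
    exact: ind_retr_bimod.
  - by rewrite scalerDr [LHS](linearD ind_retr) IHx IHy -tensDr.
by rewrite !linearD IHx IHy.
Qed.

Lemma ind_split x : ind_unit (ind_top x) + struct _ (ind_retr x) = x.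
Proof.
elim/tensor_ind: (x : Ind M N A) => [|t a|u v IHu IHv].
- by rewrite !linear0 addr0.
- rewrite [ind_top _]ind_top_tens [ind_retr _]ind_retr_funE.
  elim/tring_ind: (t : T) => [r|m u _|u v IHu IHv].
  + rewrite ind_retr_ring linear0 addr0.
    rewrite -[LHS](@tens_bal T R (tring_bimod M N)); congr (tensT _ a).
    exact: mul1r.
  + rewrite tring_aug_bimod scale0r linear0 add0r ind_retr_bimod struct_tens.
    exact: (@scale_tens T R (tring_bimod M N)).
  + rewrite rmorphD scalerDl ind_retr_tensD !linearD addrACA IHu IHv.
    by rewrite -tensDl.
- rewrite [ind_top _](linearD ind_top) [ind_retr _](linearD ind_retr).
  by rewrite !linearD addrACA IHu IHv.
Qed.

Lemma ind_lift V (f : {linear A -> forget V}) :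
  exists g : {linear Ind M N A -> V}, forall a, g (ind_unit a) = f a.
Proof.
have bal : balanced (fun (t : tring_bimod M N) (a : A) => (t : T) *: (f a : V)).
  split=> [t u a|t a b|t r a]; first exact: scalerDl.
    by rewrite linearD; apply: (@scalerDr T V).
  by rewrite linearZ; apply/esym/(@scalerA T V).
have lin : linear (tensor_lift
    (fun (t : tring_bimod M N) (a : A) => (t : T) *: (f a : V))).
  move=> t x y; rewrite (tensor_liftD bal); congr (_ + _).
  elim/tensor_ind: x => [|u a|x x' IHx IHx'].
  - by rewrite scaler0 (tensor_lift0 bal) scaler0.
  - by rewrite scale_tens !(tensor_lift_tens bal) scalerA.
  - by rewrite scalerDr !(tensor_liftD bal) IHx IHx' scalerDr.
exists (mk_linear lin) => a; rewrite [LHS](tensor_lift_tens bal); exact: scale1r.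
Qed.
End Induced.

End LeftModules.

Lemma rhom_scaleE (S R : nzRingType) (B : bimodule S R) (Y : lmodType (op R))
    (s : op S) (h : rhom B Y) (b : rmod B) :
  ((s *: h : rhom B Y) : {linear rmod B -> Y}) b =
  (h : {linear rmod B -> Y}) (bimod_lmul (s : S) b).
Proof. by []. Qed.

Section RightModules.
Variables (R : nzRingType) (M : bimodule R R) (N : nat).
Notation T := (tensor_ring M N).
Notation inR := (tring_of_ring M N).
Notation inM := (tring_of_bimod N).
Notation H := (hom_functor M).
Implicit Types (V W : lmodType (op T)) (A : lmodType (op R)).

Definition costruct V : {linear forget_op V -> H (forget_op V)} :=
  costruct_map (Y := V).

Lemma costructE V (v : forget_op V) (m : M) :
  (costruct V v : rhom M (forget_op V)) (m : rmod M) = (inM m : op T) *: (v : V).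
Proof. by []. Qed.

Lemma costruct_nat V W (f : {linear V -> W}) v :
  costruct W (forget_op_map f v) = fmap H (forget_op_map f) (costruct V v).
Proof. by apply: hom_ext => m; apply/esym/(linearZ_LR f). Qed.

Lemma op_scaleA V (s t : T) (v : V) :
  ((s * t : T) : op T) *: v = (t : op T) *: ((s : op T) *: v).
Proof. by rewrite scalerA. Qed.

Lemma tring_op_linear V W (f : {linear forget_op V -> forget_op W}) :
  (forall v, costruct W (f v) = fmap H f (costruct V v)) ->
  exists g : {linear V -> W}, forall v, g v = f v.
Proof.
move=> f_costruct.
have fM (m : M) (v : forget_op V) :
    f ((inM m : op T) *: (v : V)) = (inM m : op T) *: (f v : W).
  by rewrite -[RHS]/((costruct W (f v) : rhom M (forget_op W)) (m : rmod M)) f_costruct.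
have fT (t : T) (v : forget_op V) : f ((t : op T) *: (v : V)) = (t : op T) *: (f v : W).
  elim/tring_ind: t v => [r|m t IHt|s t IHs IHt] v.
  - exact: (linearZ_LR f (r : op R) v).
  - by rewrite !op_scaleA IHt fM.
  - by rewrite !scalerDl -IHs -IHt; apply: (linearD f).
have g_lin : linear (f : V -> W) by move=> t u v; rewrite [LHS](linearD f) fT.
by exists (mk_linear g_lin).
Qed.

Definition stalk_op A : lmodType (op T) :=
  restrict_scalars (rmorph_op (tring_aug (M := M) (N := N))) A.

Lemma stalk_op_scale A (t : T) (a : A) :
  (t : op T) *: (a : stalk_op A) = (tring_aug t : op R) *: a.
Proof. by []. Qed.

Fact stalk_op_val_linear A : linear (fun a : A => a : forget_op (stalk_op A)).
Proof. by move=> r a b; apply: (linearP (lid A)). Qed.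
Definition stalk_op_val A : {linear A -> forget_op (stalk_op A)} :=
  mk_linear (@stalk_op_val_linear A).

Lemma costruct_stalk_op A a : costruct (stalk_op A) (stalk_op_val A a) = 0.
Proof.
apply: hom_ext => m; rewrite costructE stalk_op_scale.
by rewrite -[inM m]mulr1 tring_aug_bimod scale0r.
Qed.

Section Coinduced.
Variable A : lmodType (op R).
Notation CoA := (forget_op (Coind M N A)).
Notation BT := (tring_bimod M N).
Notation coE h t := ((h : rhom BT A) (t : rmod BT)).

Lemma coind_ext (h k : CoA) : (forall t : T, coE h t = coE k t) -> h = k.
Proof. exact: (@hom_ext _ _ _ (h : rhom BT A) (k : rhom BT A)). Qed.

Lemma coind_scale (s t : T) (h : Coind M N A) :
  coE ((s : op T) *: h) t = coE h (s * t).
Proof. exact: rhom_scaleE. Qed.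

Lemma coind_ract (h : CoA) (t : T) r : coE h (t * inR r) = (r : op R) *: coE h t.
Proof. exact: (linearZ_LR h (r : op R) (t : rmod BT)). Qed.

Lemma coind_zeroE (t : T) : coE (0 : CoA) t = 0.
Proof. by []. Qed.

Fact coind_ev_linear : linear (fun h : CoA => coE h (1 : T)).
Proof.
move=> r h k; rewrite [LHS]/(coE _ _ + coE _ _); congr (_ + _).
by rewrite -coind_ract [LHS](coind_scale (inR r) 1 h) mulr1 mul1r.
Qed.
Definition coind_ev : {linear CoA -> A} := mk_linear coind_ev_linear.

Fact coind_const_fun_linear a : 
  linear ((fun t => (tring_aug (t : T) : op R) *: a) : rmod BT -> A).
Proof.
move=> r s t; rewrite tring_augD scalerDl; congr (_ + _).
by rewrite [tring_aug _](tring_augM (s : T) (inR r)) scalerA.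
Qed.
Fact coind_const_linear :
  linear (fun a : A => mk_linear (coind_const_fun_linear a) : CoA).
Proof.
move=> r a b; apply: coind_ext => t; rewrite [LHS]scalerDr; congr (_ + _).
rewrite [RHS](coind_scale (inR r) t) [RHS]/((tring_aug (inR r * t) : op R) *: a).
by rewrite rmorphM scalerA.
Qed.
Definition coind_const : {linear A -> CoA} := mk_linear coind_const_linear.
Lemma coind_constE a t : coE (coind_const a) t = (tring_aug (t : T) : op R) *: a.
Proof. by []. Qed.

Hypothesis M_nilpotent : nilpotent_bimod M N.

Section SectionAt.
Variable k : H CoA.
Notation kE m t := (coE ((k : rhom M CoA) (m : rmod M)) t).
(** The map on T that sends m t to (k m) t and vanishes on R: a section of the
    structure map of Coind A. *)
Definition coind_sect_fun (t : rmod BT) : A :=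
  tring_case (fun (m : M) (t : T) => kE m t) (t : T).
Fact coind_sect_Dl (m m' : M) (t : T) : kE (m + m') t = kE m t + kE m' t.
Proof. by rewrite (linearD (k : rhom M CoA)). Qed.
Fact coind_sect_Dr (m : M) (t t' : T) : kE m (t + t') = kE m t + kE m t'.
Proof. exact: (linearD ((k : rhom M CoA) (m : rmod M) : rhom BT A)). Qed.
Fact coind_sect_bal (m : M) r (t : T) : kE (ract m r) t = kE m (inR r * t).
Proof.
rewrite [ract m r]/((r : op R) *: (m : rmod M)) (linearZ_LR (k : rhom M CoA)).
exact: (coind_scale (inR r) t).
Qed.
Lemma coind_sect_funD (s t : T) :
  coind_sect_fun (s + t : T) = coind_sect_fun s + coind_sect_fun t.
Proof. exact: (tring_caseD coind_sect_Dl coind_sect_Dr coind_sect_bal). Qed.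
Lemma coind_sect_ring r : coind_sect_fun (inR r) = 0.
Proof. exact: (tring_case_ring coind_sect_Dl coind_sect_Dr coind_sect_bal). Qed.
Lemma coind_sect_bimod m (t : T) : coind_sect_fun (inM m * t) = kE m t.
Proof. exact: (tring_case_bimod coind_sect_Dl coind_sect_Dr coind_sect_bal). Qed.
Lemma coind_sect_ract (t : T) r :
  coind_sect_fun (t * inR r) = (r : op R) *: coind_sect_fun t.
Proof.
elim/tring_ind: t => [s|m u _|u v IHu IHv].
- by rewrite -(rmorphM inR) !coind_sect_ring scaler0.
- by rewrite -mulrA !coind_sect_bimod coind_ract.
- by rewrite mulrDl !coind_sect_funD scalerDr IHu IHv.
Qed.
Fact coind_sect_fun_linear : linear coind_sect_fun.
Proof.
by move=> r s t; rewrite coind_sect_funD; congr (_ + _); apply: coind_sect_ract.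
Qed.
End SectionAt.

Lemma coind_sect_fun_comb r (k k' : H CoA) (t : T) :
  coind_sect_fun (r *: k + k') t = coind_sect_fun k (inR r * t) + coind_sect_fun k' t.
Proof.
elim/tring_ind: t => [s|m u _|u v IHu IHv].
- by rewrite -(rmorphM inR) !coind_sect_ring addr0.
- by rewrite mulrA -tring_of_bimodZ !coind_sect_bimod.
- by rewrite mulrDr !coind_sect_funD IHu IHv addrACA.
Qed.
Fact coind_sect_linear :
  linear (fun k : H CoA => mk_linear (coind_sect_fun_linear k) : CoA).
Proof.
move=> r k k'; apply: coind_ext => t.
exact: coind_sect_fun_comb.
Qed.
Definition coind_sect : {linear H CoA -> CoA} := mk_linear coind_sect_linear.

Lemma coind_ev_const a : coind_ev (coind_const a) = a.
Proof. by rewrite [LHS](coind_constE a 1) [tring_aug _]rmorph1 scale1r. Qed.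

Lemma coind_costruct_const a : costruct _ (coind_const a) = 0.
Proof.
apply: hom_ext => m; apply: coind_ext => t.
rewrite costructE coind_scale coind_constE tring_aug_bimod scale0r.
by rewrite -[RHS](coind_zeroE t).
Qed.

Lemma coind_costruct_sect k : costruct _ (coind_sect k) = k.
Proof.
apply: hom_ext => m; apply: coind_ext => t.
rewrite costructE coind_scale; exact: coind_sect_bimod.
Qed.

Lemma coind_split_at (h : CoA) (t : T) :
  (tring_aug t : op R) *: coE h (1 : T) + coind_sect_fun (costruct _ h) t = coE h t.
Proof.
elim/tring_ind: t => [r|m u _|u v IHu IHv].
- by rewrite coind_sect_ring addr0 -coind_ract mul1r.
- rewrite tring_aug_bimod scale0r add0r coind_sect_bimod costructE.
  exact: coind_scale.
- rewrite tring_augD scalerDl coind_sect_funD addrACA IHu IHv.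
  exact/esym/(linearD (h : rhom BT A)).
Qed.

Lemma coind_split h : coind_const (coind_ev h) + coind_sect (costruct _ h) = h.
Proof.
apply: coind_ext => t; exact: coind_split_at.
Qed.

Lemma coind_lift V (f : {linear forget_op V -> A}) :
  exists g : {linear V -> Coind M N A}, forall v, coind_ev (g v) = f v.
Proof.
have lin v : linear (fun t : rmod BT => f ((t : op T) *: (v : V))).
  move=> r s t; rewrite scalerDl [LHS](linearD f); congr (_ + _).
  rewrite -(linearZ_LR f (r : op R)); congr (f _).
  exact: (op_scaleA (s : T) (inR r)).
have lin' : linear (fun v : V => mk_linear (lin v) : Coind M N A).
  move=> s u v; apply: coind_ext => t.
  rewrite [LHS]/(f _) scalerDr [LHS](linearD f); congr (_ + _).
  by rewrite [RHS]/(f _) op_scaleA.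
by exists (mk_linear lin') => v; rewrite [LHS]/(f _) scale1r.
Qed.
End Coinduced.

End RightModules.

(** * Gorenstein projective algebras over a nilpotent functor *)

Lemma descent (P : nat -> Prop) n :
  P n -> (forall k, P k.+1 -> P k) -> forall k, (k <= n)%N -> P k.
Proof.
move=> Pn step k le_kn; rewrite -(subKn le_kn).
elim: (n - k)%N (leq_subr k n) => [|i IHi] le_in; first by rewrite subn0.
by apply: step; rewrite -subSn // subSS; apply/IHi/ltnW.
Qed.

Definition res (R T : nzRingType) (phi : {rmorphism R -> T}) (V : lmodType T) :
  lmodType R := restrict_scalars phi V.
Definition res_map (R T : nzRingType) (phi : {rmorphism R -> T})
    (V W : lmodType T) (f : {linear V -> W}) : {linear res phi V -> res phi W} :=
  restrict_map (phi := phi) f.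

(** A ring T over R whose modules are the pairs (X, u : F X -> X) for a
    nilpotent right exact functor F on R-modules, together with the free such
    pairs Ind A = A + F (Ind A) and the pairs with zero structure map. *)
Record algebra_setting (R T : nzRingType) (phi : {rmorphism R -> T}) :=
  AlgebraSetting {
  as_fun : functor R;
  as_bound : nat;
  as_right_exact : right_exact as_fun;
  as_nilpotent : nilpotent_functor as_fun as_bound;
  as_struct : forall V : lmodType T, {linear as_fun (res phi V) -> res phi V};
  as_struct_nat : forall (V W : lmodType T) (f : {linear V -> W}) x,
    res_map phi f (as_struct V x) = as_struct W (fmap as_fun (res_map phi f) x);
  as_linear : forall (V W : lmodType T) (f : {linear res phi V -> res phi W}),
    (forall x, f (as_struct V x) = as_struct W (fmap as_fun f x)) ->
    exists g : {linear V -> W}, forall v, g v = f v;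
  as_stalk : lmodType R -> lmodType T;
  as_stalk_val : forall A, {linear res phi (as_stalk A) -> A};
  as_stalk_mono : forall A, mono (as_stalk_val A);
  as_stalk_epi : forall A, epi (as_stalk_val A);
  as_stalk_struct : forall A x, as_stalk_val A (as_struct (as_stalk A) x) = 0;
  as_ind : lmodType R -> lmodType T;
  as_unit : forall A : lmodType R, {linear A -> res phi (as_ind A)};
  as_top : forall A : lmodType R, {linear res phi (as_ind A) -> A};
  as_retr : forall A : lmodType R,
    {linear res phi (as_ind A) -> as_fun (res phi (as_ind A))};
  as_top_unit : forall A a, as_top A (as_unit A a) = a;
  as_top_struct : forall A x, as_top A (as_struct (as_ind A) x) = 0;
  as_retr_struct : forall A x, as_retr A (as_struct (as_ind A) x) = x;
  as_split : forall A x,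
    as_unit A (as_top A x) + as_struct (as_ind A) (as_retr A x) = x;
  as_lift : forall (A : lmodType R) (V : lmodType T) (f : {linear A -> res phi V}),
    exists g : {linear as_ind A -> V}, forall a, g (as_unit A a) = f a
}.

Section ProjectiveSide.
Variables (R T : nzRingType) (phi : {rmorphism R -> T}) (C : algebra_setting phi).
Notation F := (as_fun C).
Notation n := (as_bound C).
Notation Fk k := (fun_pow F k).
Notation forget V := (res phi V).
Notation struct V := (as_struct C V).
Notation stalk A := (as_stalk C A).
Notation Ind A := (as_ind C A).
Notation eta A := (as_unit C A).
Notation eps A := (as_top C A).
Notation rho A := (as_retr C A).
Notation "f ^R" := (res_map phi f) (at level 2, format "f ^R").
Implicit Types (V W : lmodType T) (A B G P : lmodType R).

Let F_rex : right_exact F := @as_right_exact _ _ _ C.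
Let Fk_rex k : right_exact (Fk k) := fun_pow_right_exact k F_rex.
Let F_nil : nilpotent_functor F n := @as_nilpotent _ _ _ C.

(** The top is determined up to isomorphism only, so that it can be a given
    syzygy and not just the quotient module coker. *)
Definition is_top V G (p : {linear forget V -> G}) : Prop := right_ex (struct V) p.

(** V + F W -> W is onto, so by descending induction on k the image of F^k h is
    all of F^k W, starting from F^n W = 0. *)
Lemma nakayama V W (h : {linear V -> W}) :
  (forall w, exists v x, w = h v + struct W x) -> epi (h^R).
Proof.
move=> hW; pose c := lcopair (h^R) (struct W).
have c_epi : epi c by move=> w; have [v [x ->]] := hW w; exists (v, x).
suff: forall k, (k <= n)%N -> epi (fmap (Fk k) (h^R)) by move/(_ 0 isT).
apply: descent => [w|k IHk w]; first by exists 0; rewrite [w]F_nil linear0.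
have [z <-] := right_exact_epi (@Fk_rex k) c_epi w.
have [y yE] := IHk (fmap (Fk k) (lsnd _ _) z).
exists (fmap (Fk k) (lfst _ _) z + fmap (Fk k) (struct V) y).
rewrite linearD -!fmap_comp.
rewrite [RHS](_ : _ = fmap (Fk k) (lcomp (h^R) (lfst _ _)) z +
  fmap (Fk k) (lcomp (struct W) (lsnd _ _)) z); last by rewrite -fmap_add.
congr (_ + _); rewrite [RHS]fmap_comp -yE.
rewrite fun_pow_succ -fmap_comp.
by apply: fmap_ext => x /=; apply: as_struct_nat.
Qed.

(** F^k f is seen to be injective by descending induction on k: an element of
    its kernel dies in F^k G, hence comes from F^(k+1) V, where F^(k+1) f
    kills it, the structure map of Ind P being split injective. *)
Lemma mono_over_top V G P (p : {linear forget V -> G}) (i : {linear G -> P})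
    (f : {linear V -> Ind P}) :
  is_top p -> (forall x, eps P (f x) = i (p x)) -> (forall k, mono (fmap (Fk k) i)) ->
  forall k, mono (fmap (Fk k) (f^R)).
Proof.
move=> p_top fE i_mono k0.
suff: forall k, (k <= k0 + n)%N -> mono (fmap (Fk k) (f^R)).
  by apply; apply: leq_addr.
apply: descent => [z _|k IHk z fz0].
  exact: (nilpotent_functor_add (m := k0) F_nil).
have [[_ ker_p] _] := Fk_rex k p_top.
have [|y yz] := ker_p z.
  apply: (i_mono k); rewrite (@fmap_sq _ _ _ _ _ _ i p (eps P) (f^R)); last first.
    by move=> x; rewrite fE.
  by rewrite fz0 linear0.
suff y0 : y = 0 by rewrite -yz y0 linear0.
apply: IHk; rewrite -[LHS](fmap_cancel (Fk k) (@as_retr_struct _ _ _ C _)).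
rewrite fun_pow_succ.
rewrite (@fmap_sq _ (Fk k) _ _ _ _ (struct _) (fmap F (f^R)) (f^R) (struct V)).
  by rewrite yz fz0 linear0.
by move=> x; apply/esym/as_struct_nat.
Qed.

Lemma ind_lift_top A B (b : {linear A -> B}) (g : {linear Ind A -> Ind B}) :
  (forall a, g (eta A a) = eta B (b a)) -> forall x, eps B (g x) = b (eps A x).
Proof.
move=> gE x; rewrite -{1}(@as_split _ _ _ C _ x).
rewrite [g _](linearD (g^R)) linearD [g^R _]gE as_top_unit as_struct_nat.
by rewrite as_top_struct addr0.
Qed.

(** For the tensor ring this is the isomorphism of T (x) M with the augmentation
    ideal of T, tensored with A. Both the injectivity of kappa and its
    surjectivity onto the image of the structure map follow by descending
    induction on the power of F, from Ind B = B + F (Ind B). *)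
Lemma ind_radical A :
  exists kappa : {linear Ind (F A) -> Ind A}, left_ex (kappa^R) (eps A).
Proof.
have [kappa kE] := as_lift (V := Ind A) C (lcomp (struct (Ind A)) (fmap F (eta A))).
have kS x : kappa^R (struct _ x) = struct _ (fmap F (kappa^R) x) := as_struct_nat kappa x.
have ek0 x : eps A (kappa^R x) = 0.
  rewrite -[x](@as_split _ _ _ C _) linearD [kappa^R _]kE kS linearD.
  by rewrite !as_top_struct addr0.
exists kappa; split; last split=> // y ey0.
- suff: forall k, (k <= n)%N -> mono (fmap (Fk k) (kappa^R)) by move/(_ 0 isT).
  apply: descent => [z _|k IHk z kz0]; first exact: F_nil.
  have zE := fmap_split (Fk k) (@as_split _ _ _ C (F A)) z.
  move: zE; set a := fmap (Fk k) (eps _) z; set w := fmap (Fk k) (rho _) z => zE.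
  have sum0 : fmap (Fk k.+1) (eta A) a + fmap (Fk k.+1) (kappa^R) w = 0.
    rewrite -[LHS](fmap_cancel (Fk k) (@as_retr_struct _ _ _ C _)).
    rewrite -[RHS](linear0 (fmap (Fk k) (rho A))) -kz0 -zE !linearD.
    congr (fmap (Fk k) (rho A) _ + fmap (Fk k) (rho A) _).
      by rewrite fun_pow_succ; apply: fmap_sq => x; apply/esym/kE.
    by rewrite fun_pow_succ; apply: fmap_sq => x; apply/esym/kS.
  have a0 : a = 0.
    rewrite -[a]addr0 -(linear0 (fmap (Fk k.+1) (eps A))) -[in RHS]sum0 linearD.
    rewrite (fmap_cancel (Fk k.+1) (@as_top_unit _ _ _ C A)).
    by rewrite (fmap_null (Fk k.+1) ek0) linear0 !addr0.
  move: sum0; rewrite a0 linear0 add0r => /IHk w0.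
  by rewrite -zE a0 w0 !linear0 addr0.
- have sub k : (k <= n)%N -> forall y : Fk k.+1 (forget (Ind A)),
      exists z, fmap (Fk k) (kappa^R) z = fmap (Fk k) (struct (Ind A)) y.
    move: k; apply: descent => [z|k IHk z].
      by exists 0; rewrite [z](nilpotent_functor_add (m := 1) F_nil) !linear0.
    have zE := fmap_split (Fk k.+1) (@as_split _ _ _ C A) z.
    have [u uE] := IHk (fmap (Fk k.+1) (rho A) z).
    exists (fmap (Fk k) (eta _) (fmap (Fk k.+1) (eps A) z) +
            fmap (Fk k) (struct _) u).
    rewrite -[in RHS]zE !linearD; congr (_ + _).
      by rewrite fun_pow_succ; apply: fmap_sq => x; apply: kE.
    by rewrite -uE fun_pow_succ; apply: fmap_sq => x; apply: kS.
  have [x xE] := @sub 0 isT (rho A y).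
  exists x; rewrite [kappa^R x]xE -[RHS](@as_split _ _ _ C _ y) ey0 linear0.
  by rewrite add0r.
Qed.

Lemma ind_zero A : (forall a : A, a = 0) -> forall x : Ind A, x = 0.
Proof.
move=> A0 x; have [|y] := @nakayama (Ind A) (Ind A) (lzero _ _) _ x; last by [].
move=> w; exists 0, (rho A w); rewrite -[LHS](@as_split _ _ _ C A w).
by rewrite (A0 (eps A w)) !linear0.
Qed.

(** A T-linear map V -> Ind A is built from its components V -> F^k A, each of
    which extends F applied to the previous one along the structure map. Here
    f0 is the sum of the components so far, fm the next one and iota the
    inclusion of its target. *)
Lemma lift_to_ind_step m V A B (iota : {linear B -> forget (Ind A)})
    (fm : {linear forget V -> B}) (f0 : {linear forget V -> forget (Ind A)}) :
  (forall x : Fk m B, x = 0) -> (forall k, extends (struct V) (Fk k.+1 B)) ->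
  (forall x, f0 (struct V x) + iota (fm (struct V x)) =
             struct (Ind A) (fmap F f0 x)) ->
  exists f : {linear V -> Ind A},
    forall x, eps A (f x) = eps A (f0 x + iota (fm x)).
Proof.
elim: m B iota fm f0 => [|m IHm] B iota fm f0 B_nil B_ext f0E.
  have fm0 x : fm x = 0 := B_nil _.
  have [|f fE] := @as_linear _ _ _ C V (Ind A) f0.
    by move=> x; rewrite -f0E fm0 linear0 addr0.
  by exists f => x; rewrite fE fm0 linear0 addr0.
have [fm' fm'E] := B_ext 0 (fmap F fm).
pose f1 := ladd f0 (lcomp iota fm).
have [|k|x|f fE] := IHm (F B) (lcomp (struct (Ind A)) (fmap F iota)) fm' f1.
- exact: B_nil.
- exact: (B_ext k.+1).
- rewrite /= fm'E f0E /f1 fmap_add linearD; congr (_ + struct _ _).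
  by rewrite fmap_comp.
- by exists f => x; rewrite fE linearD as_top_struct addr0.
Qed.

Lemma lift_to_ind V G A (p : {linear forget V -> G}) (g : {linear G -> A}) :
  is_top p -> (forall k, extends (struct V) (Fk k.+1 A)) ->
  exists f : {linear V -> Ind A}, forall x, eps A (f x) = g (p x).
Proof.
move=> [[p_struct _] _] A_ext.
have [|//||f fE] := @lift_to_ind_step n V A A (eta A) (lcomp g p) (lzero _ _).
- exact: F_nil.
- by move=> x; rewrite /= p_struct !linear0 (fmap_zero F) ?linear0 ?addr0.
by exists f => x; rewrite fE /= add0r as_top_unit.
Qed.

(** The map h induces b on tops; extend b to P and let g0 : Ind P -> Ind A have
    the extension as its top. Then h - g0 f takes values in the radical
    Ind (F A), which is the same problem for F A, and F is nilpotent. *)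
Lemma extends_ind V G P (p : {linear forget V -> G}) (i : {linear G -> P})
    (f : {linear V -> Ind P}) m A :
  is_top p -> (forall x, eps P (f x) = i (p x)) ->
  (forall x : Fk m A, x = 0) -> (forall k, extends i (Fk k A)) ->
  extends f (Ind A).
Proof.
move=> [[p_struct ker_p] p_epi] fE; elim: m A => [|m IHm] A A_nil A_ext h.
  by exists (lzero _ _) => x; rewrite (ind_zero A_nil (h x)).
have [|b bE] := factor_epi (t := lcomp (eps A) (h^R)) p_epi.
  by move=> x /ker_p[y <-]; rewrite /= as_struct_nat as_top_struct.
have [b' b'E] := A_ext 0 b.
have [g0 g0E] := as_lift C (lcomp (eta A) b').
have [kappa [kappa_mono [kappa0 ker_eps]]] := ind_radical A.
have [|h1 h1E] := @factor_mono _ _ _ _ kappa (lsub h (lcomp g0 f)) kappa_mono.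
  move=> x; apply: ker_eps; rewrite linearB /=.
  rewrite [X in _ - X](ind_lift_top g0E) fE b'E bE subrr //.
have [h2 h2E] := IHm (F A) A_nil (fun k => A_ext k.+1) h1.
exists (ladd (lcomp kappa h2) g0) => x.
by rewrite /= h2E h1E /= subrK.
Qed.

Lemma ind_hom_zero A W (d : {linear Ind A -> W}) :
  (forall a, d (eta A a) = 0) -> forall x, d x = 0.
Proof.
move=> d_eta; suff d0 : forall k, (k <= n)%N -> forall x, fmap (Fk k) (d^R) x = 0.
  by move=> x; apply: (d0 0).
apply: descent => [x|k IHk x]; first exact: F_nil.
rewrite -[x](fmap_split (Fk k) (@as_split _ _ _ C A)) linearD.
rewrite (fmap_null (Fk k)) // add0r.
rewrite (@fmap_sq _ (Fk k) _ _ _ _ _ _ (struct W) (fmap F (d^R))).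
  by rewrite -fun_pow_succ IHk linear0.
exact: as_struct_nat.
Qed.

Lemma ind_projective P : projective P -> projective (Ind P).
Proof.
move=> P_proj V W g f g_epi.
have [h hE] := P_proj _ _ (g^R) (lcomp (f^R) (eta P)) g_epi.
have [h' h'E] := as_lift C h; exists h' => x; apply/subr0_eq.
apply: (@ind_hom_zero _ _ (lsub (lcomp g h') f)) => a.
by rewrite /= h'E [g _]hE subrr.
Qed.

(** Let the structure map of V' kill the class of w in F (Ind P). Then the
    structure map of Ind P sends w to some f x; the top of x vanishes because
    G -> P is injective, so w comes from F V and its class is zero. *)
Lemma next_syzygy V G P G' (p : {linear forget V -> G}) (i : {linear G -> P})
    (q : {linear P -> G'}) (f : {linear V -> Ind P}) :
  is_top p -> short_exact i q -> (forall k, mono (fmap (Fk k) i)) ->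
  (forall x, eps P (f x) = i (p x)) ->
  exists V' (h : {linear Ind P -> V'}),
    [/\ short_exact f h, mono (struct V') &
        exists p' : {linear forget V' -> G'}, is_top p'].
Proof.
move=> p_top [i_mono [qi0 ker_q] q_epi] Fi_mono fE.
have [[p_struct ker_p] p_epi] := p_top.
have f_mono : mono f := mono_over_top p_top fE Fi_mono (k := 0%N).
have [hf_ex h_epi] := coker_map_right_ex f.
exists (coker f), (coker_map f); move: (coker_map f) hf_ex h_epi => h [hf0 ker_h] h_epi.
have [[Fhf0 ker_Fh] Fh_epi] : right_ex (fmap F (f^R)) (fmap F (h^R)).
  exact: F_rex.
split=> //.
- move=> z sz0; have [w wz] := Fh_epi z.
  have [|x xw] := ker_h (struct _ w).
    by rewrite -[h _]/(h^R _) as_struct_nat wz.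
  have px0 : p x = 0.
    by apply: i_mono; rewrite -fE xw as_top_struct.
  have [y yx] := ker_p _ px0.
  have -> : z = fmap F (h^R) (fmap F (f^R) y).
    rewrite -wz -[w](@as_retr_struct _ _ _ C) -xw -yx.
    by rewrite -[f _]/(f^R _) as_struct_nat as_retr_struct.
  exact: Fhf0.
- have [|p' p'E] := @factor_epi _ _ _ _ (h^R) (lcomp q (eps P)) h_epi.
    by move=> y /ker_h[x <-]; rewrite /= fE qi0.
  exists p'; split; last first.
    move=> g; have [a <-] := q_epi g; exists (h (eta P a)).
    by rewrite [p' _]p'E /= as_top_unit.
  split=> [z|v].
    have [w <-] := Fh_epi z.
    by rewrite -as_struct_nat p'E /= as_top_struct linear0.
  have [y <-] := h_epi v; rewrite [p' _]p'E => /ker_q[g gE].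
  have [x xg] := p_epi g.
  exists (fmap F (h^R) (rho P (y - f x))); rewrite -as_struct_nat.
  have -> : struct (Ind P) (rho P (y - f x)) = y - f x.
    have ey0 : eps P (y - f x) = 0 by rewrite linearB fE xg gE subrr.
    by rewrite -[RHS](@as_split _ _ _ C P) ey0 linear0 add0r.
  by rewrite [LHS](linearB h) hf0 subr0.
Qed.

(** P -> G lifts to P -> V, which induces Ind P -> V, onto by Nakayama's lemma.
    The kernel has top G' by the snake lemma, and mono_over_top with k = 1 makes
    its structure map injective. *)
Lemma previous_syzygy V G P G' (p : {linear forget V -> G}) (i : {linear G' -> P})
    (q : {linear P -> G}) :
  mono (struct V) -> is_top p -> projective P -> short_exact i q ->
  (forall k, mono (fmap (Fk k) i)) ->
  exists V' (f : {linear V' -> Ind P}) (h : {linear Ind P -> V}),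
    [/\ short_exact f h, mono (struct V') &
        exists p' : {linear forget V' -> G'},
          is_top p' /\ forall x, eps P (f x) = i (p' x)].
Proof.
move=> struct_mono [[p_struct ker_p] p_epi] P_proj iq Fi_mono.
have [i_mono [qi0 ker_q] q_epi] := iq.
have [l lE] := P_proj _ _ p q p_epi.
have [h hE] := as_lift C l.
have ph x : p (h x) = q (eps P x).
  rewrite -[x in LHS](@as_split _ _ _ C P) [h _](linearD (h^R)) linearD.
  by rewrite as_struct_nat p_struct addr0 [h^R _]hE lE.
have h_epi : epi (h^R).
  apply: nakayama => w; have [a aE] := q_epi (p w).
  have [|x xE] := ker_p (w - h (eta P a)).
    by rewrite linearB ph as_top_unit aE subrr.
  by exists (eta P a), x; rewrite xE addrC subrK.
have Fh_epi : epi (fmap F (h^R)) := right_exact_epi F_rex h_epi.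
have [f_mono [hf0 ker_h]] := ker_incl_left_ex h.
exists (kernel h), (ker_incl h), h; move: (ker_incl h) f_mono hf0 ker_h => f f_mono hf0 ker_h.
have [[_ ker_Fh] _] : right_ex (fmap F (f^R)) (fmap F (h^R)) by exact: F_rex.
have [|p' p'E] := @factor_mono _ _ _ _ i (lcomp (eps P) (f^R)) i_mono.
  by move=> x; apply: ker_q; rewrite /= -ph hf0 linear0.
have p'_top : is_top p'.
  split; last first.
    move=> g; have [|w wE] := ker_p (h (eta P (i g))).
      by rewrite ph as_top_unit qi0.
    have [w' w'E] := Fh_epi w.
    have [|x xE] := ker_h (eta P (i g) - struct _ w').
      rewrite [h _](linearB (h^R)) as_struct_nat w'E wE; exact: subrr.
    exists x; apply: (iffLR (mono_injective _) i_mono).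
    by rewrite p'E /= [f^R x]xE linearB as_top_unit as_top_struct subr0.
  split=> [x|x px0].
    apply: i_mono; rewrite p'E /= as_struct_nat; exact: as_top_struct.
  have ex0 : eps P (f^R x) = 0 by rewrite -[LHS]p'E px0 linear0.
  have fx : struct _ (rho P (f^R x)) = f^R x.
    by rewrite -[RHS](@as_split _ _ _ C P) ex0 linear0 add0r.
  have [|w wE] := ker_Fh (rho P (f^R x)).
    by apply: struct_mono; rewrite -as_struct_nat fx; apply: hf0.
  exists w; apply: (iffLR (mono_injective (f^R)) f_mono).
  by rewrite as_struct_nat wE fx.
split=> //; last by exists p'; split=> // x; rewrite p'E.
move=> z sz0; apply: (mono_over_top p'_top (fun x => esym (p'E x)) Fi_mono (k := 1)).
rewrite -[LHS](@as_retr_struct _ _ _ C) /= -as_struct_nat sz0 !linear0 //.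
Qed.

Lemma stalk_hom V A (f : {linear forget V -> A}) :
  (forall x, f (struct V x) = 0) ->
  exists g : {linear V -> stalk A}, forall v, as_stalk_val C A (g v) = f v.
Proof.
move=> f_struct; have val_mono := @as_stalk_mono _ _ _ C A.
have [|f' f'E] := factor_mono (t := f) val_mono.
  by move=> x; apply: as_stalk_epi.
have [|g gE] := @as_linear _ _ _ C V (stalk A) f'.
  move=> x; apply: (iffLR (mono_injective _) val_mono).
  by rewrite f'E f_struct as_stalk_struct.
by exists g => v; rewrite gE f'E.
Qed.

Lemma stalk_struct V A (g : {linear V -> stalk A}) x :
  as_stalk_val C A (g (struct V x)) = 0.
Proof. by rewrite -[g _]/(g^R _) as_struct_nat as_stalk_struct. Qed.

(** The top is left adjoint to the stalk functor, which is exact. *)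
Lemma projective_top V G (p : {linear forget V -> G}) :
  projective V -> is_top p -> projective G.
Proof.
move=> V_proj [[p_struct ker_p] p_epi] A B g f g_epi.
have [|g' g'E] := stalk_hom (V := stalk A) (f := lcomp g (as_stalk_val C A)).
  by move=> x; rewrite /= as_stalk_struct linear0.
have [|f' f'E] := stalk_hom (f := lcomp f p).
  by move=> x; rewrite /= p_struct linear0.
have [|h hE] := V_proj _ _ g' f'.
  move=> b; have [a aE] := g_epi (as_stalk_val C B b).
  have [a' a'E] := as_stalk_epi C a; exists a'.
  apply: (iffLR (mono_injective _) (@as_stalk_mono _ _ _ C B)).
  by rewrite g'E /= a'E.
have [|k kE] := factor_epi (t := lcomp (as_stalk_val C A) (h^R)) p_epi.
  by move=> x /ker_p[y <-]; apply: stalk_struct.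
exists k => y; have [x <-] := p_epi y.
by rewrite kE -[LHS]g'E [h^R x]/(h x) hE f'E.
Qed.

(** A projective V is a direct summand of Ind V. *)
Lemma projective_struct_mono V : projective V -> mono (struct V).
Proof.
move=> V_proj; have [g gE] := as_lift C (lid (forget V)).
have [|s sE] := V_proj _ _ g (lid V); first by move=> v; exists (eta (forget V) v); apply: gE.
move=> z sz0; rewrite -(fmap_cancel F (f := s^R) (g := g^R) sE z).
rewrite -[fmap F (s^R) z](@as_retr_struct _ _ _ C) -as_struct_nat sz0.
by rewrite !linear0.
Qed.

(** Ind A -> A becomes T-linear as a map onto the stalk A; a map from the top
    of V to A is extended to the next projective module by lifting it to a map
    V -> Ind A first, for which the preceding step of the resolution and the
    radical Ind (F A) of Ind A are needed. *)
Lemma proj_step_top (X : lmodType R -> Prop) (V0 Q0 V Q V' : lmodType T) G G'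
    (f0 : {linear V0 -> Q0}) (h0 : {linear Q0 -> V})
    (f : {linear V -> Q}) (h : {linear Q -> V'})
    (p : {linear forget V -> G}) (p' : {linear forget V' -> G'}) :
  short_exact f0 h0 -> short_exact f h -> projective Q0 -> projective Q ->
  mono (struct V') -> is_top p -> is_top p' ->
  (forall A, X A -> extends f0 (Ind (F A))) ->
  (forall A, X A -> extends f (Ind A)) ->
  proj_step X G G'.
Proof.
move=> [f0_mono [h0f0 ker_h0] h0_epi] [f_mono [hf0 ker_h] h_epi] Q0_proj Q_proj.
move=> struct_mono [[p_struct ker_p] p_epi] [[p'_struct ker_p'] p'_epi] X0 X1.
have pQ_top : is_top (coker_map (struct Q)) := coker_map_right_ex (struct Q).
move: (coker_map _) pQ_top => pQ pQ_top; have CQ_proj := projective_top Q_proj pQ_top.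
have [[pQ_struct ker_pQ] pQ_epi] := pQ_top.
have [|i iE] := @factor_epi _ _ _ _ p (lcomp pQ (f^R)) p_epi.
  by move=> x /ker_p[y <-]; rewrite /= as_struct_nat pQ_struct.
have [|q qE] := @factor_epi _ _ _ _ pQ (lcomp p' (h^R)) pQ_epi.
  by move=> x /ker_pQ[y <-]; rewrite /= as_struct_nat p'_struct.
have [[_ ker_Fh] Fh_epi] : right_ex (fmap F (f^R)) (fmap F (h^R)) by exact: F_rex.
exists (coker (struct Q)), i, q; split=> //; first split; first 1 last.
- split=> [g|y qy0].
    have [x <-] := p_epi g.
    by rewrite iE qE /= [h^R _]hf0 linear0.
  have [w wy] := pQ_epi y; move: qy0; rewrite -wy qE => /ker_p'[w' w'E].
  have [w'' w''E] := Fh_epi w'.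
  have [|x xE] := ker_h (w - struct Q w'').
    by rewrite [h _](linearB (h^R)) as_struct_nat w''E w'E subrr.
  exists (p x); rewrite iE /= [f^R x]xE linearB pQ_struct; exact: subr0.
- move=> g'; have [v <-] := p'_epi g'; have [w <-] := h_epi v.
  by exists (pQ w); rewrite qE.
- move=> A XA b.
  have [|E Eval] := stalk_hom (V := Ind A) (f := eps A).
    exact: as_top_struct.
  have [|bV bVE] := stalk_hom (f := lcomp b p).
    by move=> x; rewrite /= p_struct linear0.
  have E_epi : epi E.
    move=> a; exists (eta A (as_stalk_val C A a)).
    apply: (iffLR (mono_injective _) (@as_stalk_mono _ _ _ C A)).
    by rewrite Eval as_top_unit.
  have [e eE] := Q0_proj _ _ E (lcomp bV h0) E_epi.
  have eps_e x : eps A (e x) = b (p (h0 x)) by rewrite -Eval eE /= bVE.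
  have [kappa [kappa_mono [kappa0 ker_eps]]] := ind_radical A.
  have [|d dE] := @factor_mono _ _ _ _ kappa (lcomp e f0) kappa_mono.
    by move=> x; apply: ker_eps; rewrite eps_e h0f0 !linear0.
  have [d' d'E] := X0 A XA d.
  have [|e' e'E] := factor_epi (t := lsub e (lcomp kappa d')) h0_epi.
    by move=> x /ker_h0[y <-]; rewrite /= d'E dE /= subrr.
  have eps_e' x : eps A (e' x) = b (p x).
    have [y <-] := h0_epi x; rewrite e'E linearB /= eps_e.
    by rewrite [X in _ - X]kappa0 subr0.
  have [e'' e''E] := X1 A XA e'.
  have [|b' b'E] := factor_epi (t := lcomp (eps A) (e''^R)) pQ_epi.
    by move=> x /ker_pQ[y <-]; rewrite /= as_struct_nat as_top_struct.
  exists b' => g; have [x <-] := p_epi g.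
  by rewrite iE b'E /= [e''^R _]e''E eps_e'.
- move=> g; have [x <-] := p_epi g; rewrite iE => /ker_pQ[w wE].
  have [|w' w'E] := ker_Fh w.
    by apply: struct_mono; rewrite -as_struct_nat wE; apply: hf0.
  suff <- : struct V w' = x by apply: p_struct.
  apply: (iffLR (mono_injective (f^R)) f_mono).
  by rewrite as_struct_nat w'E wE.
Qed.

Lemma iso_mono_struct V W : isomorphic V W -> mono (struct W) -> mono (struct V).
Proof.
move=> /isomorphicP[u [v [uK vK]]] W_mono z sz0.
rewrite -(fmap_cancel F (f := u^R) (g := v^R) uK z).
by rewrite (W_mono (fmap F (u^R) z)) ?linear0 // -as_struct_nat sz0 linear0.
Qed.

Lemma iso_top V W G (p : {linear forget W -> G}) (u : {linear V -> W}) :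
  bijective u -> is_top p -> is_top (lcomp p (u^R)).
Proof.
move=> /isomorphic_inv[v [uK vK]] [[p_struct ker_p] p_epi].
split; last by move=> g; have [w <-] := p_epi g; exists (v w); rewrite /= [u^R _]vK.
split=> [x|x /ker_p[y yE]]; first by rewrite /= as_struct_nat p_struct.
exists (fmap F (v^R) y); rewrite -as_struct_nat yE; exact: uK.
Qed.

Lemma top_unique V G G' (p : {linear forget V -> G}) (p' : {linear forget V -> G'}) :
  is_top p -> is_top p' -> isomorphic G G'.
Proof.
move=> [[p_struct ker_p] p_epi] [[p'_struct ker_p'] p'_epi].
apply: (epi_unique p_epi p'_epi) => x.
by split=> [/ker_p[y <-]|/ker_p'[y <-]]; [apply: p'_struct | apply: p_struct].
Qed.


Lemma fun_pow_mono A P G (i : {linear A -> P}) (q : {linear P -> G}) :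
  short_exact i q -> (forall k, derived1_vanishes F (Fk k G)) ->
  forall k, mono (fmap (Fk k) i).
Proof.
move=> iq G_der k; elim: k => [|k IHk] in A P G i q iq G_der *.
  by case: iq.
apply: (IHk _ _ (F G) (fmap F i) (fmap F q)) => [|j]; last exact: (G_der j.+1).
have [i_mono im_ker q_epi] := iq.
have [im_ker' q_epi'] := F_rex (conj im_ker q_epi).
split=> //; exact: derived1_vanishes_mono F_rex (G_der 0) iq.
Qed.

Variable X : lmodType R -> Prop.
Hypothesis X_proj : forall P, projective P -> X P.

Definition ind_class V : Prop := exists2 A, X A & isomorphic V (Ind A).

Definition as_compatible : Prop :=
  forall Q : complex T, complete_proj_resolution ind_class Q ->
    (forall i, exact_at (fmap F (cdiff Q i)^R) (fmap F (cdiff Q (i + 1))^R)) /\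
    (forall A, X A -> hom_to_exact Q (Ind (F A))).

Definition as_admissible : Prop :=
  forall G A k, Gorenstein_projective X G -> X A ->
    Ext1_vanishes G (Fk k A) /\ derived1_vanishes F (Fk k G).

(** The syzygies Z of Q have injective structure maps because F Z -> F Q and the
    structure map of the projective Q are injective. *)
Lemma Gorenstein_projective_ind_top : as_compatible -> forall V,
  Gorenstein_projective ind_class V ->
  mono (struct V) /\ Gorenstein_projective X (coker (struct V)).
Proof.
move=> compat V [Q Q_res V_iso0]; have [FQ_ex XQ] := compat Q Q_res.
have [Q_proj exQ QW] := Q_res.
have V_iso := isomorphic_trans V_iso0 (image_kernel_iso exQ).
pose Z i := kernel (cdiff Q i); pose k i : {linear Z i -> Q i} := ker_incl (cdiff Q i).
have Fk_mono : forall i, mono (fmap F (k i)^R).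
  apply: int_succ_ind; apply: int_succ_ind => i z kz0.
  have [g [gE [k'_mono [gk0 ker_g] g_epi]]] := complex_slice exQ (i + 1).
  have g_epi' : epi (g^R) := g_epi.
  have [w wz] := right_exact_epi F_rex g_epi' z.
  have [|x xw] := iffLR (FQ_ex i w).
    rewrite -(fmap_tri F (g := (k (i + 1 + 1))^R) (f := g^R)) ?wz ?kz0 //.
  rewrite -wz -xw (fmap_null F) // => y.
  apply: (proj1 (ker_incl_left_ex (cdiff Q (i + 1 + 1)))); rewrite [LHS]gE.
  by have [dd0 _] := iffLR (im_is_kerP _ _) (exQ i); apply: dd0.
have struct_mono i : mono (struct (Z i)).
  move=> z sz0; apply: (Fk_mono i); apply: (projective_struct_mono (Q_proj i)).
  by rewrite -as_struct_nat sz0 linear0.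
have top i : is_top (coker_map (struct (Z i))) := coker_map_right_ex _.
have step i : proj_step X (coker (struct (Z i))) (coker (struct (Z (i + 1)))).
  move: i; apply: int_succ_ind => i.
  have [g0 [_ kg0_ex]] := complex_slice exQ i.
  have [g [_ kg_ex]] := complex_slice exQ (i + 1).
  apply: (proj_step_top kg0_ex kg_ex _ _ (@struct_mono _) (top _) (top _)) => //.
    by move=> A XA; apply: hom_to_exact_extends exQ (XQ A XA) i.
  move=> A XA; apply: hom_to_exact_extends exQ (QW _ _) (i + 1).
  by exists A; rewrite //; apply: isomorphic_refl.
split; first exact: iso_mono_struct V_iso (@struct_mono 0).
apply: (proj_chain_Gorenstein step (i := 0)).
have [u u_bij] := V_iso.
exact: top_unique (coker_map_right_ex _) (iso_top u_bij (top 0)).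
Qed.

(** Coinduction on the class K of the modules with injective structure map and
    Gorenstein projective top. *)
Lemma Gorenstein_projective_of_top : as_admissible -> forall V,
  mono (struct V) -> Gorenstein_projective X (coker (struct V)) ->
  Gorenstein_projective ind_class V.
Proof.
move=> adm V V_mono V_GP.
pose K V := mono (struct V) /\ exists G (p : {linear forget V -> G}),
  is_top p /\ Gorenstein_projective X G.
have Fi_mono G' P G (i : {linear G' -> P}) (q : {linear P -> G}) :
    projective P -> Gorenstein_projective X G -> short_exact i q ->
    forall k, mono (fmap (Fk k) i).
  move=> P_proj G_GP iq; apply: fun_pow_mono iq _ => k.
  by case: (adm G P k G_GP (X_proj P_proj)).
have ext W G' P G (p : {linear forget W -> G'}) (i : {linear G' -> P})
    (q : {linear P -> G}) (f : {linear W -> Ind P}) :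
    is_top p -> short_exact i q -> Gorenstein_projective X G ->
    (forall x, eps P (f x) = i (p x)) -> forall Y, ind_class Y -> extends f Y.
  move=> p_top iq G_GP fE Y [A XA /isomorphic_sym A_iso].
  apply: extends_iso A_iso _; apply: (extends_ind p_top fE (@F_nil A)) => k.
  exact: Ext1_vanishes_extends (proj1 (adm G A k G_GP XA)) iq.
apply: (@Gorenstein_projective_coind _ ind_class K); last first.
- by split=> //; exists (coker (struct V)), (coker_map (struct V)); split=> //;
    apply: coker_map_right_ex.
- move=> W [W_mono [G [p [p_top G_GP]]]].
  have [_ [G' G'_GP [P [i [q [P_proj iq _]]]]]] := Gorenstein_projective_steps G_GP.
  have [W' [f [h [fh W'_mono [p' [p'_top fE]]]]]] :=
    previous_syzygy W_mono p_top P_proj iq (Fi_mono _ _ _ _ _ P_proj G_GP iq).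
  exists W'; first by split=> //; exists G', p'.
  exists (Ind P), f, h; split=> //; first exact: ind_projective.
  exact: ext p'_top iq G_GP fE.
- move=> W [W_mono [G [p [p_top G_GP]]]].
  have [[G' G'_GP [P [i [q [P_proj iq _]]]]] _] := Gorenstein_projective_steps G_GP.
  have [|f fE] := @lift_to_ind W G P p i p_top.
    move=> k; have [im_ker p_epi] := p_top.
    apply: (Ext1_vanishes_extends (q := p) (proj1 (adm G P k.+1 G_GP (X_proj P_proj)))).
    by split.
  have [W' [h [fh W'_mono [p' p'_top]]]] :=
    next_syzygy p_top iq (Fi_mono _ _ _ _ _ P_proj G'_GP iq) fE.
  exists W'; first by split=> //; exists G', p'.
  exists (Ind P), f, h; split=> //; first exact: ind_projective.
  exact: ext p_top iq G'_GP fE.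
Qed.

End ProjectiveSide.

(** * Gorenstein injective coalgebras over a nilpotent functor *)

(** The dual of algebra_setting: T-modules are the pairs (Y, v : Y -> H Y) for a
    nilpotent left exact functor H, and Coind A = A + H (Coind A) is cofree. *)
Record coalgebra_setting (R T : nzRingType) (phi : {rmorphism R -> T}) :=
  CoalgebraSetting {
  cs_fun : functor R;
  cs_bound : nat;
  cs_left_exact : left_exact cs_fun;
  cs_nilpotent : nilpotent_functor cs_fun cs_bound;
  cs_struct : forall V : lmodType T, {linear res phi V -> cs_fun (res phi V)};
  cs_struct_nat : forall (V W : lmodType T) (f : {linear V -> W}) x,
    cs_struct W (res_map phi f x) = fmap cs_fun (res_map phi f) (cs_struct V x);
  cs_linear : forall (V W : lmodType T) (f : {linear res phi V -> res phi W}),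
    (forall x, cs_struct W (f x) = fmap cs_fun f (cs_struct V x)) ->
    exists g : {linear V -> W}, forall v, g v = f v;
  cs_stalk : lmodType R -> lmodType T;
  cs_stalk_val : forall A : lmodType R, {linear A -> res phi (cs_stalk A)};
  cs_stalk_mono : forall A, mono (cs_stalk_val A);
  cs_stalk_epi : forall A, epi (cs_stalk_val A);
  cs_stalk_struct : forall A a, cs_struct (cs_stalk A) (cs_stalk_val A a) = 0;
  cs_coind : lmodType R -> lmodType T;
  cs_ev : forall A : lmodType R, {linear res phi (cs_coind A) -> A};
  cs_const : forall A : lmodType R, {linear A -> res phi (cs_coind A)};
  cs_sect : forall A : lmodType R,
    {linear cs_fun (res phi (cs_coind A)) -> res phi (cs_coind A)};
  cs_ev_const : forall A a, cs_ev A (cs_const A a) = a;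
  cs_struct_const : forall A a, cs_struct (cs_coind A) (cs_const A a) = 0;
  cs_struct_sect : forall A y, cs_struct (cs_coind A) (cs_sect A y) = y;
  cs_split : forall A x,
    cs_const A (cs_ev A x) + cs_sect A (cs_struct (cs_coind A) x) = x;
  cs_lift : forall (A : lmodType R) (V : lmodType T) (f : {linear res phi V -> A}),
    exists g : {linear V -> cs_coind A}, forall v, cs_ev A (g v) = f v
}.

Section InjectiveSide.
Variables (R T : nzRingType) (phi : {rmorphism R -> T}) (C : coalgebra_setting phi).
Notation H := (cs_fun C).
Notation n := (cs_bound C).
Notation Hk k := (fun_pow H k).
Notation forget V := (res phi V).
Notation struct V := (cs_struct C V).
Notation stalk A := (cs_stalk C A).
Notation val A := (cs_stalk_val C A).
Notation Coind A := (cs_coind C A).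
Notation ev A := (cs_ev C A).
Notation delta A := (cs_const C A).
Notation sect A := (cs_sect C A).
Notation "f ^R" := (res_map phi f) (at level 2, format "f ^R").
Implicit Types (V W : lmodType T) (A B D G E : lmodType R).

Let H_lex : left_exact H := @cs_left_exact _ _ _ C.
Let Hk_lex k : left_exact (Hk k) := fun_pow_left_exact k H_lex.
Let H_nil : nilpotent_functor H n := @cs_nilpotent _ _ _ C.

Definition is_socle V G (k : {linear G -> forget V}) : Prop := left_ex k (struct V).

(** Dual to nakayama, with the embedding of V into W + H V. *)
Lemma conakayama V W (h : {linear V -> W}) :
  (forall v, h v = 0 -> struct V v = 0 -> v = 0) -> mono (h^R).
Proof.
move=> hV; pose c := lpair (h^R) (struct V).
have c_mono : mono c.
  by move=> v; rewrite lpairE => -[hv0 sv0]; apply: hV.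
suff: forall k, (k <= n)%N -> mono (fmap (Hk k) (h^R)) by move/(_ 0 isT).
apply: descent => [v _|k IHk v hv0]; first exact: H_nil.
apply: (left_exact_mono (@Hk_lex k) c_mono).
rewrite fmap_add !fmap_comp hv0 linear0 add0r.
rewrite (_ : fmap (Hk k) (struct V) v = 0) ?linear0 //.
apply: IHk; rewrite fun_pow_succ.
rewrite (fmap_sq (Hk k) (g' := struct W) (f' := h^R)) ?hv0 ?linear0 //.
by move=> x; rewrite cs_struct_nat.
Qed.

(** An element y of H^k V is corrected by an element of the image of H^k f so
    that the structure map kills it, which puts it into the socle. *)
Lemma epi_over_socle V G E (s : {linear G -> forget V}) (q : {linear E -> G})
    (f : {linear Coind E -> V}) :
  is_socle s -> (forall e, f (delta E e) = s (q e)) ->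
  (forall k, epi (fmap (Hk k) q)) -> forall k, epi (fmap (Hk k) (f^R)).
Proof.
move=> s_soc fE q_epi k0.
suff: forall k, (k <= k0 + n)%N -> epi (fmap (Hk k) (f^R)).
  by apply; apply: leq_addr.
apply: descent => [y|k IHk y].
  by exists 0; rewrite linear0 [y](nilpotent_functor_add (m := k0) H_nil).
have [_ [_ ker_struct]] := Hk_lex k s_soc.
have [w wE] := IHk (fmap (Hk k) (struct V) y).
pose w' := fmap (Hk k) (sect E) w.
have [|g gE] := ker_struct (y - fmap (Hk k) (f^R) w').
  rewrite linearB -wE fun_pow_succ.
  rewrite (fmap_sq (Hk k) (g' := fmap H (f^R)) (f' := struct (Coind E))); last first.
    exact: cs_struct_nat.
  by rewrite (fmap_cancel (Hk k) (@cs_struct_sect _ _ _ C E)) subrr.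
have [e eE] := q_epi k g.
exists (fmap (Hk k) (delta E) e + w'); rewrite linearD.
rewrite (fmap_sq (Hk k) (g' := s) (f' := q)); last exact: fE.
by rewrite eE gE subrK.
Qed.

Lemma coind_lift_const A B (b : {linear A -> B}) (g : {linear Coind A -> Coind B}) :
  (forall x, ev B (g x) = b (ev A x)) -> forall a, g (delta A a) = delta B (b a).
Proof.
move=> gE a; rewrite -[LHS](@cs_split _ _ _ C B) gE cs_ev_const.
by rewrite -[g _]/(g^R _) cs_struct_nat cs_struct_const !linear0 addr0.
Qed.

(** Dual to ind_radical: the cokernel of A -> Coind A is again coinduced. For
    the surjectivity, an element of Coind (H A) is determined by its value a in
    H A and its image under the structure map; w1 in H (Coind A) matches both. *)
Lemma coind_quotient A :
  exists kappa : {linear Coind A -> Coind (H A)}, right_ex (delta A) (kappa^R).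
Proof.
have [kappa kE] := cs_lift C (lcomp (fmap H (ev A)) (struct (Coind A))).
have kS x : struct _ (kappa^R x) = fmap H (kappa^R) (struct _ x) := cs_struct_nat C kappa x.
have kd0 a : kappa^R (delta A a) = 0.
  rewrite -[LHS](@cs_split _ _ _ C (H A)) [ev _ _]kE kS /= cs_struct_const.
  by rewrite !linear0 addr0.
have ekE k (y : Hk k (forget (Coind A))) : fmap (Hk k) (ev (H A)) (fmap (Hk k) (kappa^R) y) =
    fmap (Hk k.+1) (ev A) (fmap (Hk k) (struct (Coind A)) y).
  by rewrite fun_pow_succ; apply: fmap_sq => x; apply: kE.
have skE k (y : Hk k (forget (Coind A))) :
    fmap (Hk k) (struct _) (fmap (Hk k) (kappa^R) y) =
    fmap (Hk k.+1) (kappa^R) (fmap (Hk k) (struct (Coind A)) y).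
  by rewrite fun_pow_succ; apply: fmap_sq => x; apply: kS.
exists kappa; split; first split=> // y ky0.
- have inj k : (k <= n)%N -> forall y : Hk k (forget (Coind A)),
      fmap (Hk k) (kappa^R) y = 0 -> fmap (Hk k) (ev A) y = 0 -> y = 0.
    move: k; apply: descent => [z _ _|k IHk z kz0 ez0]; first exact: H_nil.
    rewrite -[z](fmap_split (Hk k) (@cs_split _ _ _ C A)) ez0 linear0 add0r.
    rewrite (IHk (fmap (Hk k) (struct (Coind A)) z)) ?linear0 //.
      by rewrite -skE kz0 linear0.
    by rewrite -ekE kz0 linear0.
  exists (ev A y); apply/esym/subr0_eq; apply: (inj 0) => //.
    by rewrite [LHS](linearB (kappa^R)) ky0 kd0 subr0.
  by rewrite [LHS](linearB (ev A)) cs_ev_const subrr.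
- suff: forall k, (k <= n)%N -> epi (fmap (Hk k) (kappa^R)) by move/(_ 0 isT).
  apply: descent => [z|k IHk z]; first by exists 0; rewrite linear0 [z]H_nil.
  have [w wE] := IHk (fmap (Hk k) (struct _) z).
  pose a := fmap (Hk k) (ev _) z : Hk k.+1 A.
  pose w1 := w + fmap (Hk k.+1) (delta A) (a - fmap (Hk k.+1) (ev A) w).
  have w1_ev : fmap (Hk k.+1) (ev A) w1 = a.
    rewrite linearD (fmap_cancel (Hk k.+1) (@cs_ev_const _ _ _ C A)).
    by rewrite addrC subrK.
  have w1_kappa : fmap (Hk k.+1) (kappa^R) w1 = fmap (Hk k) (struct _) z.
    by rewrite linearD (fmap_null (Hk k.+1) kd0) addr0.
  exists (fmap (Hk k) (sect A) w1).
  rewrite -[LHS](fmap_split (Hk k) (@cs_split _ _ _ C (H A))) ekE skE.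
  rewrite (fmap_cancel (Hk k) (@cs_struct_sect _ _ _ C A)) w1_ev w1_kappa.
  exact: fmap_split (@cs_split _ _ _ C (H A)) z.
Qed.

Lemma coind_zero A : (forall a : A, a = 0) -> forall x : Coind A, x = 0.
Proof.
move=> A0 x; apply: (@conakayama (Coind A) (Coind A) (lzero _ _)) => // v _ sv0.
by rewrite -[LHS](@cs_split _ _ _ C A) sv0 (A0 (ev A v)) !linear0 addr0.
Qed.

(** Dual to lift_to_ind_step: f0 is the sum of the components so far, and the
    next one is the composite of iota : Coind A -> B and fm : B -> V. *)
Lemma lift_from_coind_step m V A B (iota : {linear forget (Coind A) -> B})
    (fm : {linear B -> forget V}) (f0 : {linear forget (Coind A) -> forget V}) :
  (forall x : Hk m B, x = 0) -> (forall k, lifts (struct V) (Hk k.+1 B)) ->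
  (forall x, struct V (f0 x + fm (iota x)) =
             fmap H f0 (struct (Coind A) x)) ->
  exists f : {linear Coind A -> V},
    forall a, f (delta A a) = f0 (delta A a) + fm (iota (delta A a)).
Proof.
elim: m B iota fm f0 => [|m IHm] B iota fm f0 B_nil B_lift f0E.
  have i0 x : iota x = 0 := B_nil _.
  have [|f fE] := @cs_linear _ _ _ C (Coind A) V f0.
    by move=> x; rewrite -f0E i0 linear0 addr0.
  by exists f => x; rewrite fE i0 linear0 addr0.
have [fm' fm'E] := B_lift 0 (fmap H fm).
pose f1 := ladd f0 (lcomp fm iota).
have [|k|x|f fE] := IHm (H B) (lcomp (fmap H iota) (struct (Coind A))) fm' f1.
- exact: B_nil.
- exact: (B_lift k.+1).
- by rewrite linearD fm'E /f1 fmap_add fmap_comp /= f0E.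
- by exists f => a; rewrite fE /= cs_struct_const !linear0 addr0.
Qed.

Lemma lift_from_coind V G A (s : {linear G -> forget V}) (g : {linear A -> G}) :
  is_socle s -> (forall k, lifts (struct V) (Hk k.+1 A)) ->
  exists f : {linear Coind A -> V}, forall a, f (delta A a) = s (g a).
Proof.
move=> [_ [struct_s _]] A_lift.
have [|//||f fE] := @lift_from_coind_step n V A A (ev A) (lcomp s g) (lzero _ _).
- exact: H_nil.
- by move=> x; rewrite /= add0r struct_s (fmap_zero H).
by exists f => x; rewrite fE /= add0r cs_ev_const.
Qed.

(** Dual to extends_ind: lift the restriction of h to the socle first; the
    difference factors through Coind (H A). *)
Lemma lifts_coind V G E (s : {linear G -> forget V}) (q : {linear E -> G})
    (f : {linear Coind E -> V}) m A :
  is_socle s -> (forall e, f (delta E e) = s (q e)) ->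
  (forall x : Hk m A, x = 0) -> (forall k, lifts q (Hk k A)) ->
  lifts f (Coind A).
Proof.
move=> [s_mono [struct_s ker_struct]] fE; elim: m A => [|m IHm] A A_nil A_lift h.
  exists (lzero _ _) => x; rewrite (coind_zero A_nil x) !linear0 //.
have [|b bE] := @factor_mono _ _ _ _ s (lcomp (h^R) (delta A)) s_mono.
  by move=> a; apply: ker_struct; rewrite /= cs_struct_nat cs_struct_const linear0.
have [b' b'E] := A_lift 0 b.
have [g0 g0E] := cs_lift C (lcomp b' (ev A)).
have [kappa [[kappa0 ker_kappa] kappa_epi]] := coind_quotient A.
have [|h1 h1E] := @factor_epi _ _ _ _ kappa (lsub h (lcomp f g0)) kappa_epi.
  move=> x /ker_kappa[a <-]; rewrite /= (coind_lift_const g0E) fE b'E bE.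
  exact: subrr.
have [h2 h2E] := IHm (H A) A_nil (fun k => A_lift k.+1) h1.
exists (ladd (lcomp h2 kappa) g0) => x.
by rewrite /= linearD h2E h1E /= subrK.
Qed.

Lemma coind_hom_zero A W (d : {linear W -> Coind A}) :
  (forall w, ev A (d w) = 0) -> forall x, d x = 0.
Proof.
move=> d_ev; suff d0 : forall k, (k <= n)%N -> forall x, fmap (Hk k) (d^R) x = 0.
  by move=> x; apply: (d0 0).
apply: descent => [x|k IHk x]; first exact: H_nil.
rewrite -[LHS](fmap_split (Hk k) (@cs_split _ _ _ C A)).
rewrite (fmap_null (Hk k) (g := ev A) (f := d^R) d_ev) linear0 add0r.
rewrite (fmap_sq (Hk k) (g' := fmap H (d^R)) (f' := struct W)).
  by rewrite -fun_pow_succ IHk linear0.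
exact: cs_struct_nat.
Qed.

Lemma coind_injective E : injective_module E -> injective_module (Coind E).
Proof.
move=> E_inj V W g f g_inj.
have [h hE] := E_inj _ _ (g^R) (lcomp (ev E) (f^R)) g_inj.
have [h' h'E] := cs_lift C h; exists h' => x; apply/subr0_eq.
apply: (@coind_hom_zero _ _ (lsub (lcomp h' g) f)) => w.
by rewrite linearB /= h'E [h _]hE subrr.
Qed.

(** Dual to next_syzygy. A preimage of y in H V' is found by applying the section
    to the image of y in H (Coind E) and correcting the result by a constant, so
    that f kills it. *)
Lemma previous_cosyzygy V G E G' (s : {linear G -> forget V}) (i : {linear G' -> E})
    (q : {linear E -> G}) (f : {linear Coind E -> V}) :
  is_socle s -> short_exact i q -> (forall k, epi (fmap (Hk k) q)) ->
  (forall e, f (delta E e) = s (q e)) ->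
  exists V' (h : {linear V' -> Coind E}),
    [/\ short_exact h f, epi (struct V') &
        exists s' : {linear G' -> forget V'}, is_socle s'].
Proof.
move=> s_soc [i_mono [qi0 ker_q] q_epi] Hq_epi fE.
have [s_mono [struct_s ker_struct]] := s_soc.
have f_epi : epi f := epi_over_socle s_soc fE Hq_epi (k := 0%N).
have [h_mono [fh0 ker_f]] := ker_incl_left_ex f.
exists (kernel f), (ker_incl f); move: (ker_incl f) h_mono fh0 ker_f => h h_mono fh0 ker_f.
have [Hh_mono [Hfh0 _]] : left_ex (fmap H (h^R)) (fmap H (f^R)) by exact: H_lex.
split=> //.
- move=> y; pose x := sect E (fmap H (h^R) y).
  have sx : struct _ x = fmap H (h^R) y by apply: cs_struct_sect.
  have [|g gE] := ker_struct (f^R x).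
    by rewrite cs_struct_nat sx Hfh0.
  have [e eE] := q_epi g.
  have [|v vE] := ker_f (x - delta E e).
    by rewrite [LHS](linearB (f^R)) [f^R (delta E e)]fE eE gE subrr.
  exists v; apply: (iffLR (mono_injective _) Hh_mono).
  by rewrite -cs_struct_nat [h^R v]vE linearB cs_struct_const sx subr0.
- have [|s' s'E] := @factor_mono _ _ _ _ (h^R) (lcomp (delta E) i) h_mono.
    by move=> g; apply: ker_f; rewrite /= fE qi0 linear0.
  exists s'; split.
    move=> g sg0; apply: i_mono; rewrite -[LHS](@cs_ev_const _ _ _ C E).
    by rewrite -[delta E _]s'E sg0 !linear0.
  split=> [g|v sv0].
    by apply: Hh_mono; rewrite -cs_struct_nat s'E /= cs_struct_const.
  have hv : delta E (ev E (h^R v)) = h^R v.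
    rewrite -[RHS](@cs_split _ _ _ C E) cs_struct_nat sv0.
    by rewrite !linear0 addr0.
  have [|g gE] := ker_q (ev E (h^R v)).
    by apply: s_mono; rewrite -fE hv; apply: fh0.
  exists g; apply: (iffLR (mono_injective (h^R)) h_mono).
  by rewrite s'E /= gE hv.
Qed.

(** Dual to previous_syzygy: G -> E extends to V -> E, which induces an
    embedding of V into Coind E. *)
Lemma next_cosyzygy V G E G' (s : {linear G -> forget V}) (i : {linear G -> E})
    (q : {linear E -> G'}) :
  epi (struct V) -> is_socle s -> injective_module E -> short_exact i q ->
  (forall k, epi (fmap (Hk k) q)) ->
  exists V' (h : {linear V -> Coind E}) (f : {linear Coind E -> V'}),
    [/\ short_exact h f, epi (struct V') &
        exists s' : {linear G' -> forget V'},
          is_socle s' /\ forall e, f (delta E e) = s' (q e)].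
Proof.
move=> struct_epi [s_mono [struct_s ker_struct]] E_inj iq Hq_epi.
have [i_mono [qi0 ker_q] q_epi] := iq.
have [l lE] := E_inj _ _ s i (iffLR (mono_injective s) s_mono).
have [h hE] := cs_lift C l.
have hs g : h^R (s g) = delta E (i g).
  rewrite -[LHS](@cs_split _ _ _ C E) [ev E _]hE lE cs_struct_nat struct_s.
  by rewrite !linear0 addr0.
have h_mono : mono (h^R).
  apply: conakayama => v hv0 /ker_struct[g gE].
  suff -> : v = s g.
    rewrite (_ : g = 0) ?linear0 //; apply: i_mono.
    by rewrite -[LHS](@cs_ev_const _ _ _ C E) -hs gE [h^R v]hv0 linear0.
  by rewrite gE.
have [[fh0 ker_f] f_epi] := coker_map_right_ex h.
exists (coker h), h, (coker_map h); move: (coker_map h) fh0 ker_f f_epi => f fh0 ker_f f_epi.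
have [Hh_mono [Hfh0 ker_Hf]] : left_ex (fmap H (h^R)) (fmap H (f^R)) by exact: H_lex.
have [|s' s'E] := @factor_epi _ _ _ _ q (lcomp (f^R) (delta E)) q_epi.
  by move=> e /ker_q[g <-]; rewrite /= -hs; apply: fh0.
have s'_soc : is_socle s'.
  split; last split.
  - move=> g' sg0; have [e eE] := q_epi g'; move: sg0; rewrite -eE s'E => /ker_f[v vE].
    have [|g gE] := ker_struct v.
      by apply: Hh_mono; rewrite -cs_struct_nat [h^R v]vE cs_struct_const.
    have -> : e = i g; last exact: qi0.
    apply: (can_inj (@cs_ev_const _ _ _ C E)).
    by rewrite -hs gE; apply/esym.
  - move=> g'; have [e <-] := q_epi g'.
    by rewrite s'E /= cs_struct_nat cs_struct_const linear0.
  - move=> v' sv0; have [x xE] := f_epi v'.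
    have [|w wE] := ker_Hf (struct _ x).
      by rewrite -cs_struct_nat [f^R x]xE.
    have [v vE] := struct_epi w.
    exists (q (ev E (x - h v))); rewrite s'E /=.
    have -> : delta E (ev E (x - h v)) = x - h v.
      rewrite -[RHS](@cs_split _ _ _ C E).
      rewrite (_ : struct _ (x - h v) = 0) ?linear0 ?addr0 //.
      rewrite [LHS](linearB (struct (Coind E))) [struct _ (h v)](cs_struct_nat C h v) vE wE.
      exact: subrr.
    by rewrite [LHS](linearB (f^R)) [f^R (h v)]fh0 subr0.
split=> //; last by exists s'; split=> // e; rewrite s'E.
move=> y; have [w wE] := epi_over_socle s'_soc (fun e => esym (s'E e)) Hq_epi (k := 1) y.
exists (f^R (sect E w)); rewrite cs_struct_nat cs_struct_sect; exact: wE.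
Qed.

Lemma costalk_hom V A (f : {linear A -> forget V}) :
  (forall a, struct V (f a) = 0) ->
  exists g : {linear stalk A -> V}, forall a, g (val A a) = f a.
Proof.
move=> f_struct; have val_epi := @cs_stalk_epi _ _ _ C A.
have [|f' f'E] := factor_epi (t := f) val_epi.
  by move=> a /cs_stalk_mono ->; rewrite linear0.
have [|g gE] := @cs_linear _ _ _ C (stalk A) V f'.
  move=> x; have [a <-] := val_epi x.
  by rewrite f'E f_struct cs_stalk_struct linear0.
by exists g => a; rewrite gE f'E.
Qed.

Lemma costalk_struct V A (g : {linear stalk A -> V}) a :
  struct V (g (val A a)) = 0.
Proof. by rewrite -[g _]/(g^R _) cs_struct_nat cs_stalk_struct linear0. Qed.

(** The socle is right adjoint to the stalk functor, which is exact. *)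
Lemma injective_socle V G (s : {linear G -> forget V}) :
  injective_module V -> is_socle s -> injective_module G.
Proof.
move=> V_inj [s_mono [struct_s ker_struct]] A B g f g_inj.
have [|g' g'E] := costalk_hom (V := stalk B) (f := lcomp (val B) g).
  by move=> a; apply: cs_stalk_struct.
have [|f' f'E] := costalk_hom (f := lcomp s f).
  by move=> a; apply: struct_s.
have [|h hE] := V_inj _ _ g' f'.
  apply/mono_injective => x; have [a <-] := @cs_stalk_epi _ _ _ C A x.
  rewrite g'E => /cs_stalk_mono ga0.
  by rewrite (iffRL (mono_injective g) g_inj a ga0) linear0.
have [|k kE] := factor_mono (t := lcomp (h^R) (val B)) s_mono.
  by move=> b; apply: ker_struct; apply: costalk_struct.
exists k => a; apply: (iffLR (mono_injective _) s_mono).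
by rewrite kE -[RHS]f'E -hE g'E.
Qed.

(** An injective V is a direct summand of Coind V. *)
Lemma injective_struct_epi V : injective_module V -> epi (struct V).
Proof.
move=> V_inj; have [g gE] := cs_lift C (lid (forget V)).
have [|r rE] := V_inj _ _ g (lid V).
  by apply/mono_injective => v gv0; rewrite -[LHS]gE gv0 linear0.
move=> z; exists (r^R (sect _ (fmap H (g^R) z))).
rewrite cs_struct_nat cs_struct_sect.
exact: (fmap_cancel H (f := g^R) (g := r^R) rE z).
Qed.

(** Dual to proj_step_top: a map from A to the socle of V is extended to
    Coind A -> V first, by means of the next step of the resolution and the
    quotient Coind (H A) of Coind A, and then lifted to Q. *)
Lemma inj_step_socle (Y : lmodType R -> Prop) (V0 Q0 V Q V' : lmodType T) G G'
    (h0 : {linear V -> Q0}) (f0 : {linear Q0 -> V0})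
    (h : {linear V' -> Q}) (f : {linear Q -> V})
    (s : {linear G -> forget V}) (s' : {linear G' -> forget V'}) :
  short_exact h0 f0 -> short_exact h f -> injective_module Q0 -> injective_module Q ->
  epi (struct V') -> is_socle s -> is_socle s' ->
  (forall A, Y A -> lifts f0 (Coind (H A))) ->
  (forall A, Y A -> lifts f (Coind A)) ->
  inj_step Y G' G.
Proof.
move=> [h0_mono [f0h0 ker_f0] f0_epi] [h_mono [fh0 ker_f] f_epi] Q0_inj Q_inj.
move=> struct_epi [s_mono [struct_s ker_s]] [s'_mono [struct_s' ker_s']] Y0 Y1.
have sQ_soc : is_socle (ker_incl (struct Q)) := ker_incl_left_ex (struct Q).
move: (ker_incl _) sQ_soc => sQ sQ_soc; have KQ_inj := injective_socle Q_inj sQ_soc.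
have [sQ_mono [struct_sQ ker_sQ]] := sQ_soc.
have [|i iE] := @factor_mono _ _ _ _ sQ (lcomp (h^R) s') sQ_mono.
  by move=> g; apply: ker_sQ; rewrite /= cs_struct_nat struct_s' linear0.
have [|q qE] := @factor_mono _ _ _ _ s (lcomp (f^R) sQ) s_mono.
  by move=> x; apply: ker_s; rewrite /= cs_struct_nat struct_sQ linear0.
have [Hh_mono [_ ker_Hf]] : left_ex (fmap H (h^R)) (fmap H (f^R)) by exact: H_lex.
exists (kernel (struct Q)), i, q; split=> //; first split; first 1 last.
- split=> [g|y qy0].
    by apply: s_mono; rewrite qE /= iE; apply: fh0.
  have [|v vE] := ker_f (sQ y).
    by rewrite -[f _]/(lcomp (f^R) sQ y) -qE qy0 linear0.
  have [|g gE] := ker_s' v.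
    by apply: Hh_mono; rewrite -cs_struct_nat [h^R v]vE struct_sQ.
  exists g; apply: (iffLR (mono_injective _) sQ_mono).
  by rewrite iE /= gE; apply: vE.
- move=> g; have [w wE] := f_epi (s g).
  have [|y yE] := ker_Hf (struct Q w).
    by rewrite -cs_struct_nat [f^R w]wE struct_s.
  have [v vE] := struct_epi y.
  have [|x xE] := ker_sQ (w - h v).
    rewrite [LHS](linearB (struct Q)) [struct _ (h v)](cs_struct_nat C h v) vE yE.
    exact: subrr.
  exists x; apply: (iffLR (mono_injective _) s_mono).
  by rewrite qE /= xE [LHS](linearB (f^R)) [f^R (h v)]fh0 subr0.
- move=> A YA b.
  have [|e0 e0E] := costalk_hom (V := Coind A) (f := delta A).
    exact: cs_struct_const.
  have [|bV bVE] := costalk_hom (f := lcomp s b).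
    by move=> a; apply: struct_s.
  have e0_mono : injective e0.
    apply/mono_injective => x; have [a <-] := @cs_stalk_epi _ _ _ C A x.
    rewrite e0E => da0; rewrite (_ : a = 0) ?linear0 //.
    by rewrite -[LHS](@cs_ev_const _ _ _ C A) da0 linear0.
  have [e eE] := Q0_inj _ _ e0 (lcomp h0 bV) e0_mono.
  have e_delta a : e (delta A a) = h0 (s (b a)) by rewrite -e0E eE /= bVE.
  have [kappa [[kappa0 ker_kappa] kappa_epi]] := coind_quotient A.
  have [|d dE] := @factor_epi _ _ _ _ kappa (lcomp f0 e) kappa_epi.
    by move=> x /ker_kappa[a <-]; rewrite /= e_delta f0h0.
  have [d' d'E] := Y0 A YA d.
  have [|e' e'E] := @factor_mono _ _ _ _ h0 (lsub e (lcomp d' kappa)) h0_mono.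
    by move=> x; apply: ker_f0; rewrite /= linearB d'E dE /= subrr.
  have e'_delta a : e' (delta A a) = s (b a).
    apply: (iffLR (mono_injective h0) h0_mono); rewrite e'E /= e_delta.
    by rewrite [kappa _]kappa0 linear0 subr0.
  have [e'' e''E] := Y1 A YA e'.
  have [|b' b'E] := factor_mono (t := lcomp (e''^R) (delta A)) sQ_mono.
    by move=> a; apply: ker_sQ; rewrite /= cs_struct_nat cs_struct_const linear0.
  exists b' => a; apply: (iffLR (mono_injective _) s_mono).
  by rewrite qE /= b'E /= [f^R _]e''E e'_delta.
- move=> g ig0; apply: s'_mono; apply: h_mono.
  by rewrite -[h _]/(lcomp (h^R) s' g) -iE ig0 linear0.
Qed.

Lemma iso_epi_struct V W : isomorphic V W -> epi (struct W) -> epi (struct V).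
Proof.
move=> /isomorphicP[u [v [uK vK]]] W_epi z.
have [w wE] := W_epi (fmap H (u^R) z); exists (v^R w).
rewrite cs_struct_nat wE; exact: (fmap_cancel H (f := u^R) (g := v^R) uK z).
Qed.

Lemma iso_socle V W G (s : {linear G -> forget V}) (u : {linear V -> W}) :
  bijective u -> is_socle s -> is_socle (lcomp (u^R) s).
Proof.
move=> u_bij [s_mono [struct_s ker_s]]; have [v [uK vK]] := isomorphic_inv u_bij.
split; last split.
- by move=> x ux0; apply: s_mono; apply: (can_inj uK); rewrite [LHS]ux0 linear0.
- by move=> x; rewrite /= cs_struct_nat struct_s linear0.
- move=> w sw0; have [|x xE] := ker_s (v^R w); first by rewrite cs_struct_nat sw0 linear0.
  by exists x; rewrite /= xE; apply: vK.
Qed.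

Lemma socle_unique V G G' (s : {linear G -> forget V}) (s' : {linear G' -> forget V}) :
  is_socle s -> is_socle s' -> isomorphic G G'.
Proof.
move=> [s_mono [struct_s ker_s]] [s'_mono [struct_s' ker_s']].
apply: (mono_unique s_mono s'_mono) => x.
by split=> -[y <-]; [apply: ker_s' | apply: ker_s].
Qed.

(** The vanishing of the first right derived functor at G, in the form in
    which the vanishing of Ext^1(M, G) provides it for Hom(M, -). *)
Definition right_derived1_vanishes (L : functor R) G : Prop :=
  forall E D (i : {linear G -> E}) (q : {linear E -> D}),
    short_exact i q -> epi (fmap L q).

Lemma fun_pow_epi G E D (i : {linear G -> E}) (q : {linear E -> D}) :
  short_exact i q -> (forall k, right_derived1_vanishes H (Hk k G)) ->
  forall k, epi (fmap (Hk k) q).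
Proof.
move=> iq G_der k; elim: k => [|k IHk] in G E D i q iq G_der *.
  by case: iq.
apply: (IHk (H G) _ _ (fmap H i) (fmap H q)) => [|j]; last exact: (G_der j.+1).
have [i_mono im_ker q_epi] := iq.
have [i_mono' im_ker'] := H_lex (conj i_mono im_ker).
split=> //; exact: (G_der 0) iq.
Qed.

Variable Y : lmodType R -> Prop.
Hypothesis Y_inj : forall E, injective_module E -> Y E.

Definition coind_class V : Prop := exists2 A, Y A & isomorphic V (Coind A).

Definition cs_cocompatible : Prop :=
  forall I : complex T, complete_inj_resolution coind_class I ->
    (forall i, exact_at (fmap H (cdiff I i)^R) (fmap H (cdiff I (i + 1))^R)) /\
    (forall A, Y A -> hom_from_exact (Coind (H A)) I).

Definition cs_coadmissible : Prop :=
  forall G A k, Gorenstein_injective Y G -> Y A ->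
    Ext1_vanishes (Hk k A) G /\ right_derived1_vanishes H (Hk k G).

(** Dual to Gorenstein_projective_ind_top. *)
Lemma Gorenstein_injective_coind_socle : cs_cocompatible -> forall V,
  Gorenstein_injective coind_class V ->
  epi (struct V) /\ Gorenstein_injective Y (kernel (struct V)).
Proof.
move=> compat V [I I_res V_iso]; have [HI_ex YI] := compat I I_res.
have [I_inj exI IW] := I_res.
pose Z i := kernel (cdiff I i); pose h i : {linear Z i -> I i} := ker_incl (cdiff I i).
have struct_epi : forall i, epi (struct (Z i)).
  apply: int_succ_ind => i y.
  have [g [gE _]] := complex_slice exI i.
  have h_lex : left_ex ((h (i + 1))^R) ((cdiff I (i + 1))^R) := ker_incl_left_ex _.
  have [Hh_mono [Hdh0 _]] := H_lex h_lex.
  have [x xE] := iffLR (HI_ex i _) (Hdh0 y).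
  have [w wE] := injective_struct_epi (I_inj i) x.
  exists (g^R w); rewrite cs_struct_nat wE; apply: (iffLR (mono_injective _) Hh_mono).
  by rewrite -xE; apply: fmap_tri.
have soc i : is_socle (ker_incl (struct (Z i))) := ker_incl_left_ex _.
have step i : inj_step Y (kernel (struct (Z i))) (kernel (struct (Z (i + 1)))).
  have [g [gE hg_ex]] := complex_slice exI i.
  have [g0 [g0E hg0_ex]] := complex_slice exI (i + 1).
  apply: (inj_step_socle hg0_ex hg_ex _ _ (@struct_epi _) (soc _) (soc _)) => //.
    by move=> A YA; apply: (hom_from_exact_lifts exI (YI A YA) g0E).
  move=> A YA; apply: (hom_from_exact_lifts exI (IW _ _) gE).
  by exists A; rewrite //; apply: isomorphic_refl.
split; first exact: iso_epi_struct V_iso (@struct_epi 0).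
apply: (inj_chain_Gorenstein step (i := 0)).
have [u u_bij] := V_iso.
exact: socle_unique (iso_socle u_bij (ker_incl_left_ex _)) (soc 0).
Qed.

(** Dual to Gorenstein_projective_of_top. *)
Lemma Gorenstein_injective_of_socle : cs_coadmissible -> forall V,
  epi (struct V) -> Gorenstein_injective Y (kernel (struct V)) ->
  Gorenstein_injective coind_class V.
Proof.
move=> adm V V_epi V_GI.
pose K V := epi (struct V) /\ exists G (s : {linear G -> forget V}),
  is_socle s /\ Gorenstein_injective Y G.
have Hq_epi G' E G (i : {linear G' -> E}) (q : {linear E -> G}) :
    injective_module E -> Gorenstein_injective Y G' -> short_exact i q ->
    forall k, epi (fmap (Hk k) q).
  move=> E_inj G_GI iq; apply: fun_pow_epi iq _ => k.
  by case: (adm G' E k G_GI (Y_inj E_inj)).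
have lift W G' E G (s : {linear G -> forget W}) (i : {linear G' -> E})
    (q : {linear E -> G}) (f : {linear Coind E -> W}) :
    is_socle s -> short_exact i q -> Gorenstein_injective Y G' ->
    (forall e, f (delta E e) = s (q e)) -> forall U, coind_class U -> lifts f U.
  move=> s_soc iq G_GI fE U [A YA /isomorphic_sym A_iso].
  apply: lifts_iso A_iso _; apply: (lifts_coind s_soc fE (@H_nil A)) => k.
  exact: Ext1_vanishes_lifts (proj1 (adm G' A k G_GI YA)) iq.
apply: (@Gorenstein_injective_coind _ coind_class K); last first.
- by split=> //; exists (kernel (struct V)), (ker_incl (struct V)); split=> //;
    apply: ker_incl_left_ex.
- move=> W [W_epi [G [s [s_soc G_GI]]]].
  have [_ [G' G'_GI [E [i [q [E_inj iq _]]]]]] := Gorenstein_injective_steps G_GI.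
  have [|f fE] := @lift_from_coind W G E s q s_soc.
    move=> k; have [s_mono im_ker] := s_soc.
    apply: (Ext1_vanishes_lifts (i := s) (proj1 (adm G E k.+1 G_GI (Y_inj E_inj)))).
    by split.
  have [W' [h [hf W'_epi [s' s'_soc]]]] :=
    previous_cosyzygy s_soc iq (Hq_epi _ _ _ _ _ E_inj G'_GI iq) fE.
  exists W'; first by split=> //; exists G', s'.
  exists (Coind E), h, f; split=> //; first exact: coind_injective.
  exact: lift s_soc iq G'_GI fE.
- move=> W [W_epi [G [s [s_soc G_GI]]]].
  have [[G' G'_GI [E [i [q [E_inj iq _]]]]] _] := Gorenstein_injective_steps G_GI.
  have [W' [h [f [hf W'_epi [s' [s'_soc fE]]]]]] :=
    next_cosyzygy W_epi s_soc E_inj iq (Hq_epi _ _ _ _ _ E_inj G_GI iq).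
  exists W'; first by split=> //; exists G', s'.
  exists (Coind E), h, f; split=> //; first exact: coind_injective.
  exact: lift s'_soc iq G_GI fE.
Qed.

End InjectiveSide.

(** * The tensor ring as an instance *)

Section Instances.
Variables (R : nzRingType) (M : bimodule R R) (N : nat).
Hypothesis M_nilpotent : nilpotent_bimod M N.
Notation T := (tensor_ring M N).

Definition tensor_setting :
    algebra_setting (tring_of_ring M N : {rmorphism R -> T}) :=
  @AlgebraSetting R T (tring_of_ring M N) (tensor_functor M) N.+1
    (@tensor_right_exact R M) (tensor_functor_nilpotent M_nilpotent)
    (@struct R M N) (@struct_nat R M N) (@tring_linear R M N)
    (@stalk R M N) (@stalk_val R M N)
    (fun A a a0 => a0) (fun A a => ex_intro _ a erefl) (@stalk_val_struct R M N)
    (Ind M N) (@ind_unit R M N) (@ind_top R M N)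
    (fun A => @ind_retr R M N A M_nilpotent)
    (@ind_top_unit R M N) (@ind_top_struct R M N)
    (fun A => @ind_retr_struct R M N A M_nilpotent)
    (fun A => @ind_split R M N A M_nilpotent) (@ind_lift R M N).

Definition cotensor_setting :
    coalgebra_setting (rmorph_op (tring_of_ring M N) : {rmorphism op R -> op T}) :=
  @CoalgebraSetting (op R) (op T) (rmorph_op (tring_of_ring M N)) (hom_functor M) N.+1
    (@hom_left_exact R M) (hom_functor_nilpotent M_nilpotent)
    (@costruct R M N) (@costruct_nat R M N) (@tring_op_linear R M N)
    (@stalk_op R M N) (@stalk_op_val R M N)
    (fun A a a0 => a0) (fun A a => ex_intro _ a erefl) (@costruct_stalk_op R M N)
    (Coind M N) (@coind_ev R M N) (@coind_const R M N)
    (fun A => @coind_sect R M N A M_nilpotent)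
    (@coind_ev_const R M N) (@coind_costruct_const R M N)
    (fun A => @coind_costruct_sect R M N A M_nilpotent)
    (fun A => @coind_split R M N A M_nilpotent) (@coind_lift R M N).

Lemma admissible_setting (X : lmodType R -> Prop) :
  admissible M X -> as_admissible tensor_setting X.
Proof.
move=> adm G A k G_GP XA; have [ext tor] := adm G A k G_GP XA.
have iso B : isomorphic (tensor (tensor_pow M k) B) (fun_pow (tensor_functor M) k B).
  apply: isomorphic_sym; rewrite -{2}(addn0 k).
  exact/fun_pow_tensor/isomorphic_sym/tensor_regular.
split; first exact: Ext1_vanishes_iso_r (iso A) ext.
exact: (@derived1_vanishes_iso _ (tensor_functor M) _ _ (iso G) tor).
Qed.

Lemma coadmissible_setting (Y : lmodType (op R) -> Prop) :
  coadmissible M Y -> cs_coadmissible cotensor_setting Y.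
Proof.
move=> adm G A k G_GI YA; have [ext extM] := adm G A k G_GI YA.
have iso B : isomorphic (rhom (tensor_pow M k) B) (fun_pow (hom_functor M) k B).
  apply: isomorphic_sym; rewrite -{2}(addn0 k).
  exact/fun_pow_rhom/isomorphic_sym/rhom_regular.
split; first exact: Ext1_vanishes_iso_l (iso A) ext.
move=> E D i q iq h.
have [h' h'E] := Ext1_vanishes_lifts (Ext1_vanishes_iso_r (iso G) extM) iq h.
by exists h'; apply: hom_ext.
Qed.

End Instances.

Theorem theorem1 (R : nzRingType) (M : bimodule R R) (N : nat)
  (M_nilpotent : nilpotent_bimod M N)
  (X : lmodType R -> Prop) (Y : lmodType (op R) -> Prop)
  (X_proj : forall P : lmodType R, projective P -> X P)
  (Y_inj : forall I : lmodType (op R), injective_module I -> Y I) :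
  (compatible M N X -> admissible M X ->
     forall V : lmodType (tensor_ring M N),
       Gorenstein_projective (Ind_class X) V <->
       Phi (Gorenstein_projective X) V) /\
  (cocompatible M N Y -> coadmissible M Y ->
     forall V : lmodType (op (tensor_ring M N)),
       Gorenstein_injective (Coind_class Y) V <->
       Psi (Gorenstein_injective Y) V).
Proof.
split=> [compat adm V|cocompat coadm V].
  pose C := tensor_setting M_nilpotent; split=> [V_GP|[V_inj top_GP]].
    have [] := @Gorenstein_projective_ind_top _ _ _ C X compat V V_GP.
    by move=> /mono_injective.
  apply: (@Gorenstein_projective_of_top _ _ _ C X X_proj _ V _ top_GP).
    exact: admissible_setting.
  exact/mono_injective.
pose C := cotensor_setting M_nilpotent; split=> [V_GI|[V_epi socle_GI]].
  exact: (@Gorenstein_injective_coind_socle _ _ _ C Y cocompat V V_GI).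
apply: (@Gorenstein_injective_of_socle _ _ _ C Y Y_inj _ V V_epi socle_GI).
exact: coadmissible_setting.
Qed.
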